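(* Let $\alpha\in(0,1]$, $\beta=\sqrt{1-\alpha^2}$, $c>0$, $T\in\mathbb{R}$, and let $m_{c,\alpha}=(m_{1,c,\alpha},m_{2,c,\alpha},m_{3,c,\alpha})$ be the first vector of the solution $(m,n,b)$ of the Serret--Frenet system $$m'=k\,n,\qquad n'=-k\,m+\tau\, b,\qquad b'=-\tau\, n\qquad\text{on }\mathbb{R},$$ with $k(x)=c\,e^{\alpha x^2/4}$, $\tau(x)=-\dfrac{\sqrt{1-\alpha^2}\,x}{2}$ and initial conditions $m(0)=(1,0,0)$, $n(0)=(0,1,0)$, $b(0)=(0,0,1)$. Define $$\mathrm{m}_{c,\alpha}(x,t)=m_{c,\alpha}\Big(\frac{x}{\sqrt{T-t}}\Big),\qquad x\in\mathbb{R},\ t<T,$$ with components $\mathrm{m}_{c,\alpha}=(\mathrm{m}_{1,c,\alpha},\mathrm{m}_{2,c,\alpha},\mathrm{m}_{3,c,\alpha})$, and $\Phi_\alpha(x)=\int_0^x e^{\alpha s^2/4}\,ds$. Then the following hold. (i) The function $\mathrm{m}_{c,\alpha}$ belongs to $C^\infty(\mathbb{R}\times(-\infty,T);\mathbb{S}^2)$, solves $$\partial_t \mathrm{m}=\beta\,\mathrm{m}\times\partial_{xx}\mathrm{m}-\alpha\,\mathrm{m}\times(\mathrm{m}\times\partial_{xx}\mathrm{m})$$ for $t\in(-\infty,T)$, and $$|\partial_x\mathrm{m}_{c,\alpha}(x,t)|=\frac{c}{\sqrt{T-t}}\,e^{\frac{\alpha x^2}{4(T-t)}}\quad\text{for all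 }(x,t)\in\mathbb{R}\times(-\infty,T).$$ (ii) $m_{1,c,\alpha}$ is even, while $m_{2,c,\alpha}$ and $m_{3,c,\alpha}$ are odd. (iii) There exist constants $\rho_{j,c,\alpha}\in[0,1]$, $B_{j,c,\alpha}\in[-1,1]$ and $\phi_{j,c,\alpha}\in[0,2\pi)$, $j\in\{1,2,3\}$, such that for all $x\ge1$ $$\begin{aligned}m_{j,c,\alpha}(x)=&\ \rho_{j,c,\alpha}\cos(c\Phi_\alpha(x)-\phi_{j,c,\alpha})-\frac{\beta B_{j,c,\alpha}}{2c}\,x e^{-\alpha x^2/4}\\&+\frac{\beta^2\rho_{j,c,\alpha}}{8c}\sin(c\Phi_\alpha(x)-\phi_{j,c,\alpha})\int_x^\infty s^2e^{-\alpha s^2/4}\,ds+\frac{\beta}{\alpha^5c^2}\,O(x^2e^{-\alpha x^2/2}),\end{aligned}$$ and $$\begin{aligned}m_{j,c,\alpha}'(x)=&-c\rho_{j,c,\alpha}\sin(c\Phi_\alpha(x)-\phi_{j,c,\alpha})\,e^{\alpha x^2/4}\\&+\frac{\beta^2\rho_{j,c,\alpha}}{8}\cos(c\Phi_\alpha(x)-\phi_{j,c,\alpha})\,e^{\alpha x^2/4}\int_x^\infty s^2e^{-\alpha s^2/4}\,ds+\frac{\beta}{\alpha^5c}\,O(x^2e^{-\alpha x^2/4}).\end{aligned}$$ Moreover, these constants satisfy $$\rho_{1,c,\alpha}^2+\rho_{2,c,\alpha}^2+\rho_{3,c,\alpha}^2=2,\qquad B_{1,c,\alpha}^2+B_{2,c,\alpha}^2+B_{3,c,\alpha}^2=1,\qquad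 \rho_{j,c,\alpha}^2+B_{j,c,\alpha}^2=1,\ j\in\{1,2,3\}.$$ (iv) With the constants of (iii), and setting $\rho^-_{1,c,\alpha}=\rho_{1,c,\alpha}$, $\rho^-_{2,c,\alpha}=-\rho_{2,c,\alpha}$, $\rho^-_{3,c,\alpha}=-\rho_{3,c,\alpha}$, for $j\in\{1,2,3\}$ one has the pointwise convergences $$\lim_{t\to T^-}\Big(\mathrm{m}_{j,c,\alpha}(x,t)-\rho_{j,c,\alpha}\cos\Big(c\,\Phi_\alpha\Big(\frac{x}{\sqrt{T-t}}\Big)-\phi_{j,c,\alpha}\Big)\Big)=0\quad\text{if }x>0,$$ $$\lim_{t\to T^-}\Big(\mathrm{m}_{j,c,\alpha}(x,t)-\rho^-_{j,c,\alpha}\cos\Big(c\,\Phi_\alpha\Big(\frac{-x}{\sqrt{T-t}}\Big)-\phi_{j,c,\alpha}\Big)\Big)=0\quad\text{if }x<0.$$ (v) For any $\varphi\in W^{1,\infty}(\mathbb{R};\mathbb{R}^3)$, $$\lim_{t\to T^-}\int_{\mathbb{R}}\mathrm{m}_{c,\alpha}(x,t)\cdot\varphi(x)\,dx=0.$$ In particular, $\mathrm{m}_{c,\alpha}(\cdot,t)\to0$ as $t\to T^-$ as a tempered distribution.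
   Context: $\mathbb{S}^2$ is the unit sphere in $\mathbb{R}^3$ and $\times$ is the cross product in $\mathbb{R}^3$. The equation in (i) is the one-dimensional Landau--Lifshitz--Gilbert equation. The big-$O$ in the asymptotics of $m_{j,c,\alpha}$ in (iii) does not depend on the parameters: there is a universal constant $C>0$ such that $|O(x^2e^{-\alpha x^2/2})|\le Cx^2e^{-\alpha x^2/2}$ for all $x\ge1$. *)

(* Defs.v *)
From HB Require Import structures.
From mathcomp Require Import all_boot all_order all_algebra.
From mathcomp Require Import all_classical all_reals all_analysis.
Import numFieldNormedType.Exports.
Import Order.TTheory GRing.Theory Num.Theory.

Set Implicit Arguments.
Unset Strict Implicit.
Unset Printing Implicit Defensive.

Local Open Scope classical_set_scope.
Local Open Scope ring_scope.

(** The norm `|u| that the library puts on 'rV[R]_3 is the sup norm, hence the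
    separate Euclidean structure. *)

Definition dot (R : realType) (u v : 'rV[R]_3) : R :=
  \sum_(j < 3) u 0 j * v 0 j.

Definition enorm (R : realType) (u : 'rV[R]_3) : R := Num.sqrt (dot u u).

Definition sphere2 (R : realType) : set 'rV[R]_3 := [set u | enorm u = 1].

Definition cross (R : realType) (u v : 'rV[R]_3) : 'rV[R]_3 :=
  \row_(j < 3) [:: u 0 1 * v 0 2 - u 0 2 * v 0 1;
                   u 0 2 * v 0 0 - u 0 0 * v 0 2;
                   u 0 0 * v 0 1 - u 0 1 * v 0 0]`_j.

Definition dx (R : realType) (W : normedModType R) (f : R * R -> W)
  : R * R -> W := 'D_(1, 0) f.

Definition dt (R : realType) (W : normedModType R) (f : R * R -> W)
  : R * R -> W := 'D_(0, 1) f.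

(** For U open: all partial derivatives of order at most k exist and are
    continuous on U. *)
Fixpoint Ck (R : realType) (W : normedModType R) (k : nat) (U : set (R * R))
    (f : R * R -> W) : Prop :=
  (forall p, U p -> {for p, continuous f}) /\
  if k is k'.+1 then
    [/\ forall p, U p -> derivable f p (1, 0) /\ derivable f p (0, 1),
        Ck k' U (dx f) & Ck k' U (dt f)]
  else True.

Definition Cinfty (R : realType) (W : normedModType R) (U : set (R * R))
  (f : R * R -> W) : Prop := forall k, Ck k U f.

Definition serret_frenet (R : realType) (c alpha : R) (m n b : R -> 'rV[R]_3)
    : Prop :=
  let k := fun x : R => c * expR (alpha * x ^+ 2 / 4) in
  let tau := fun x : R => - (Num.sqrt (1 - alpha ^+ 2) * x / 2) in
  [/\ forall x : R,
        [/\ is_derive x 1 m (k x *: n x),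
            is_derive x 1 n (- (k x *: m x) + tau x *: b x) &
            is_derive x 1 b (- (tau x *: n x))],
      m 0 = delta_mx 0 0, n 0 = delta_mx 0 1 & b 0 = delta_mx 0 2].

(** Only meaningful for [p.2 < T]. *)
Definition self_similar (R : realType) (m : R -> 'rV[R]_3) (T : R)
  (p : R * R) : 'rV[R]_3 := m (p.1 / Num.sqrt (T - p.2)).

Definition LLG_at (R : realType) (alpha beta : R) (u : R * R -> 'rV[R]_3)
    (p : R * R) : Prop :=
  dt u p = beta *: cross (u p) (dx (dx u) p)
           - alpha *: cross (u p) (cross (u p) (dx (dx u) p)).

(** Integral from a to b with the usual sign convention when [b < a]. *)
Definition oriented_integral (R : realType) (a b : R) (f : R -> R) : R :=
  if a <= b then \int[lebesgue_measure]_(s in `[a, b]) f s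
  else - \int[lebesgue_measure]_(s in `[b, a]) f s.

Definition Phi (R : realType) (alpha x : R) : R :=
  oriented_integral 0 x (fun s => expR (alpha * s ^+ 2 / 4)).

Definition gauss_tail (R : realType) (alpha x : R) : R :=
  \int[lebesgue_measure]_(s in `[x, +oo[) (s ^+ 2 * expR (- alpha * s ^+ 2 / 4)).

(** The integral of f over R is l, as the limit of the Lebesgue integrals over
    [a, b] when a -> -oo and b -> +oo independently: the product of an oscillating
    map and a bounded function need not be Lebesgue integrable on R. *)
Definition improper_integral (R : realType) (f : R -> R) (l : R) : Prop :=
  (forall a b : R, lebesgue_measure.-integrable `[a, b] (EFin \o f)) /\
  (fun ab : R * R => \int[lebesgue_measure]_(x in `[ab.1, ab.2]) f x)
    @ filter_prod (-oo : set_system R) (+oo : set_system R) --> l.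

Definition smooth (R : realType) (eta : R -> R) : Prop :=
  forall (k : nat) (x : R), derivable (derive1n k eta) x 1.

Definition test_function (R : realType) (eta : R -> R) : Prop :=
  smooth eta /\ compact (closure [set x | eta x != 0]).

Definition Linfty (R : realType) (f : R -> R) : Prop :=
  f \in Lfun (@lebesgue_measure R) +oo%E.

Definition weak_derivative (R : realType) (f g : R -> R) : Prop :=
  forall eta : R -> R, test_function eta ->
    \int[lebesgue_measure]_(x in setT) (f x * derive1 eta x)
    = - \int[lebesgue_measure]_(x in setT) (g x * eta x).

Definition W1infty (R : realType) (f : R -> R) : Prop :=
  Linfty f /\ exists2 g : R -> R, Linfty g & weak_derivative f g.

Definition W1infty3 (R : realType) (phi : R -> 'rV[R]_3) : Prop :=
  forall j : 'I_3, W1infty (fun x => phi x 0 j).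

Definition schwartz (R : realType) (eta : R -> R) : Prop :=
  smooth eta /\
  forall k l : nat, exists M : R, forall x : R, `|x ^+ k * derive1n l eta x| <= M.

(** [u t -> 0] along F in the space of tempered distributions (weak-* topology),
    where the function [u t] is identified componentwise with the distribution
    [eta |-> \int u t x * eta x dx]. *)
Definition tempered_cvg0 (R : realType) (F : set_system R)
    (u : R -> R -> 'rV[R]_3) : Prop :=
  forall (j : 'I_3) (eta : R -> R), schwartz eta ->
    (\forall t \near F, lebesgue_measure.-integrable setT
       (fun x : R => (u t x 0 j * eta x)%:E)) /\
    (fun t => \int[lebesgue_measure]_(x in setT) (u t x 0 j * eta x))
      @ F --> (0 : R).

(** [C] bounds the functions abbreviated by the big-O symbols. *)
Definition profile_asymptotics (R : realType) (C c alpha beta : R)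
    (m : R -> R) (rho B phi : R) : Prop :=
  forall x : R, 1 <= x -> exists O1 O2 : R,
    [/\ `|O1| <= C * (x ^+ 2 * expR (- alpha * x ^+ 2 / 2)),
        `|O2| <= C * (x ^+ 2 * expR (- alpha * x ^+ 2 / 4)),
        m x = rho * cos (c * Phi alpha x - phi)
              - beta * B / (2 * c) * x * expR (- alpha * x ^+ 2 / 4)
              + beta ^+ 2 * rho / (8 * c) * sin (c * Phi alpha x - phi)
                * gauss_tail alpha x
              + beta / (alpha ^+ 5 * c ^+ 2) * O1 &
        derive1 m x = - (c * rho * sin (c * Phi alpha x - phi)
                     * expR (alpha * x ^+ 2 / 4))
              + beta ^+ 2 * rho / 8 * cos (c * Phi alpha x - phi)
                * expR (alpha * x ^+ 2 / 4) * gauss_tail alpha x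
              + beta / (alpha ^+ 5 * c) * O2].

(** The sign change of j = 1, 2 reflects the parity of the components m_j; the
    components are numbered from 0. *)
Definition rho_minus (R : realType) (rho : 'I_3 -> R) (j : 'I_3) : R :=
  if j == 0 then rho j else - rho j.

(* Main.v *)
(** For each coordinate, W = exp (i c Phi) (m + i n) satisfies
    W' = i tau b exp (i c Phi), where tau / k is of size x exp (- alpha x^2 / 4).
    Integrating by parts against the phase shows that W and b converge at
    infinity, to rho exp (i phi) and B, and gives the rate; inserting the rate
    into W' and integrating by parts once more gives the expansion, with an
    error of size 1 / k^2. The relations between the constants are the
    orthonormality of the frame, passed to the limit.

    For the weak convergence, m = - (n / k)' + r with r integrable, so after the
    scaling by lambda = sqrt (T - t) an integration by parts bounds the pairing
    of m with a function of W^{1,oo} by a multiple of lambda. *)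

Require Import Defs.
From HB Require Import structures.
From mathcomp Require Import all_boot all_order all_algebra.
From mathcomp Require Import all_classical all_reals all_analysis.
From mathcomp Require Import measurable_realfun ess_sup_inf.
From mathcomp Require Import ring lra.
Import numFieldNormedType.Exports.
Import Order.TTheory GRing.Theory Num.Theory.

Set Implicit Arguments.
Unset Strict Implicit.
Unset Printing Implicit Defensive.

Local Open Scope classical_set_scope.
Local Open Scope ring_scope.

(** * Derivatives of real functions *)

(** The error bounds must hold with one constant for all [c] and [alpha], and must keep a factor
    [beta], so limits and rates are obtained together. An integration by parts is done by algebra:
    the boundary term is added to the function, and the derivative of the sum is compared with that
    of an explicit majorant tending to 0 ([derive_dominated_cvg]). Such a comparison costs
    [alpha ^- 2]; the rate found by the first one enters the second, whence [alpha ^- 4], which is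
    weakened to [alpha ^- 5].

    The second integration by parts meets a product of two oscillating factors, whose mean is not
    zero. The mean produces the term with the Gaussian tail, and only the remainder, which turns
    twice as fast as the phase, can be integrated by parts again.

    In the weak convergence the obstacle is that a function of W^{1,oo} is known only almost
    everywhere and through test functions: it is truncated to be bounded everywhere, and smooth
    cutoffs stand for the boundary terms. The Gaussian weights are dominated by [1 / (1 + y ^+ 2)],
    whose primitive [atan] makes every bound explicit in lambda. *)

Section OneVariableCalculus.
Variable R : realType.
Implicit Types (f g : R -> R) (x a b : R).

Lemma is_derive_addf f g x a b : is_derive x 1 f a -> is_derive x 1 g b ->
  is_derive x 1 (fun y => f y + g y) (a + b).
Proof. by move=> df dg; exact: is_deriveD. Qed.

Lemma is_derive_subf f g x a b : is_derive x 1 f a -> is_derive x 1 g b ->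
  is_derive x 1 (fun y => f y - g y) (a - b).
Proof. by move=> df dg; exact: is_deriveB. Qed.

Lemma is_derive_oppf f x a : is_derive x 1 f a ->
  is_derive x 1 (fun y => - f y) (- a).
Proof. by move=> df; exact: is_deriveN. Qed.

Lemma is_derive_mulf f g x a b : is_derive x 1 f a -> is_derive x 1 g b ->
  is_derive x 1 (fun y => f y * g y) (a * g x + f x * b).
Proof.
move=> df dg; have := is_deriveM df dg => /is_derive_eq; apply.
by rewrite addrC /GRing.scale /= [g x * _]mulrC.
Qed.

Lemma is_derive_expf f x a n : is_derive x 1 f a ->
  is_derive x 1 (fun y => f y ^+ n) (n%:R * f x ^+ n.-1 * a).
Proof.
case: n => [|n] df; first by rewrite !mul0r; exact: is_derive_cst.
have -> : (fun y => f y ^+ n.+1) = (fun y => f y) ^+ n.+1.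
  by apply/funext => y; rewrite /= exprfctE.
by apply: is_derive_eq; rewrite /GRing.scale /= mulrC mulr_natl mulrC.
Qed.

Lemma is_derive_invf f x a : f x != 0 -> is_derive x 1 f a ->
  is_derive x 1 (fun y => (f y)^-1) (- a / f x ^+ 2).
Proof.
move=> fx df; have /is_derive_eq := is_deriveV fx df; apply.
by rewrite /GRing.scale /= mulrC mulrN mulNr.
Qed.

Lemma is_derive_expRf f x a : is_derive x 1 f a ->
  is_derive x 1 (fun y => expR (f y)) (expR (f x) * a).
Proof. by move=> df; exact: (is_derive1_comp (f := expR)). Qed.

Lemma is_derive_cosf f x a : is_derive x 1 f a ->
  is_derive x 1 (fun y => cos (f y)) (- sin (f x) * a).
Proof. by move=> df; exact: (is_derive1_comp (f := cos)). Qed.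

Lemma is_derive_sinf f x a : is_derive x 1 f a ->
  is_derive x 1 (fun y => sin (f y)) (cos (f x) * a).
Proof. by move=> df; exact: (is_derive1_comp (f := sin)). Qed.

Lemma is_derive_affine f x a r s : is_derive (r * x + s) 1 f a ->
  is_derive x 1 (fun y => f (r * y + s)) (r * a).
Proof.
move=> df; rewrite mulrC.
apply: (is_derive1_comp (f := f) (g := fun y => r * y + s)) => //.
have dr := is_derive_mulf (is_derive_cst r x 1) (is_derive_id x 1).
have /is_derive_eq := is_derive_addf dr (is_derive_cst s x 1); apply.
by rewrite mul0r add0r addr0 mulr1.
Qed.

End OneVariableCalculus.

(* [notypeclasses refine] keeps instance resolution from closing the premises
   with values in the form [f x *: df], on which [ring] fails. *)
Ltac derive :=
  match goal with
  | H : is_derive ?x _ ?f _ |- is_derive ?x _ ?f _ => exact: H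
  | H : forall z, is_derive z _ ?f _ |- is_derive _ _ ?f _ => exact: H
  | H : forall z, is_derive z _ (fun y => ?f y) _ |- is_derive _ _ ?f _ => exact: H
  | |- is_derive _ _ (fun y => y) _ => exact: is_derive_id
  | |- is_derive _ _ (fun _ => ?c) _ => exact: is_derive_cst
  | |- is_derive _ _ (fun y => (@?f y - @?g y)%R) _ =>
      notypeclasses refine (@is_derive_subf _ f g _ _ _ _ _); cbv beta; derive
  | |- is_derive _ _ (fun y => (@?f y + @?g y)%R) _ =>
      notypeclasses refine (@is_derive_addf _ f g _ _ _ _ _); cbv beta; derive
  | |- is_derive _ _ (fun y => (- @?f y)%R) _ =>
      notypeclasses refine (@is_derive_oppf _ f _ _ _); cbv beta; derive
  | |- is_derive _ _ (fun y => (@?f y * @?g y)%R) _ =>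
      notypeclasses refine (@is_derive_mulf _ f g _ _ _ _ _); cbv beta; derive
  | |- is_derive _ _ (fun y => (@?f y ^+ ?n)%R) _ =>
      notypeclasses refine (@is_derive_expf _ f _ _ _ _); cbv beta; derive
  | |- is_derive _ _ (fun y => (@?f y)^-1%R) _ =>
      notypeclasses refine (@is_derive_invf _ f _ _ _ _); cbv beta; [ | derive]
  | |- is_derive _ _ (fun y => expR (@?f y)) _ =>
      notypeclasses refine (@is_derive_expRf _ f _ _ _); cbv beta; derive
  | |- is_derive _ _ (fun y => cos (@?f y)) _ =>
      notypeclasses refine (@is_derive_cosf _ f _ _ _); cbv beta; derive
  | |- is_derive _ _ (fun y => sin (@?f y)) _ =>
      notypeclasses refine (@is_derive_sinf _ f _ _ _); cbv beta; derive
  | _ => idtac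
  end.

Ltac derive_eq := notypeclasses refine (is_derive_eq _ _); [derive | cbv beta].

Lemma derive0_cst (R : realType) (f : R -> R) :
  (forall x : R, is_derive x 1 f 0) -> forall x y, f x = f y.
Proof. by move=> df x y; exact: is_derive_0_is_cst. Qed.

(** * The Serret-Frenet frame *)

(** The antisymmetry makes [u ^+ 2 + v ^+ 2 + w ^+ 2] constant. Applied to differences, this is the
    uniqueness theorem for the Serret-Frenet system. *)
Lemma antisymmetric_system_eq0 (R : realType) (k t u v w : R -> R) :
    (forall x : R, is_derive x 1 u (k x * v x)) ->
    (forall x : R, is_derive x 1 v (- k x * u x + t x * w x)) ->
    (forall x : R, is_derive x 1 w (- t x * v x)) ->
    u 0 = 0 -> v 0 = 0 -> w 0 = 0 ->
  forall x, [/\ u x = 0, v x = 0 & w x = 0].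
Proof.
move=> du dv dw u0 v0 w0 x.
have E : u x ^+ 2 + v x ^+ 2 + w x ^+ 2 = 0.
  pose f y := u y ^+ 2 + v y ^+ 2 + w y ^+ 2.
  have -> : 0 = f 0 by rewrite /f u0 v0 w0 expr0n /= !addr0.
  by apply: (derive0_cst (f := f)) => y; rewrite /f; derive_eq; ring.
move: E => /eqP; rewrite !paddr_eq0 ?addr_ge0 ?sqr_ge0 // !sqrf_eq0.
by move=> /andP[/andP[/eqP-> /eqP->] /eqP->].
Qed.

Lemma rowP3 (R : realType) (u v : 'rV[R]_3) :
  u 0 0 = v 0 0 -> u 0 1 = v 0 1 -> u 0 2 = v 0 2 -> u = v.
Proof.
move=> u0 u1 u2; apply/rowP => -[[|[|[|//]]] p].
- by have -> : Ordinal p = 0 by exact: val_inj.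
- by have -> : Ordinal p = 1 by exact: val_inj.
- by have -> : Ordinal p = 2 by exact: val_inj.
Qed.

Section Frame.
Variables (R : realType) (c alpha : R) (m n b : R -> 'rV[R]_3).
Hypothesis SF : serret_frenet c alpha m n b.
Notation beta := (Num.sqrt (1 - alpha ^+ 2)).
Notation k := (fun x : R => c * expR (alpha * x ^+ 2 / 4)).
Notation tau := (fun x : R => - (beta * x / 2)).

Lemma is_derive_coord (f : R -> 'rV[R]_3) (x : R) v j : is_derive x 1 f v ->
  is_derive x 1 (fun y => f y 0 j) (v 0 j).
Proof.
move=> [df <-]; apply: DeriveDef; first by move/derivable_mxP : df.
by rewrite derive_mx // mxE.
Qed.

Lemma sf_m j (x : R) : is_derive x 1 (fun y => m y 0 j) (k x * n x 0 j).
Proof.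
have [/(_ x)[dm _ _] _ _ _] := SF.
by apply: is_derive_eq; [exact: is_derive_coord dm|rewrite !mxE].
Qed.

Lemma sf_n j (x : R) :
  is_derive x 1 (fun y => n y 0 j) (- k x * m x 0 j + tau x * b x 0 j).
Proof.
have [/(_ x)[_ dn _] _ _ _] := SF.
by apply: is_derive_eq; [exact: is_derive_coord dn|rewrite !mxE !mulNr].
Qed.

Lemma sf_b j (x : R) : is_derive x 1 (fun y => b y 0 j) (- tau x * n x 0 j).
Proof.
have [/(_ x)[_ _ db] _ _ _] := SF.
by apply: is_derive_eq; [exact: is_derive_coord db|rewrite !mxE !mulNr].
Qed.

Lemma sf_0 : [/\ forall j, m 0 0 j = (j == 0)%:R,
  forall j, n 0 0 j = (j == 1)%:R & forall j, b 0 0 j = (j == 2)%:R].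
Proof. by have [_ -> -> ->] := SF; split=> j; rewrite mxE eqxx. Qed.

(* The columns of the matrix with rows m, n, b solve a system with
   antisymmetric matrix, hence keep their scalar products. *)
Lemma sf_col (x : R) i j :
  m x 0 i * m x 0 j + n x 0 i * n x 0 j + b x 0 i * b x 0 j = (i == j)%:R.
Proof.
have dm := sf_m; have dn := sf_n; have db := sf_b.
pose f y := m y 0 i * m y 0 j + n y 0 i * n y 0 j + b y 0 i * b y 0 j.
have -> : (i == j)%:R = f 0.
  have [m0 n0 b0] := sf_0; rewrite /f !m0 !n0 !b0; clear f.
  case: i j => [[|[|[|i]]] Hi] [[|[|[|j]]] Hj] //=;
    by rewrite ?mulr0 ?mul0r ?mulr1 ?addr0 ?add0r.
apply: (derive0_cst (f := f)) => y; rewrite /f.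
have := dm i; have := dm j; have := dn i; have := dn j; have := db i; have := db j.
move=> *; derive_eq; ring.
Qed.

(** The cross products of the vectors of the frame solve the same system as the frame, so uniqueness
    propagates the relations from 0. One statement serves the three cyclic choices of the
    indices. *)
Lemma sf_minors (i j l : 'I_3) :
    (forall x, x = 0 -> [/\ n x 0 i * b x 0 j - n x 0 j * b x 0 i = m x 0 l,
      b x 0 i * m x 0 j - b x 0 j * m x 0 i = n x 0 l &
      m x 0 i * n x 0 j - m x 0 j * n x 0 i = b x 0 l]) ->
  forall x, [/\ n x 0 i * b x 0 j - n x 0 j * b x 0 i = m x 0 l,
    b x 0 i * m x 0 j - b x 0 j * m x 0 i = n x 0 l &
    m x 0 i * n x 0 j - m x 0 j * n x 0 i = b x 0 l].
Proof.
move=> /(_ 0 erefl)[E0 G0 D0] x.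
have dmi := sf_m i; have dni := sf_n i; have dbi := sf_b i.
have dmj := sf_m j; have dnj := sf_n j; have dbj := sf_b j.
have dml := sf_m l; have dnl := sf_n l; have dbl := sf_b l.
have [||||||/eqP + /eqP + /eqP] := @antisymmetric_system_eq0 R k tau
  (fun x => n x 0 i * b x 0 j - n x 0 j * b x 0 i - m x 0 l)
  (fun x => b x 0 i * m x 0 j - b x 0 j * m x 0 i - n x 0 l)
  (fun x => m x 0 i * n x 0 j - m x 0 j * n x 0 i - b x 0 l) _ _ _ _ _ _ x.
- by move=> y; derive_eq; ring.
- by move=> y; derive_eq; ring.
- by move=> y; derive_eq; ring.
- by rewrite E0 subrr.
- by rewrite G0 subrr.
- by rewrite D0 subrr.
by rewrite !subr_eq0 => /eqP-> /eqP-> /eqP->.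
Qed.

Lemma sf_cross (x : R) : cross (m x) (n x) = b x /\ cross (m x) (b x) = - n x.
Proof.
have [m0 n0 b0] := sf_0.
have H (i j l : 'I_3) : (i, j, l) \in [:: (1, 2, 0); (2, 0, 1); (0, 1, 2)] ->
    [/\ n x 0 i * b x 0 j - n x 0 j * b x 0 i = m x 0 l,
    b x 0 i * m x 0 j - b x 0 j * m x 0 i = n x 0 l &
    m x 0 i * n x 0 j - m x 0 j * n x 0 i = b x 0 l].
  move=> ijl; apply: sf_minors => _ ->; rewrite !m0 !n0 !b0.
  move: ijl; rewrite !inE => /or3P[] /eqP[-> -> ->] /=;
    by split; ring.
have [_ G0 D0] := H 1 2 0 isT; have [_ G1 D1] := H 2 0 1 isT.
have [_ G2 D2] := H 0 1 2 isT.
split; apply: rowP3; rewrite !mxE /=.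
- exact: D0.
- exact: D1.
- exact: D2.
- by rewrite -G0; ring.
- by rewrite -G1; ring.
- by rewrite -G2; ring.
Qed.

(** [sf_col] gives orthonormal columns; a left inverse of a square matrix is a right inverse, so the
    rows are orthonormal too. *)
Lemma sf_norm (x : R) :
  [/\ dot (m x) (m x) = 1, dot (n x) (n x) = 1 & dot (b x) (b x) = 1].
Proof.
pose F : 'M[R]_3 := \matrix_(i, j) [:: m x 0 j; n x 0 j; b x 0 j]`_i.
have FT : F^T *m F = 1%:M.
  apply/matrixP => i j; rewrite !mxE -(sf_col x i j).
  by rewrite !big_ord_recl big_ord0 !mxE /= addr0 addrA.
have /mulmx1C/matrixP FF := FT.
by split; [have := FF 0 0|have := FF 1 1|have := FF 2 2];
  rewrite mxE [RHS]mxE eqxx mulr1n => <-;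
  apply: eq_bigr => j _; rewrite !mxE.
Qed.

(** [k] is even and [tau] is odd, so the triple [m (- x)], [- n (- x)], [- b (- x)] solves the same
    system. The sign [s] matches its initial values in coordinate [j]. *)
Lemma sf_parity (x : R) (j : 'I_3) (s : R) : s = (if j == 0 then 1 else -1) ->
  [/\ m (- x) 0 j = s * m x 0 j, n (- x) 0 j = - s * n x 0 j
    & b (- x) 0 j = - s * b x 0 j].
Proof.
move=> sj; have ss : s * s = 1 by rewrite sj; case: ifP; rewrite ?mulrNN mulr1.
have [m0 n0 b0] := sf_0.
have dm := sf_m j; have dn := sf_n j; have db := sf_b j.
have refl (f : R -> R) (y a : R) : is_derive (- y) 1 f a ->
    is_derive y 1 (fun z => f (- z)) (- a).
  move=> df; have -> : (fun z => f (- z)) = (fun z => f (-1 * z + 0)).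
    by apply/funext => z; rewrite mulN1r addr0.
  rewrite -[- a]mulN1r; apply: is_derive_affine.
  by rewrite mulN1r addr0.
have [|||||| E1 E2 E3] := @antisymmetric_system_eq0 R k tau
  (fun x => m (- x) 0 j - s * m x 0 j)
  (fun x => - n (- x) 0 j - s * n x 0 j)
  (fun x => - b (- x) 0 j - s * b x 0 j) _ _ _ _ _ _ x.
- move=> y; have dm' := refl _ _ _ (dm (- y)).
  by derive_eq; rewrite sqrrN; ring.
- move=> y; have dn' := refl _ _ _ (dn (- y)).
  by derive_eq; rewrite sqrrN; ring.
- move=> y; have db' := refl _ _ _ (db (- y)).
  by derive_eq; ring.
- rewrite oppr0 m0 sj; case: ifP => /= _; ring.
- rewrite oppr0 n0 sj; case: eqP => [->|_] /=; ring.
- rewrite oppr0 b0 sj; case: eqP => [->|_] /=; ring.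
by split; lra.
Qed.

End Frame.

(** * Gaussian tails *)

Section Decay.
Variable R : realType.
Implicit Types (f g : R -> R) (x : R).

Lemma cvg0_pinfty_inv f (K : R) : (forall x, 1 <= x -> `|f x| <= K / x) ->
  f x @[x --> +oo] --> (0 : R).
Proof.
move=> fK; apply/cvgr0Pnorm_le => eps eps0.
near=> x.
have x1 : 1 <= x by near: x; exact: nbhs_pinfty_ge.
have x0 : 0 < x by exact: lt_le_trans x1.
have xK : K / eps <= x by near: x; apply: nbhs_pinfty_ge; exact: num_real.
by apply: le_trans (fK x x1) _; rewrite ler_pdivrMr // mulrC -ler_pdivrMr.
Unshelve. all: by end_near. Qed.

(** With [- y] the exponent, [expR (y / 2)] is at least [y / 2]. Squaring gives the fourth power of
    [x], enough to beat the weight [x ^+ 2] in [cvg0_expRN]. *)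
Lemma expRN_quartic_le (a x : R) : 0 < a -> 0 < x ->
  expR (- a * x ^+ 2 / 4) <= 64 / (a ^+ 2 * x ^+ 4).
Proof.
move=> a0 x0; set y := a * x ^+ 2 / 4.
have y0 : 0 < y by rewrite /y divr_gt0 // mulr_gt0 // exprn_gt0.
rewrite (_ : - a * x ^+ 2 / 4 = - y); last by rewrite /y !mulNr.
rewrite expRN (_ : 64 / _ = (y ^+ 2 / 4)^-1); last first.
  by rewrite /y; field; rewrite !gt_eqF.
rewrite lef_pV2 ?posrE ?expR_gt0 ?divr_gt0 ?exprn_gt0 //.
have -> : expR y = expR (y / 2) ^+ 2 by rewrite -expRM_natr; congr expR; lra.
rewrite (_ : y ^+ 2 / 4 = (y / 2) ^+ 2); last by field.
apply: lerXn2r; rewrite ?nnegrE ?expR_ge0 ?(ltW (divr_gt0 y0 _)) //.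
by apply: le_trans (expR_ge1Dx _); rewrite lerDr.
Qed.

(* The limit is the supremum of [f - g]: each value of [f - g] is at most each
   value of [f + g]. *)
Lemma increment_bounded_cvg f g (a : R) :
    (forall x y, a <= x -> x <= y -> `|f y - f x| <= g x) ->
    g x @[x --> +oo] --> (0 : R) ->
  exists2 L, f x @[x --> +oo] --> L &
    forall x, a <= x -> `|f x - L| <= g x.
Proof.
move=> fg g0.
have g_ge0 x : a <= x -> 0 <= g x.
  by move=> ax; exact: le_trans (fg x x ax (lexx x)).
have cross x y : a <= x -> a <= y -> f x - g x <= f y + g y.
  move=> ax ay; have gx := g_ge0 x ax; have gy := g_ge0 y ay.
  have [xy|/ltW yx] := leP x y.
    by have := fg x y ax xy; rewrite ler_norml; lra.
  by have := fg y x ay yx; rewrite ler_norml; lra.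
pose A := [set f x - g x | x in [set x | a <= x]].
have A0 : A !=set0 by exists (f a - g a); exists a => //=.
have Aub y : a <= y -> ubound A (f y + g y).
  by move=> ay _ [x /= ax <-]; exact: cross.
pose L := sup A.
have fL x : a <= x -> `|f x - L| <= g x.
  move=> ax; rewrite ler_norml; apply/andP; split.
    have : L <= f x + g x by apply: ge_sup => //; exact: Aub.
    lra.
  have : f x - g x <= L.
    apply: ub_le_sup; last by exists x.
    by exists (f a + g a); apply: Aub.
  lra.
exists L => //; apply/cvgrPdist_le => eps eps0.
near=> x; rewrite distrC.
apply: le_trans (fL x _) _.
  by near: x; apply: nbhs_pinfty_ge; exact: num_real.
by apply: le_trans (ler_norm _) _; near: x; exact: cvgr0_norm_le.
Unshelve. all: by end_near. Qed.

(** Both [f + g] and [g - f] are nonincreasing, and [g] is nonnegative because it decreases to 0;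
    hence increments of [f] beyond [x] are at most [g x]. This replaces the absolutely convergent
    integral of [df]. *)
Lemma derive_dominated_cvg f g (df dg : R -> R) (a : R) :
    (forall x, a <= x -> is_derive x 1 f (df x)) ->
    (forall x, a <= x -> is_derive x 1 g (dg x)) ->
    (forall x, a <= x -> `|df x| <= - dg x) ->
    g x @[x --> +oo] --> (0 : R) ->
  exists2 L, f x @[x --> +oo] --> L &
    forall x, a <= x -> `|f x - L| <= g x.
Proof.
move=> Df Dg dfg g0.
have mono u (du : R -> R) : (forall x, a <= x -> is_derive x 1 u (du x)) ->
    (forall x, a <= x -> du x <= 0) ->
    forall x y, a <= x -> x <= y -> u y <= u x.
  move=> Du u0; apply: ler0_derive1_nincry => [x|x|].
  - by rewrite in_itv /= andbT => /ltW /Du[].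
  - by rewrite in_itv /= andbT => /ltW ax; rewrite derive1E; have [_ ->] := Du x ax;
      exact: u0.
  - apply/continuous_in_subspaceT => x; rewrite inE /= in_itv /= andbT => ax.
    by apply/differentiable_continuous/derivable1_diffP; have [] := Du x ax.
have mD x y : a <= x -> x <= y -> f y + g y <= f x + g x.
  apply: (mono (fun x => f x + g x) (fun x => df x + dg x)) => {x y}x ax.
    exact: is_derive_addf (Df x ax) (Dg x ax).
  by have := dfg x ax; rewrite ler_norml; lra.
have mB x y : a <= x -> x <= y -> g y - f y <= g x - f x.
  apply: (mono (fun x => g x - f x) (fun x => dg x - df x)) => {x y}x ax.
    exact: is_derive_subf (Dg x ax) (Df x ax).
  by have := dfg x ax; rewrite ler_norml; lra.
have mg x y : a <= x -> x <= y -> g y <= g x.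
  apply: (mono g dg) => {x y}x ax.
  by have := dfg x ax; have := normr_ge0 (df x); lra.
have g_ge0 x : a <= x -> 0 <= g x.
  move=> ax; rewrite leNgt; apply/negP => gx0.
  near (pinfty_nbhs R) => y.
  have xy : x <= y by near: y; apply: nbhs_pinfty_ge; exact: num_real.
  suff : g x < g y by rewrite ltNge mg.
  by near: y; exact: (cvgr_gt _ g0).
apply: increment_bounded_cvg g0 => x y ax xy.
have := mD x y ax xy; have := mB x y ax xy; have := g_ge0 y (le_trans ax xy).
by rewrite ler_norml; lra.
Unshelve. all: by end_near. Qed.

End Decay.

Section GaussianIntegrals.
Variable R : realType.
Implicit Types (f g : R -> R) (x a : R).

Lemma is_derive_continuous f x a : is_derive x 1 f a -> {for x, continuous f}.
Proof. by case=> df _; exact/differentiable_continuous/derivable1_diffP. Qed.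

Lemma continuous_integrable_segment f a x : continuous f ->
  (@lebesgue_measure R).-integrable `[a, x] (EFin \o f).
Proof.
move=> cf; apply: continuous_compact_integrable; first exact: segment_compact.
exact: continuous_subspaceT.
Qed.

Lemma is_derive_integral0 f x : continuous f -> 0 < x ->
  is_derive x 1 (fun y => \int[lebesgue_measure]_(s in `[0, y]) f s) (f x).
Proof.
move=> cf x0.
have [] := @continuous_FTC1_closed R f 0 x (x + 1) _ _ x0 (cf x).
- by rewrite ltrDl.
- exact: continuous_integrable_segment.
by move=> d1 d2; apply: DeriveDef; [exact: d1|rewrite -derive1E; exact: d2].
Qed.

Lemma is_derive_Phi a x : 0 < x -> is_derive x 1 (Phi a) (expR (a * x ^+ 2 / 4)).
Proof.
move=> x0; pose f s := expR (a * s ^+ 2 / 4).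
have cf : continuous f.
  by move=> y; apply: is_derive_continuous; rewrite /f; derive.
apply: near_eq_is_derive (is_derive_integral0 cf x0).
near=> y; rewrite /Phi /oriented_integral ifT //.
by apply: ltW; near: y; exact: lt_nbhsr.
Unshelve. all: by end_near. Qed.

Lemma is_derive_expRN a x : is_derive x 1 (fun y => expR (- a * y ^+ 2 / 4))
  (- (a * x / 2) * expR (- a * x ^+ 2 / 4)).
Proof. by derive_eq; field. Qed.

Lemma cvg0_expRN a (K : R) f : 0 < a ->
    (forall x, 1 <= x -> `|f x| <= K * (x ^+ 2 * expR (- a * x ^+ 2 / 4))) ->
  f x @[x --> +oo] --> (0 : R).
Proof.
move=> a0 fK; apply: (@cvg0_pinfty_inv _ _ (64 * `|K| / a ^+ 2)) => x x1.
have x0 : 0 < x by exact: lt_le_trans x1.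
apply: le_trans (fK x x1) _.
apply: le_trans (ler_norm _) _; rewrite normrM (ger0_norm (mulr_ge0 _ _)) ?sqr_ge0
  ?expR_ge0 //.
have := expRN_quartic_le a0 x0 => /(ler_wpM2l (sqr_ge0 x))/(ler_wpM2l (normr_ge0 K)).
move=> /le_trans; apply.
rewrite (_ : `|K| * _ = 64 * `|K| / a ^+ 2 / x * x^-1); last first.
  by field; rewrite !gt_eqF.
apply: ler_piMr; last by rewrite invf_le1.
by rewrite !mulr_ge0 ?invr_ge0 ?sqr_ge0 // ltW.
Qed.

(* Chosen so that its derivative is at most [- x ^+ 2 * expR (- a * x ^+ 2 / 4)]
   on [1, +oo). *)
Definition gauss_majorant a x := (2 / a * x + 4 / a ^+ 2) * expR (- a * x ^+ 2 / 4).

Lemma is_derive_gauss_majorant a x : a != 0 ->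
  is_derive x 1 (gauss_majorant a)
    (- (x ^+ 2 + 2 / a * (x - 1)) * expR (- a * x ^+ 2 / 4)).
Proof.
move=> a0; have de := is_derive_expRN a; rewrite /gauss_majorant.
by derive_eq; field.
Qed.

(** Integration gains one power of [x] over the integrand and costs [a ^- 2]: this is the source of
    the factor [alpha ^- 2] in the first-order rates. *)
Lemma gauss_majorant_le a x : 0 < a <= 1 -> 1 <= x ->
  gauss_majorant a x <= 6 / a ^+ 2 * (x * expR (- a * x ^+ 2 / 4)).
Proof.
move=> /andP[a0 a1] x1; rewrite mulrA ler_wpM2r ?expR_ge0 //.
rewrite (_ : 2 / a * x + 4 / a ^+ 2 = (2 * a * x + 4) / a ^+ 2); last first.
  by field; rewrite gt_eqF.
rewrite [leRHS]mulrAC ler_wpM2r ?invr_ge0 ?sqr_ge0 //.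
by nra.
Qed.

Lemma gauss_majorant_cvg0 a : 0 < a <= 1 -> gauss_majorant a x @[x --> +oo] --> 0.
Proof.
move=> /[dup] a01 /andP[a0 a1]; apply: (@cvg0_expRN a (6 / a ^+ 2)) => // x x1.
have x0 : 0 < x by exact: lt_le_trans x1.
rewrite ger0_norm; last first.
  by rewrite mulr_ge0 ?expR_ge0 // addr_ge0 ?mulr_ge0 ?invr_ge0 ?sqr_ge0 ?ltW.
apply: le_trans (gauss_majorant_le a01 x1) _.
rewrite ler_wpM2l ?divr_ge0 ?sqr_ge0 // ler_wpM2r ?expR_ge0 //.
by rewrite expr2 ler_peMl // ltW.
Qed.

(** The fundamental theorem on a half-line needs the limit of the primitive [A]. Comparison with
    [gauss_majorant] provides it, and the bound on the tail is the rate of that convergence. *)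
Lemma gauss_tail_spec a : 0 < a <= 1 ->
  (forall x, 0 < x ->
    is_derive x 1 (gauss_tail a) (- (x ^+ 2 * expR (- a * x ^+ 2 / 4)))) /\
  (forall x, 1 <= x -> `|gauss_tail a x| <= gauss_majorant a x).
Proof.
move=> /[dup] a01 /andP[a0 a1].
pose f (s : R) := s ^+ 2 * expR (- a * s ^+ 2 / 4).
have f0 s : 0 <= f s by rewrite /f mulr_ge0 ?expR_ge0 // sqr_ge0.
have cf : continuous f.
  by move=> y; apply: is_derive_continuous; rewrite /f; derive.
pose A x := \int[lebesgue_measure]_(s in `[0, x]) f s.
have dA x : 0 < x -> is_derive x 1 A (f x) by exact: is_derive_integral0.
have [|x x1|x x1||L AL Ale] := @derive_dominated_cvg R A (gauss_majorant a) f
  (fun x => - (x ^+ 2 + 2 / a * (x - 1)) * expR (- a * x ^+ 2 / 4)) 1.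
- by move=> x x1; apply: dA; exact: lt_le_trans x1.
- by apply: is_derive_gauss_majorant; rewrite gt_eqF.
- rewrite [X in - X]mulNr opprK ger0_norm // /f.
  rewrite ler_wpM2r ?expR_ge0 // lerDl mulr_ge0 ?subr_ge0 //.
  by rewrite divr_ge0 // ltW.
- exact: gauss_majorant_cvg0.
have GE x : 0 < x -> gauss_tail a x = L - A x.
  move=> x0; apply: (@Rintegral_ge0_continuous_FTC2y R f A) => //.
  - exact: continuous_subspaceT.
  - by move=> y xy; have [] := dA y (lt_trans x0 xy).
  - by apply: cvg_at_right_filter; exact: is_derive_continuous (dA x x0).
  - move=> y; rewrite in_itv /= andbT => xy; rewrite derive1E.
    by have [_ ->] := dA y (lt_trans x0 xy).
split=> x x0; last first.
  by rewrite (GE x (lt_le_trans ltr01 x0)) distrC; exact: Ale.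
apply: (@near_eq_is_derive _ _ _ (fun y => L - A y)).
  near=> y; rewrite GE //.
  by near: y; exact: lt_nbhsr.
have dAx := dA x x0; rewrite -/(f x).
by derive_eq; rewrite sub0r.
Unshelve. all: by end_near. Qed.

End GaussianIntegrals.

(** * Asymptotics of the profile *)

Section NormBounds.
Variable R : numDomainType.
Implicit Types x y a b : R.

Lemma normM_le x y a b : `|x| <= a -> `|y| <= b -> `|x * y| <= a * b.
Proof. by move=> xa yb; rewrite normrM ler_pM. Qed.

Lemma normD_le x y a b : `|x| <= a -> `|y| <= b -> `|x + y| <= a + b.
Proof. by move=> xa yb; rewrite (le_trans (ler_normD _ _)) ?lerD. Qed.

Lemma normB_le x y a b : `|x| <= a -> `|y| <= b -> `|x - y| <= a + b.
Proof. by move=> xa yb; rewrite (le_trans (ler_normB _ _)) ?lerD. Qed.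

End NormBounds.

Section Asymptotics.
Variables (R : realType) (alpha beta c : R) (m n b : R -> R).
Hypotheses (alpha01 : 0 < alpha <= 1) (beta01 : 0 <= beta <= 1) (c0 : 0 < c).
Let e (x : R) := expR (- alpha * x ^+ 2 / 4).
Hypothesis dm : forall x : R, 1 <= x -> is_derive x 1 m (c / e x * n x).
Hypothesis dn : forall x : R, 1 <= x ->
  is_derive x 1 n (- (c / e x) * m x - beta * x / 2 * b x).
Hypothesis db : forall x : R, 1 <= x -> is_derive x 1 b (beta * x / 2 * n x).
Hypothesis mnb : forall x, m x ^+ 2 + n x ^+ 2 + b x ^+ 2 = 1.

Let alpha0 : 0 < alpha. Proof. by case/andP: alpha01. Qed.
Let alpha1 : alpha <= 1. Proof. by case/andP: alpha01. Qed.
Let beta0 : 0 <= beta. Proof. by case/andP: beta01. Qed.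
Let beta1 : beta <= 1. Proof. by case/andP: beta01. Qed.
Let alpha_neq0 : alpha != 0. Proof. by rewrite gt_eqF. Qed.
Let c_neq0 : c != 0. Proof. by rewrite gt_eqF. Qed.
Let e_gt0 x : 0 < e x. Proof. exact: expR_gt0. Qed.
Let e_neq0 x : e x != 0. Proof. by rewrite gt_eqF. Qed.

Let e_le1 x : e x <= 1.
Proof.
rewrite expR_le1 !mulNr oppr_le0.
by rewrite divr_ge0 // mulr_ge0 ?sqr_ge0 // ltW.
Qed.

Let de (x : R) : is_derive x 1 e (- (alpha * x / 2) * e x).
Proof. exact: is_derive_expRN. Qed.

Let sqr_le1 (x : R) : x ^+ 2 <= 1 -> `|x| <= 1.
Proof. by move=> x1; rewrite -(@ler_pXn2r _ 2) ?nnegrE // expr1n real_normK ?num_real. Qed.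

Let m_le1 x : `|m x| <= 1.
Proof. by apply: sqr_le1; have := mnb x; nra. Qed.
Let n_le1 x : `|n x| <= 1.
Proof. by apply: sqr_le1; have := mnb x; nra. Qed.
Let b_le1 x : `|b x| <= 1.
Proof. by apply: sqr_le1; have := mnb x; nra. Qed.

Let x_le_sqr (x : R) : 1 <= x -> x <= x ^+ 2.
Proof. by nra. Qed.

Let quad_le (x : R) : 1 <= x -> `|1 - alpha * x ^+ 2 / 2| <= x ^+ 2.
Proof.
move=> x1; have y1 : 1 <= x ^+ 2 by nra.
have ay : alpha * x ^+ 2 <= x ^+ 2 by rewrite ler_piMl ?sqr_ge0.
have ay0 : 0 <= alpha * x ^+ 2 by rewrite mulr_ge0 ?sqr_ge0 ?ltW.
by rewrite ler_norml; lra.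
Qed.

Let scaled_majorant_derive (K x : R) : is_derive x 1 (fun y => K * gauss_majorant alpha y)
  (K * (- (x ^+ 2 + 2 / alpha * (x - 1)) * e x)).
Proof.
have dg := is_derive_gauss_majorant x alpha_neq0.
by derive_eq; rewrite mul0r add0r.
Qed.

Let scaled_majorant_dominates (K x : R) : 0 <= K -> 1 <= x ->
  K * (x ^+ 2 * e x) <= - (K * (- (x ^+ 2 + 2 / alpha * (x - 1)) * e x)).
Proof.
move=> K0 x1; rewrite -mulrN [X in _ * - X]mulNr opprK ler_wpM2l //.
rewrite ler_wpM2r ?(ltW (e_gt0 x)) // lerDl mulr_ge0 ?subr_ge0 //.
by rewrite divr_ge0 // ltW.
Qed.

Let scaled_majorant_cvg0 (K : R) : K * gauss_majorant alpha x @[x --> +oo] --> (0 : R).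
Proof.
rewrite -[0](mulr0 K); apply: cvgM; first exact: cvg_cst.
exact: gauss_majorant_cvg0.
Qed.

Let cvg_of_dist (f g : R -> R) (l K : R) : g x @[x --> +oo] --> l ->
  (forall x, 1 <= x -> `|f x - g x| <= K * (x ^+ 2 * e x)) ->
  f x @[x --> +oo] --> l.
Proof.
move=> gl fg; have -> : f = (fun x => g x + (f x - g x)).
  by apply/funext => x; rewrite addrC subrK.
by rewrite -[l]addr0; apply: cvgD => //; exact: cvg0_expRN fg.
Qed.

Let coef_le (K L : R) : 0 <= K -> 1 <= L -> K <= K * L.
Proof. by move=> K0 L1; rewrite ler_peMr. Qed.

Let inv_alpha_ge1 k : 1 <= (alpha ^+ k)^-1.
Proof. by rewrite invf_ge1 ?exprn_gt0 // exprn_ile1 // ltW. Qed.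

Let coef_ge0 i j : 0 <= beta / (c ^+ i * alpha ^+ j).
Proof. by rewrite divr_ge0 // ltW // mulr_gt0 // exprn_gt0. Qed.

Let xe_ge0 (x : R) : 1 <= x -> 0 <= x * e x.
Proof. by move=> x1; rewrite mulr_ge0 ?(ltW (e_gt0 x)) //; lra. Qed.

(** Since [n] is [e / c] times the derivative of [m], the derivative [beta * x / 2 * n] of [b] can
    be integrated by parts. [h] is the boundary term, and what remains is of size [x ^+ 2 * e]. *)
Lemma third_component_cvg : exists2 B, b x @[x --> +oo] --> B &
  forall x, 1 <= x -> `|b x - B| <= 4 * beta / (c * alpha ^+ 2) * (x * e x).
Proof.
have K0 : 0 <= beta / (2 * c) by rewrite divr_ge0 // mulr_ge0 // ltW.
pose h x := beta / (2 * c) * (x * e x) * m x.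
have h_le x : 1 <= x -> `|h x| <= beta / (2 * c) * (x * e x).
  move=> x1; rewrite -[leRHS]mulr1; apply: normM_le => //.
  by rewrite ger0_norm // mulr_ge0 // xe_ge0.
have [|x x1|x x1||L bL bLe] := @derive_dominated_cvg R (fun x => b x - h x)
  (fun x => beta / (2 * c) * gauss_majorant alpha x)
  (fun x => - (beta / (2 * c) * ((1 - alpha * x ^+ 2 / 2) * e x) * m x))
  (fun x => beta / (2 * c) * (- (x ^+ 2 + 2 / alpha * (x - 1)) * e x)) 1.
- move=> x x1; have dbx := db x1; have dmx := dm x1; have dex := de x.
  by rewrite /h; derive_eq; field; rewrite c_neq0 e_neq0.
- exact: scaled_majorant_derive.
- apply: le_trans (scaled_majorant_dominates K0 x1).
  rewrite normrN -[leRHS]mulr1; apply: normM_le => //; apply: normM_le => //.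
    by rewrite ger0_norm.
  by apply: normM_le; [exact: quad_le|rewrite ger0_norm // ltW].
- exact: scaled_majorant_cvg0.
exists L.
  apply: (cvg_of_dist (K := beta / (2 * c)) bL) => x x1.
  rewrite opprB addrC subrK; apply: le_trans (h_le x x1) _.
  by rewrite ler_wpM2l // ler_wpM2r ?(ltW (e_gt0 x)) ?x_le_sqr.
move=> x x1; rewrite (_ : b x - L = b x - h x - L + h x); last by ring.
apply: le_trans (normD_le (bLe x x1) (h_le x x1)) _.
apply: (@le_trans _ _ (beta / (2 * c) * (6 / alpha ^+ 2 * (x * e x))
    + beta / (2 * c) * (x * e x) * (alpha ^+ 2)^-1)).
  apply: lerD; first by rewrite ler_wpM2l // gauss_majorant_le.
  apply: coef_le => //; by rewrite mulr_ge0 // xe_ge0.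
(* The tail contributes 6 / 2 and [h] contributes 1 / 2; the sum is rounded up to 4. *)
rewrite (_ : _ + _ = 7 / 2 * (beta / (c * alpha ^+ 2) * (x * e x))); last first.
  by field; rewrite ?c_neq0 ?alpha_neq0.
rewrite [leRHS](_ : _ = 4 * (beta / (c * alpha ^+ 2) * (x * e x))); last first.
  by field; rewrite ?c_neq0 ?alpha_neq0.
apply: ler_wpM2r; last by lra.
by apply: mulr_ge0; [exact: (coef_ge0 1 2)|exact: xe_ge0].
Qed.


(* For [C = cos (c * Phi)] and [S = sin (c * Phi)], [m * C - n * S] is the real
   part of [exp (i * c * Phi) * (m + i * n)]; replacing [(C, S)] by [(S, - C)]
   gives its imaginary part. *)
Section Phase.
Variables C S : R -> R.
Hypothesis dC : forall x : R, 1 <= x -> is_derive x 1 C (- (c / e x) * S x).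
Hypothesis dS : forall x : R, 1 <= x -> is_derive x 1 S (c / e x * C x).
Hypothesis CS : forall x, C x ^+ 2 + S x ^+ 2 = 1.

Let C_le1 x : `|C x| <= 1.
Proof. by apply: sqr_le1; have := CS x; nra. Qed.
Let S_le1 x : `|S x| <= 1.
Proof. by apply: sqr_le1; have := CS x; nra. Qed.

(** The rotation cancels the large terms in [c / e] and leaves the derivative
    [beta * x / 2 * b * S]. Adding [h] trades it for terms of size [x ^+ 2 * e]. *)
Lemma rotated_component_cvg :
  exists2 p, m x * C x - n x * S x @[x --> +oo] --> p & forall x, 1 <= x ->
    `|m x * C x - n x * S x - p| <= 7 * beta / (c * alpha ^+ 2) * (x * e x).
Proof.
have K0 : 0 <= beta / c by rewrite divr_ge0 // ltW.
pose P x := m x * C x - n x * S x.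
pose h x := beta / (2 * c) * (x * e x) * (b x * C x).
have h_le x : 1 <= x -> `|h x| <= beta / (2 * c) * (x * e x).
  move=> x1; rewrite -[leRHS]mulr1; apply: normM_le; last first.
    by rewrite -[leRHS]mulr1; exact: normM_le.
  rewrite ger0_norm // mulr_ge0 ?xe_ge0 // divr_ge0 // mulr_ge0 //; exact: ltW.
have [|x x1|x x1||p pL pLe] := @derive_dominated_cvg R (fun x => P x + h x)
  (fun x => beta / c * gauss_majorant alpha x)
  (fun x => beta / c * (((1 - alpha * x ^+ 2 / 2) / 2 * (b x * C x)
     + beta * x ^+ 2 / 4 * (n x * C x)) * e x))
  (fun x => beta / c * (- (x ^+ 2 + 2 / alpha * (x - 1)) * e x)) 1.
- move=> x x1; have dbx := db x1; have dmx := dm x1; have dnx := dn x1.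
  have dex := de x; have dCx := dC x1; have dSx := dS x1.
  by rewrite /h /P; derive_eq; field; rewrite c_neq0 e_neq0.
- exact: scaled_majorant_derive.
- apply: le_trans (scaled_majorant_dominates K0 x1).
  apply: normM_le; first by rewrite ger0_norm.
  apply: normM_le; last by rewrite ger0_norm // ltW.
  apply: (@le_trans _ _ (x ^+ 2 / 2 * (1 * 1) + 1 * x ^+ 2 / 4 * (1 * 1))).
    apply: normD_le; apply: normM_le; try exact: normM_le.
      by rewrite normrM (@ger0_norm _ 2^-1) ?ler_wpM2r ?quad_le.
    rewrite ger0_norm; last by rewrite divr_ge0 // mulr_ge0 // sqr_ge0.
    by rewrite ler_wpM2r // ler_wpM2r ?sqr_ge0.
  by have := sqr_ge0 x; lra.
- exact: scaled_majorant_cvg0.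
exists p.
  apply: (cvg_of_dist (K := beta / (2 * c)) pL) => x x1; rewrite -/(P x).
  rewrite opprD addrA subrr sub0r normrN; apply: le_trans (h_le x x1) _.
  rewrite ler_wpM2l //; last by rewrite ler_wpM2r ?(ltW (e_gt0 x)) ?x_le_sqr.
  rewrite divr_ge0 // mulr_ge0 //; exact: ltW.
move=> x x1; rewrite -/(P x) (_ : P x - p = P x + h x - p - h x); last by ring.
apply: le_trans (normB_le (pLe x x1) (h_le x x1)) _.
apply: (@le_trans _ _ (beta / c * (6 / alpha ^+ 2 * (x * e x))
    + beta / (2 * c) * (x * e x) * (alpha ^+ 2)^-1)).
  apply: lerD; first by rewrite ler_wpM2l // gauss_majorant_le.
  apply: coef_le => //; rewrite mulr_ge0 ?xe_ge0 // divr_ge0 // mulr_ge0 //.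
  exact: ltW.
rewrite (_ : _ + _ = 13 / 2 * (beta / (c * alpha ^+ 2) * (x * e x))); last first.
  by field; rewrite ?c_neq0 ?alpha_neq0.
rewrite [leRHS](_ : _ = 7 * (beta / (c * alpha ^+ 2) * (x * e x))); last first.
  by field; rewrite ?c_neq0 ?alpha_neq0.
apply: ler_wpM2r; last by lra.
by apply: mulr_ge0; [exact: (coef_ge0 1 2)|exact: xe_ge0].
Qed.

(** The integral of [s ^+ 3 * e s ^+ 2] over the half-line from [x], elementary because the power of
    [s] is odd. *)
Let g2 (x : R) := (x ^+ 2 / alpha + 2 / alpha ^+ 2) * e x ^+ 2.

Let g2_le (x : R) : 1 <= x -> g2 x <= 3 / alpha ^+ 2 * (x ^+ 2 * e x ^+ 2).
Proof.
move=> x1; rewrite mulrA ler_wpM2r ?sqr_ge0 //.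
rewrite (_ : _ + _ = (alpha * x ^+ 2 + 2) / alpha ^+ 2); last by field.
rewrite [leRHS]mulrAC ler_wpM2r ?invr_ge0 ?sqr_ge0 //.
have y1 : 1 <= x ^+ 2 by nra.
have ay : alpha * x ^+ 2 <= x ^+ 2 by rewrite ler_piMl ?sqr_ge0.
lra.
Qed.

Let sqr_e_le (x : R) : 1 <= x -> 0 <= x ^+ 2 * e x ^+ 2 <= x ^+ 2 * e x.
Proof.
move=> x1; rewrite mulr_ge0 ?sqr_ge0 //= ler_wpM2l ?sqr_ge0 //.
by rewrite expr2 ler_piMl // ltW.
Qed.

Variables (G : R -> R) (p q B : R).
Hypothesis dG : forall x : R, 1 <= x -> is_derive x 1 G (- (x ^+ 2 * e x)).
Hypothesis G_le : forall x : R, 1 <= x -> `|G x| <= gauss_majorant alpha x.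
Hypothesis p_lim : m x * C x - n x * S x @[x --> +oo] --> p.
Hypothesis q_le : forall x : R, 1 <= x ->
  `|m x * S x + n x * C x - q| <= 7 * beta / (c * alpha ^+ 2) * (x * e x).
Hypothesis B_le : forall x : R, 1 <= x ->
  `|b x - B| <= 4 * beta / (c * alpha ^+ 2) * (x * e x).

(** [h] and [r] come from two successive integrations by parts of [beta * x / 2 * b * S]; the second
    removes the term in [b * C] left by the first. *)
Let h (x : R) := beta / (2 * c) * (x * e x).
Let r (x : R) := beta / (2 * c ^+ 2) * ((1 - alpha * x ^+ 2 / 2) * e x ^+ 2).
(** The first integration also leaves a term in [n * C]. Half of it is carried by [m * S + n * C],
    which tends to [q] and is integrated by [G]. The other half is carried by [n * C - m * S], which
    turns at twice the phase; times [2 * c / e], and up to a term in [b], this is the derivative of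
    [Y]. *)
Let w (x : R) := beta ^+ 2 / (16 * c ^+ 2) * (x ^+ 2 * e x ^+ 2).
Let Y (x : R) := C x * m x + S x * n x.
(* The corrections are primitives, up to terms of size [e ^+ 2], of the
   oscillating terms in the derivative of [m * C - n * S]. *)
Let V x := m x * C x - n x * S x + h x * (b x * C x) - r x * (b x * S x)
  + beta ^+ 2 / (8 * c) * q * G x - w x * Y x.

Let Y_le2 (x : R) : `|Y x| <= 2.
Proof.
rewrite (_ : 2 = 1 * 1 + 1 * 1); last by rewrite !mulr1.
by apply: normD_le; apply: normM_le.
Qed.

Let betac_ge0 : 0 <= beta / c ^+ 2.
Proof. by rewrite divr_ge0 // sqr_ge0. Qed.

Let r_le (x : R) : 1 <= x -> `|r x| <= beta / c ^+ 2 * (1 / 2) * (x ^+ 2 * e x ^+ 2).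
Proof.
move=> x1; rewrite /r (_ : beta / (2 * c ^+ 2) = beta / c ^+ 2 * (1 / 2)); last by field.
apply: normM_le; first by rewrite ger0_norm // mulr_ge0.
by apply: normM_le; [exact: quad_le|rewrite ger0_norm ?sqr_ge0].
Qed.

Let beta_sqr_le : beta ^+ 2 <= beta.
Proof. by rewrite expr2 ler_piMr. Qed.

Let w_le (x : R) : 1 <= x -> `|w x| <= beta / c ^+ 2 * (1 / 16) * (x ^+ 2 * e x ^+ 2).
Proof.
move=> x1; apply: normM_le; last by rewrite ger0_norm // mulr_ge0 ?sqr_ge0.
rewrite ger0_norm; last by rewrite divr_ge0 ?sqr_ge0 // mulr_ge0 // sqr_ge0.
rewrite [leRHS](_ : _ = beta / (16 * c ^+ 2)); last by field.
by rewrite ler_wpM2r // invr_ge0 mulr_ge0 // sqr_ge0.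
Qed.

Let V' (x : R) :=
  beta / c ^+ 2 * (alpha * x * (1 - alpha * x ^+ 2 / 4)) * e x ^+ 2 * (b x * S x)
   - r x * (beta * x / 2 * n x * S x)
   + beta ^+ 2 / (8 * c) * (x ^+ 2 * e x) * (m x * S x + n x * C x - q)
   - beta ^+ 2 / (16 * c ^+ 2) * ((2 * x - alpha * x ^+ 3) * e x ^+ 2) * Y x
   + w x * (beta * x / 2 * b x * S x).

Let dV (x : R) : 1 <= x -> is_derive x 1 V (V' x).
Proof.
move=> x1; have dbx := db x1; have dmx := dm x1; have dnx := dn x1.
have dex := de x; have dCx := dC x1; have dSx := dS x1; have dGx := dG x1.
rewrite /V /V' /h /r /w /Y; derive_eq; field.
by rewrite c_neq0 e_neq0.
Qed.

Let dV_le (x : R) : 1 <= x ->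
  `|V' x| <= 3 * (beta / (c ^+ 2 * alpha ^+ 2)) * (x ^+ 3 * e x ^+ 2).
Proof.
move=> x1; set t := beta / c ^+ 2; set X := x ^+ 3 * e x ^+ 2.
have x0 : 0 <= x by lra.
have E0 : 0 <= e x ^+ 2 by exact: sqr_ge0.
have X0 : 0 <= X by rewrite mulr_ge0 // exprn_ge0.
have tX0 : 0 <= t * X by rewrite mulr_ge0.
have x2 : 1 <= x ^+ 2 by nra.
have x3 : x <= x ^+ 3 by rewrite exprS ler_peMr.
have ax2 : 0 <= alpha * x ^+ 2 <= x ^+ 2.
  by rewrite mulr_ge0 ?sqr_ge0 ?ler_piMl ?sqr_ge0 // ltW.
have ax3 : 0 <= alpha * x ^+ 3 <= x ^+ 3.
  have x3_ge0 : 0 <= x ^+ 3 by lra.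
  by rewrite mulr_ge0 ?ler_piMl // ltW.
have T1 : `|t * (alpha * x * (1 - alpha * x ^+ 2 / 4)) * e x ^+ 2 * (b x * S x)|
    <= 5 / 4 * (t * X).
  rewrite (_ : 5 / 4 * (t * X) = t * (5 / 4 * x ^+ 3) * e x ^+ 2 * (1 * 1)); last first.
    by rewrite /X; field.
  apply: normM_le; last exact: normM_le.
  apply: normM_le; last by rewrite ger0_norm.
  apply: normM_le; first by rewrite ger0_norm.
  rewrite (_ : alpha * x * _ = alpha * (x - alpha * x ^+ 3 / 4)); last by ring.
  rewrite -[leRHS]mul1r; apply: normM_le; first by rewrite ger0_norm // ltW.
  by rewrite ler_norml; lra.
have T2 : `|r x * (beta * x / 2 * n x * S x)| <= 1 / 4 * (t * X).
  rewrite (_ : 1 / 4 * (t * X) =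
      t * (1 / 2) * (x ^+ 2 * e x ^+ 2) * (1 * x / 2 * 1 * 1)); last first.
    by rewrite /X; field.
  apply: normM_le; first exact: r_le.
  apply: normM_le => //; apply: normM_le => //.
  by rewrite ger0_norm ?divr_ge0 ?mulr_ge0 // ler_wpM2r // ler_wpM2r.
(* This term uses the first-order rate [q_le], and alone brings [alpha ^- 2] into the bound. *)
have T3 : `|beta ^+ 2 / (8 * c) * (x ^+ 2 * e x) * (m x * S x + n x * C x - q)|
    <= 7 / 8 * (t * X / alpha ^+ 2).
  rewrite (_ : 7 / 8 * _ = 1 / (8 * c) * (x ^+ 2 * e x) *
      (7 * beta / (c * alpha ^+ 2) * (x * e x))); last first.
    by rewrite /X /t; field; rewrite c_neq0 alpha_neq0.
  apply: normM_le; last exact: q_le.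
  apply: normM_le; last by rewrite ger0_norm // mulr_ge0 ?sqr_ge0 // ltW.
  have c8 : 0 <= 8 * c by rewrite mulr_ge0 // ltW.
  rewrite ger0_norm ?divr_ge0 ?sqr_ge0 // ler_wpM2r ?invr_ge0 //.
  exact: le_trans beta_sqr_le beta1.
have T4 : `|beta ^+ 2 / (16 * c ^+ 2) * ((2 * x - alpha * x ^+ 3) * e x ^+ 2) * Y x|
    <= 1 / 4 * (t * X).
  rewrite (_ : 1 / 4 * _ = beta / (16 * c ^+ 2) * (2 * x ^+ 3 * e x ^+ 2) * 2); last first.
    by rewrite /X /t; field.
  apply: normM_le; last exact: Y_le2.
  have c8 : 0 <= 16 * c ^+ 2 by rewrite mulr_ge0 // sqr_ge0.
  apply: normM_le.
    by rewrite ger0_norm ?divr_ge0 ?sqr_ge0 // ler_wpM2r ?invr_ge0.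
  apply: normM_le; last by rewrite ger0_norm.
  by rewrite ler_norml; lra.
have T5 : `|w x * (beta * x / 2 * b x * S x)| <= 1 / 32 * (t * X).
  rewrite (_ : 1 / 32 * (t * X) =
      t * (1 / 16) * (x ^+ 2 * e x ^+ 2) * (1 * x / 2 * 1 * 1)); last first.
    by rewrite /X; field.
  apply: normM_le; first exact: w_le.
  apply: normM_le => //; apply: normM_le => //.
  by rewrite ger0_norm ?divr_ge0 ?mulr_ge0 // ler_wpM2r // ler_wpM2r.
(* 5 / 4 + 1 / 4 + 7 / 8 + 1 / 4 + 1 / 32 is less than 3. *)
apply: le_trans (normD_le (normB_le (normD_le (normB_le T1 T2) T3) T4) T5) _.
have tX2 : t * X <= t * X / alpha ^+ 2 by exact: coef_le.
rewrite [leRHS](_ : _ = 3 * (t * X / alpha ^+ 2)); last first.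
  by rewrite /X /t; field; rewrite c_neq0 alpha_neq0.
by lra.
Qed.

Let V_le (x : R) : 1 <= x ->
  `|V x - p| <= 9 * (beta / (c ^+ 2 * alpha ^+ 4)) * (x ^+ 2 * e x ^+ 2).
Proof.
have K0 : 0 <= 3 * (beta / (c ^+ 2 * alpha ^+ 2)) by rewrite mulr_ge0 ?coef_ge0.
have g2_ge0 y : 0 <= g2 y.
  by rewrite mulr_ge0 ?sqr_ge0 // addr_ge0 ?divr_ge0 ?sqr_ge0 // ltW.
have [|y y1|y y1||L VL VLe] := @derive_dominated_cvg R V
  (fun x => 3 * (beta / (c ^+ 2 * alpha ^+ 2)) * g2 x) V'
  (fun x => - (3 * (beta / (c ^+ 2 * alpha ^+ 2)) * (x ^+ 3 * e x ^+ 2))) 1.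
- exact: dV.
- have dey := de y; rewrite /g2; derive_eq; field.
  by rewrite c_neq0 alpha_neq0.
- by rewrite opprK; exact: dV_le.
- apply: (@cvg0_expRN _ alpha
    (3 * (beta / (c ^+ 2 * alpha ^+ 2)) * (3 / alpha ^+ 2))) => // y y1.
  rewrite ger0_norm; last exact: mulr_ge0.
  rewrite -[leRHS]mulrA; apply: ler_wpM2l => //.
  apply: le_trans (g2_le y1) _.
  by rewrite ler_wpM2l ?divr_ge0 ?sqr_ge0 //; case/andP: (sqr_e_le y1).
(* All the corrections in [V] tend to 0, so [V] has the limit of [m * C - n * S]. *)
have Lp : L = p.
  apply: (cvg_unique _ VL); first exact: Rhausdorff.
  apply: (cvg_of_dist (K := beta / (2 * c) + beta / c ^+ 2 * (1 / 2)
    + beta ^+ 2 / (8 * c) * `|q| * (6 / alpha ^+ 2)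
    + beta / c ^+ 2 * (1 / 16) * 2) p_lim) => y y1.
  have y0 : 0 <= y by lra.
  have [Z0 Z1] := andP (sqr_e_le y1); set Z := y ^+ 2 * e y.
  have yeZ : y * e y <= Z by rewrite ler_wpM2r ?(ltW (e_gt0 y)) ?x_le_sqr.
  have c2 : 0 <= beta / (2 * c) by rewrite divr_ge0 // mulr_ge0 // ltW.
  have T1 : `|h y * (b y * C y)| <= beta / (2 * c) * Z * (1 * 1).
    apply: normM_le; last exact: normM_le.
    rewrite ger0_norm; first by rewrite ler_wpM2l.
    by rewrite mulr_ge0 ?xe_ge0.
  have T2 : `|r y * (b y * S y)| <= beta / c ^+ 2 * (1 / 2) * Z * (1 * 1).
    apply: normM_le; last exact: normM_le.
    by apply: le_trans (r_le y1) _; rewrite ler_wpM2l // mulr_ge0.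
  have T3 : `|beta ^+ 2 / (8 * c) * q * G y|
      <= beta ^+ 2 / (8 * c) * `|q| * (6 / alpha ^+ 2 * Z).
    apply: normM_le.
      rewrite normrM ger0_norm // divr_ge0 ?sqr_ge0 // mulr_ge0 //; exact: ltW.
    apply: le_trans (G_le y1) _; apply: le_trans (gauss_majorant_le alpha01 y1) _.
    by rewrite ler_wpM2l // divr_ge0 // sqr_ge0.
  have T4 : `|w y * Y y| <= beta / c ^+ 2 * (1 / 16) * Z * 2.
    apply: normM_le; last exact: Y_le2.
    by apply: le_trans (w_le y1) _; rewrite ler_wpM2l // mulr_ge0.
  rewrite (_ : V y - _ = h y * (b y * C y) - r y * (b y * S y)
    + beta ^+ 2 / (8 * c) * q * G y - w y * Y y); last by rewrite /V; ring.
  apply: le_trans (normB_le (normD_le (normB_le T1 T2) T3) T4) _.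
  by rewrite -/Z le_eqVlt; apply/predU1P; left; ring.
move=> x1; rewrite -Lp; apply: le_trans (VLe x x1) _.
rewrite [leRHS](_ : _ = 3 * (beta / (c ^+ 2 * alpha ^+ 2)) *
    (3 / alpha ^+ 2 * (x ^+ 2 * e x ^+ 2))).
  by rewrite ler_wpM2l ?g2_le.
by field; rewrite c_neq0 alpha_neq0.
Qed.

Lemma rotated_component_expansion (x : R) : 1 <= x ->
  `|m x * C x - n x * S x
    - (p - beta ^+ 2 / (8 * c) * q * G x - beta * B / (2 * c) * (x * e x) * C x)|
  <= 12 * (beta / (c ^+ 2 * alpha ^+ 4)) * (x ^+ 2 * e x ^+ 2).
Proof.
move=> x1; set t := beta / c ^+ 2; set Z := x ^+ 2 * e x ^+ 2.
have Z0 : 0 <= Z by case/andP: (sqr_e_le x1).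
(* Freezing [b] at its limit in the boundary term costs a product of two first-order sizes, hence
   already [x ^+ 2 * e x ^+ 2]. *)
have T1 : `|h x * (b x - B) * C x| <= 2 * (t * Z / alpha ^+ 2).
  rewrite (_ : 2 * _ = 1 / (2 * c) * (x * e x) *
    (4 * beta / (c * alpha ^+ 2) * (x * e x)) * 1); last first.
    by rewrite /t /Z; field; rewrite c_neq0 alpha_neq0.
  apply: normM_le => //; apply: normM_le; last exact: B_le.
  have c2 : 0 <= 2 * c by rewrite mulr_ge0 // ltW.
  rewrite ger0_norm; last by rewrite mulr_ge0 ?xe_ge0 // divr_ge0.
  by rewrite ler_wpM2r ?xe_ge0 // ler_wpM2r ?invr_ge0.
have T2 : `|r x * (b x * S x)| <= t * (1 / 2) * Z * (1 * 1).
  by apply: normM_le; [exact: r_le|exact: normM_le].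
have T3 : `|w x * Y x| <= t * (1 / 16) * Z * 2.
  by apply: normM_le; [exact: w_le|exact: Y_le2].
rewrite [X in `|X|](_ : _ =
    V x - p - h x * (b x - B) * C x + r x * (b x * S x) + w x * Y x); last first.
  by rewrite /V /h; field.
(* 9 + 2 + 1 / 2 + 1 / 8 is less than 12. *)
apply: le_trans (normD_le (normD_le (normB_le (V_le x1) T1) T2) T3) _.
have tZ : 0 <= t * Z by rewrite mulr_ge0.
have tZ4 : t * Z <= t * Z / alpha ^+ 4 by exact: coef_le.
have tZ2 : t * Z / alpha ^+ 2 <= t * Z / alpha ^+ 4.
  rewrite ler_wpM2l // lef_pV2 ?posrE ?exprn_gt0 //.
  by rewrite ler_wiXn2l // ltW.
rewrite [leRHS](_ : _ = 12 * (t * Z / alpha ^+ 4)); last first.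
  by rewrite /t /Z; field; rewrite c_neq0 alpha_neq0.
rewrite [X in X + _ + _ + _](_ : _ = 9 * (t * Z / alpha ^+ 4)); last first.
  by rewrite /t /Z; field; rewrite c_neq0 alpha_neq0.
by lra.
Qed.

End Phase.

End Asymptotics.

Lemma cvg_sum_ord (R : realType) (T : Type) (F : set_system T) (FF : Filter F)
    (n : nat) (f : 'I_n -> T -> R) (l : 'I_n -> R) :
  (forall i, f i x @[x --> F] --> l i) ->
  \sum_(i < n) f i x @[x --> F] --> \sum_(i < n) l i.
Proof.
elim: n f l => [|n IH] f l fl.
  under eq_fun do rewrite big_ord0.
  by rewrite big_ord0; exact: cvg_cst.
under eq_fun do rewrite big_ord_recl.
by rewrite big_ord_recl; apply: cvgD => //; apply: IH.
Qed.

Section Polar.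
Variable R : realType.

Lemma polar_coordinates (p q : R) : exists rho phi : R,
  [/\ 0 <= rho, 0 <= phi < 2 * pi, p = rho * cos phi, q = rho * sin phi
    & rho ^+ 2 = p ^+ 2 + q ^+ 2].
Proof.
have r2_ge0 : 0 <= p ^+ 2 + q ^+ 2 by rewrite addr_ge0 ?sqr_ge0.
pose r := Num.sqrt (p ^+ 2 + q ^+ 2).
have rr : r ^+ 2 = p ^+ 2 + q ^+ 2 by rewrite sqr_sqrtr.
have pi0 := pi_gt0 R.
have [r0|r_neq0] := eqVneq r 0.
  have : p ^+ 2 + q ^+ 2 = 0 by rewrite -rr r0 expr0n.
  move=> /eqP; rewrite paddr_eq0 ?sqr_ge0 // !sqrf_eq0 => /andP[/eqP-> /eqP->].
  by exists 0, 0; rewrite !mul0r expr0n /= addr0; split=> //; lra.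
have r0 : 0 < r by rewrite lt_neqAle eq_sym r_neq0 sqrtr_ge0.
pose u := p / r; pose v := q / r.
have uv : u ^+ 2 + v ^+ 2 = 1.
  by rewrite /u /v !expr_div_n -mulrDl -rr divff // expf_neq0.
have u1 : -1 <= u <= 1 by nra.
pose phi := acos u.
have cphi : cos phi = u by rewrite acosK // in_itv /= u1.
have sphi : sin phi = `|v|.
  by rewrite sin_acos // (_ : 1 - u ^+ 2 = v ^+ 2) ?sqrtr_sqr // -uv addrC addKr.
have phi0 : 0 <= phi by exact: acos_ge0.
have phipi : phi <= pi by exact: acos_lepi.
have pE : p = r * u by rewrite /u mulrC divfK.
have qE : q = r * v by rewrite /v mulrC divfK.
have [v0|v0] := leP 0 v.
  exists r, phi; rewrite cphi sphi ger0_norm //; split=> //; first exact: ltW.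
  by rewrite phi0 /=; lra.
(* [acos] reaches only the upper half circle, and the lower half is its reflection. The angle stays
   below [2 * pi] because [phi] is positive: otherwise [v] would be 0. *)
exists r, (2 * pi - phi).
have phi_gt0 : 0 < phi.
  rewrite lt_neqAle phi0 andbT eq_sym; apply/eqP => phiE.
  move: sphi; rewrite phiE sin0 => /esym/eqP; rewrite normr_eq0 => /eqP vE.
  by rewrite vE ltxx in v0.
rewrite (_ : 2 * pi - phi = - phi + pi *+ 2); last by rewrite mulr2n; ring.
rewrite cosD2pi sinD2pi cosN sinN cphi sphi ltr0_norm // opprK.
split=> //; first exact: ltW.
by rewrite mulr2n; lra.
Qed.

(** Here [t] is a multiple of [beta], so it vanishes when [alpha] is 1. The error is then 0 and the
    quotient by [t] is replaced by 0. *)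
Lemma absorb_factor (t Y err K : R) : 0 <= t -> 0 <= K * Y ->
  `|err| <= K * (t * Y) -> exists2 O, `|O| <= K * Y & err = t * O.
Proof.
move=> t0 KY0 errK; have [tE|t_neq0] := eqVneq t 0.
  move: errK; rewrite tE mul0r mulr0 normr_le0 => /eqP->.
  by exists 0; rewrite ?mul0r // normr0.
exists (err / t); last by rewrite mulrC divfK.
rewrite normrM normfV (ger0_norm t0) ler_pdivrMr ?lt_neqAle 1?eq_sym ?t_neq0 //.
by rewrite -mulrA [Y * t]mulrC.
Qed.

End Polar.

Section Profile.
Variables (R : realType) (c alpha : R) (m n b : R -> 'rV[R]_3).
Hypotheses (SF : serret_frenet c alpha m n b) (alpha01 : 0 < alpha <= 1) (c0 : 0 < c).
Notation beta := (Num.sqrt (1 - alpha ^+ 2)).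
Let e (x : R) := expR (- alpha * x ^+ 2 / 4).

Let beta01 : 0 <= beta <= 1.
Proof.
rewrite sqrtr_ge0 /= -[leRHS]sqrtr1 ler_wsqrtr // lerBlDr lerDl.
exact: sqr_ge0.
Qed.

Let kE (x : R) : c * expR (alpha * x ^+ 2 / 4) = c / e x.
Proof. by rewrite /e !mulNr expRN invrK. Qed.

Let comp_norm j x : m x 0 j ^+ 2 + n x 0 j ^+ 2 + b x 0 j ^+ 2 = 1.
Proof. by have := sf_col SF x j j; rewrite eqxx mulr1n !expr2. Qed.

Lemma profile_spec (j : 'I_3) : exists rho B phi : R,
  [/\ 0 <= rho, 0 <= phi < 2 * pi, rho ^+ 2 + B ^+ 2 = 1,
    b x 0 j @[x --> +oo] --> B
    & profile_asymptotics 24 c alpha beta (fun x => m x 0 j) rho B phi].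
Proof.
have [alpha0 alpha1] := andP alpha01.
have dm (x : R) : 1 <= x -> is_derive x 1 (fun x => m x 0 j) (c / e x * n x 0 j).
  by move=> _; rewrite -kE; exact: (sf_m SF).
have dn (x : R) : 1 <= x -> is_derive x 1 (fun x => n x 0 j)
    (- (c / e x) * m x 0 j - beta * x / 2 * b x 0 j).
  by move=> _; rewrite -kE; apply: (is_derive_eq (sf_n SF j x)); ring.
have db (x : R) : 1 <= x -> is_derive x 1 (fun x => b x 0 j)
    (beta * x / 2 * n x 0 j).
  by move=> _; apply: (is_derive_eq (sf_b SF j x)); rewrite opprK.
pose th x := c * Phi alpha x.
have dth (x : R) : 1 <= x -> is_derive x 1 th (c / e x).
  move=> x1; have dPhi := is_derive_Phi alpha (lt_le_trans ltr01 x1).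
  by rewrite -kE /th; derive_eq; rewrite mul0r add0r.
pose C x := cos (th x); pose S x := sin (th x).
have dC (x : R) : 1 <= x -> is_derive x 1 C (- (c / e x) * S x).
  by move=> x1; have dthx := dth x x1; rewrite /C; derive_eq; rewrite /S; ring.
have dS (x : R) : 1 <= x -> is_derive x 1 S (c / e x * C x).
  by move=> x1; have dthx := dth x x1; rewrite /S; derive_eq; rewrite /C; ring.
have dNC (x : R) : 1 <= x -> is_derive x 1 (fun x => - C x) (c / e x * S x).
  by move=> x1; have dCx := dC x x1; derive_eq; ring.
have dS' (x : R) : 1 <= x -> is_derive x 1 S (- (c / e x) * - C x).
  by move=> x1; rewrite mulrNN; exact: dS.
have CS x : C x ^+ 2 + S x ^+ 2 = 1 by exact: cos2Dsin2.
have SC x : S x ^+ 2 + (- C x) ^+ 2 = 1 by rewrite sqrrN addrC.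
have mnb := comp_norm j.
have [B bB B_le] := third_component_cvg alpha01 beta01 c0 dm db mnb.
have [p pL p_le] := rotated_component_cvg alpha01 beta01 c0 dm dn db mnb dC dS CS.
have [q qL q_le] := rotated_component_cvg alpha01 beta01 c0 dm dn db mnb dS' dNC SC.
(* The rotation preserves [m ^+ 2 + n ^+ 2], so the unit norm of the column passes to the limit as a
   relation between [p], [q] and [B]. *)
have pqB : p ^+ 2 + q ^+ 2 + B ^+ 2 = 1.
  pose P x := m x 0 j * C x - n x 0 j * S x.
  pose Q x := m x 0 j * S x - n x 0 j * - C x.
  have fL : P x * P x + Q x * Q x + b x 0 j * b x 0 j @[x --> +oo]
      --> p * p + q * q + B * B.
    exact: cvgD (cvgD (cvgM pL pL) (cvgM qL qL)) (cvgM bB bB).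
  have fE : (fun x => P x * P x + Q x * Q x + b x 0 j * b x 0 j) = cst 1.
    apply/funext => x; rewrite /= -[RHS](mnb x) -[m x 0 j ^+ 2]mulr1.
    by rewrite -[n x 0 j ^+ 2]mulr1 -(CS x) /P /Q; ring.
  move: fL; rewrite fE !expr2 => /(cvg_lim (@Rhausdorff R)) <-.
  exact: lim_cst.
have [rho [phi [rho0 phi2 pE qE rhoE]]] := polar_coordinates p q.
have [dG G_le] := gauss_tail_spec alpha01.
have dG1 (x : R) : 1 <= x -> is_derive x 1 (gauss_tail alpha) (- (x ^+ 2 * e x)).
  by move=> x1; apply: dG; exact: lt_le_trans x1.
exists rho, B, phi; split=> //; first by rewrite rhoE.
move=> x x1.
have q_le' (y : R) : 1 <= y -> `|m y 0 j * S y + n y 0 j * C y - q|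
    <= 7 * beta / (c * alpha ^+ 2) * (y * e y).
  by move=> y1; have := q_le y y1; rewrite mulrN opprK.
(* In the expansion for the pair [(S, - C)], a further quarter turn, the part of [q] is played by
   [- p]. *)
have p_le' (y : R) : 1 <= y -> `|m y 0 j * - C y + n y 0 j * S y - - p|
    <= 7 * beta / (c * alpha ^+ 2) * (y * e y).
  by move=> y1; have := p_le y y1; rewrite -normrN; congr (`|_| <= _); ring.
have err1 := rotated_component_expansion alpha01 beta01 c0 dm dn db mnb dC dS CS
  dG1 G_le pL q_le' B_le x1.
have err2 := rotated_component_expansion alpha01 beta01 c0 dm dn db mnb dS' dNC SC
  dG1 G_le qL p_le' B_le x1.
have beta0 : 0 <= beta by exact: sqrtr_ge0.
have E2 : expR (- alpha * x ^+ 2 / 2) = e x ^+ 2.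
  by rewrite /e -expRM_natr; congr expR; field.
have e0 : 0 < e x by exact: expR_gt0.
have e_neq0 : e x != 0 by rewrite gt_eqF.
have c_neq0 : c != 0 by rewrite gt_eqF.
have alpha_neq0 : alpha != 0 by rewrite gt_eqF.
set er1 := (X in `|X| <= _) in err1; set er2 := (X in `|X| <= _) in err2.
have C_le1 : `|C x| <= 1 by rewrite ler_norml cos_geN1 cos_le1.
have S_le1 : `|S x| <= 1 by rewrite ler_norml sin_geN1 sin_le1.
set K := 12 * (beta / (c ^+ 2 * alpha ^+ 4)) * (x ^+ 2 * e x ^+ 2) in err1 err2.
have den_ge0 k : 0 <= beta / (alpha ^+ 5 * c ^+ k).
  by rewrite divr_ge0 // mulr_ge0 // exprn_ge0 // ltW.
(* Rotating back adds the errors of the two components, hence 24 = 2 * 12. The spare factor [alpha],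
   at most 1, turns [alpha ^- 4] into [alpha ^- 5]. *)
have K_le : K * 1 + K * 1 <= 24 * (beta / (alpha ^+ 5 * c ^+ 2) * (x ^+ 2 * e x ^+ 2)).
  rewrite (_ : K * 1 + K * 1 =
      24 * (beta / (alpha ^+ 5 * c ^+ 2) * (x ^+ 2 * e x ^+ 2)) * alpha); last first.
    by rewrite /K; field; rewrite c_neq0.
  apply: ler_piMr => //; rewrite mulr_ge0 // mulr_ge0 ?den_ge0 //.
  by rewrite mulr_ge0 ?sqr_ge0.
have m_err : `|er1 * C x + er2 * S x| <=
    24 * (beta / (alpha ^+ 5 * c ^+ 2) * (x ^+ 2 * e x ^+ 2)).
  by apply: le_trans K_le; apply: normD_le; exact: normM_le.
have n_err : `|c / e x * (er2 * C x - er1 * S x)| <=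
    24 * (beta / (alpha ^+ 5 * c) * (x ^+ 2 * e x)).
  rewrite [leRHS](_ : _ = c / e x *
      (24 * (beta / (alpha ^+ 5 * c ^+ 2) * (x ^+ 2 * e x ^+ 2)))); last first.
    by field; rewrite c_neq0 alpha_neq0.
  apply: normM_le; first by rewrite ger0_norm // divr_ge0 // ltW.
  by apply: le_trans K_le; apply: normB_le; exact: normM_le.
have [|O1 O1_le O1E] := absorb_factor (den_ge0 2) _ m_err.
  by rewrite mulr_ge0 // mulr_ge0 ?sqr_ge0.
have [|O2 O2_le O2E] := absorb_factor (den_ge0 1) _ n_err.
  by rewrite mulr_ge0 // mulr_ge0 ?sqr_ge0 // ltW.
exists O1, O2; rewrite E2; split=> //.
- rewrite -O1E cosB sinB -/(th x) -/(C x) -/(S x) /er1 /er2 pE qE -!/(e x).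
  apply/eqP; rewrite -subr_eq0; apply/eqP.
  (* [m] is recovered from the two rotated components with the weights [C] and [S], so the identity
     holds modulo [C ^+ 2 + S ^+ 2 = 1]. *)
  transitivity ((1 - (C x ^+ 2 + S x ^+ 2)) *
    (m x 0 j + beta * B / (2 * c) * (x * e x))); first by field.
  by rewrite CS subrr mul0r.
- have -> : derive1 (fun y => m y 0 j) x = c / e x * n x 0 j.
    by rewrite derive1E; have [_ ->] := dm x x1.
  rewrite -[alpha ^+ 5 * c]/(alpha ^+ 5 * c ^+ 1) -O2E cosB sinB.
  rewrite -/(th x) -/(C x) -/(S x) /er1 /er2 pE qE -!/(e x).
  rewrite (_ : expR (alpha * x ^+ 2 / 4) = (e x)^-1); last first.
    by rewrite /e !mulNr expRN invrK.
  apply/eqP; rewrite -subr_eq0; apply/eqP.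
  (* The orthogonal combination recovers [n]. In it the two terms in [B] cancel, which is why the
     expansion of the derivative has none. *)
  transitivity ((1 - (C x ^+ 2 + S x ^+ 2)) * (c / e x * n x 0 j)).
    by field; rewrite c_neq0 e_neq0.
  by rewrite CS subrr mul0r.
Qed.

(** Unit columns give the relation for each [j], the unit row [b] gives the sum of the [B j ^+ 2],
    and the sum of the [rho j ^+ 2] is 3 - 1. *)
Lemma profile_constants : exists rho B phi : 'I_3 -> R,
  (forall j, [/\ 0 <= rho j <= 1, -1 <= B j <= 1, 0 <= phi j < 2 * pi &
     profile_asymptotics 24 c alpha beta (fun x => m x 0 j) (rho j) (B j) (phi j)]) /\
  [/\ \sum_(j < 3) rho j ^+ 2 = 2, \sum_(j < 3) B j ^+ 2 = 1
    & forall j, rho j ^+ 2 + B j ^+ 2 = 1].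
Proof.
have [rho /choice[B /choice[phi H]]] := choice profile_spec.
exists rho, B, phi.
have rhoB j : rho j ^+ 2 + B j ^+ 2 = 1 by have [] := H j.
have sumB : \sum_(j < 3) B j ^+ 2 = 1.
  have bL : \sum_(j < 3) b x 0 j * b x 0 j @[x --> +oo] --> \sum_(j < 3) B j * B j.
    by apply: cvg_sum_ord => j; have [_ _ _ bB _] := H j; exact: cvgM.
  have bE : (fun x => \sum_(j < 3) b x 0 j * b x 0 j) = cst 1.
    by apply/funext => x; have [_ _] := sf_norm SF x.
  under eq_bigr do rewrite expr2.
  by move: bL; rewrite bE => /(cvg_lim (@Rhausdorff R)) <-; exact: lim_cst.
split; last split=> //.
- move=> j; have [rho0 phi2 _ _ prof] := H j; have rBj := rhoB j.
  have sq := sqr_ge0 (rho j); have sqB := sqr_ge0 (B j).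
  by split=> //; [rewrite rho0 /=; nra|apply/andP; split; nra].
- have : \sum_(j < 3) (rho j ^+ 2 + B j ^+ 2) = 3.
    by under eq_bigr do rewrite rhoB; rewrite sumr_const card_ord.
  by rewrite big_split /= sumB; lra.
Qed.

End Profile.

(** * Pointwise limits at the blow-up time *)

Section SelfSimilarLimit.
Variable R : realType.

Lemma profile_cvg0 (K c alpha beta : R) (f : R -> R) (rho B phi : R) :
    0 <= K -> 0 < alpha <= 1 ->
    profile_asymptotics K c alpha beta f rho B phi ->
  f x - rho * cos (c * Phi alpha x - phi) @[x --> +oo] --> 0.
Proof.
move=> K0 /[dup] alpha01 /andP[alpha0 alpha1] prof.
have [_ G_le] := gauss_tail_spec alpha01.
apply: (@cvg0_expRN _ alpha (`|beta * B / (2 * c)|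
  + `|beta ^+ 2 * rho / (8 * c)| * (6 / alpha ^+ 2)
  + `|beta / (alpha ^+ 5 * c ^+ 2)| * K)) => // x x1.
have [r [r2 [r_le _ -> _]]] := prof x x1.
have x0 : 0 <= x by lra.
set e := expR (- alpha * x ^+ 2 / 4).
have e_gt0 : 0 < e by exact: expR_gt0.
have xe : x * e <= x ^+ 2 * e by rewrite ler_wpM2r ?(ltW e_gt0) //; nra.
have e_sqr : expR (- alpha * x ^+ 2 / 2) = e * e.
  by rewrite -expRD; congr expR; field.
have e_le1 : e <= 1.
  by rewrite expR_le1 !mulNr oppr_le0 divr_ge0 // mulr_ge0 ?sqr_ge0 // ltW.
rewrite [X in `|X|](_ : _ = - (beta * B / (2 * c) * (x * e))
  + beta ^+ 2 * rho / (8 * c) * (sin (c * Phi alpha x - phi) * gauss_tail alpha x)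
  + beta / (alpha ^+ 5 * c ^+ 2) * r); last by ring.
rewrite [leRHS]mulrDl [X in _ <= X + _]mulrDl; apply: normD_le; first apply: normD_le.
- rewrite normrN; apply: normM_le => //.
  by rewrite ger0_norm // mulr_ge0 // ltW.
- rewrite -[leRHS]mulrA; apply: normM_le => //; rewrite -[leRHS]mul1r; apply: normM_le.
    by rewrite ler_norml sin_geN1 sin_le1.
  apply: le_trans (G_le x x1) _; apply: le_trans (gauss_majorant_le alpha01 x1) _.
  by rewrite ler_wpM2l // divr_ge0 // sqr_ge0.
- rewrite -[leRHS]mulrA; apply: normM_le => //; apply: le_trans r_le _.
  rewrite ler_wpM2l // ler_wpM2l ?sqr_ge0 // e_sqr.
  by rewrite ler_piMr // ltW.
Qed.

Lemma cvg_self_similar_pinfty (x T : R) : 0 < x ->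
  x / Num.sqrt (T - t) @[t --> T^'-] --> +oo.
Proof.
move=> x0; apply/cvgryPge => A.
have A0 : 0 < `|A| + 1 by rewrite ltr_wpDl.
have d0 : 0 < (x / (`|A| + 1)) ^+ 2 by rewrite exprn_gt0 // divr_gt0.
near=> t.
have tT : t < T by near: t; exact: nbhs_left_lt.
have td : T - (x / (`|A| + 1)) ^+ 2 < t.
  by near: t; apply: nbhs_left_gt; rewrite ltrBlDr ltrDl.
have s0 : 0 < Num.sqrt (T - t) by rewrite sqrtr_gt0 subr_gt0.
have sx : Num.sqrt (T - t) <= x / (`|A| + 1).
  rewrite -[leRHS]ger0_norm; last by rewrite divr_ge0 ?ltW.
  by rewrite -sqrtr_sqr ler_wsqrtr //; lra.
rewrite ler_pdivlMr //; apply: (@le_trans _ _ ((`|A| + 1) * Num.sqrt (T - t))).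
  by rewrite ler_wpM2r ?(ltW s0) //; have := ler_norm A; lra.
by rewrite mulrC -ler_pdivlMr.
Unshelve. all: by end_near. Qed.

Lemma self_similar_cvg (c alpha beta K rho B phi s T x : R) (m : R -> 'rV[R]_3) j :
    0 <= K -> 0 < alpha <= 1 ->
    (forall x, m (- x) 0 j = s * m x 0 j) ->
    profile_asymptotics K c alpha beta (fun x => m x 0 j) rho B phi ->
  (0 < x -> (fun t => self_similar m T (x, t) 0 j
     - rho * cos (c * Phi alpha (x / Num.sqrt (T - t)) - phi)) @ T^'- --> (0 : R)) /\
  (x < 0 -> (fun t => self_similar m T (x, t) 0 j
     - s * rho * cos (c * Phi alpha (- x / Num.sqrt (T - t)) - phi)) @ T^'- --> (0 : R)).
Proof.
move=> K0 alpha01 parity /(profile_cvg0 K0 alpha01) lim; split=> x0.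
  exact: cvg_comp _ _ (cvg_self_similar_pinfty _ x0) lim.
have Nx0 : 0 < - x by rewrite oppr_gt0.
have limN := cvg_comp _ _ (cvg_self_similar_pinfty T Nx0) lim.
rewrite -(mulr0 s).
rewrite (_ : (fun t => _) = (fun t => s * (m (- x / Num.sqrt (T - t)) 0 j -
    rho * cos (c * Phi alpha (- x / Num.sqrt (T - t)) - phi)))).
  by apply: cvgM; [exact: cvg_cst|exact: limN].
apply/funext => t; rewrite /self_similar /= -[x in LHS]opprK.
by rewrite [- - x / _]mulNr parity !opprK; ring.
Qed.

End SelfSimilarLimit.

(** * Smoothness and the Landau-Lifshitz-Gilbert equation *)

Section Directional.
Variables (R : realType) (V : normedModType R).
Implicit Types (p v : V).

(** Restriction to a line turns directional derivatives into ordinary ones, to which the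
    one-variable chain rule applies. *)
Lemma is_derive_slice (W : normedModType R) (f : V -> W) p v l :
  is_derive (0 : R) 1 (fun h : R => f (h *: v + p)) l <-> is_derive p v f l.
Proof.
have E : 'D_v f p = 'D_1 (fun h : R => f (h *: v + p)) 0.
  rewrite /derive; set g1 := fun h => h^-1 *: _; set g2 := fun h => h^-1 *: _.
  suff -> : g1 = g2 by [].
  by rewrite funeqE /g1 /g2 => h /=; rewrite addr0 scale0r add0r [_%:A]mulr1.
split=> -[df <-].
  by apply: DeriveDef; [exact: (derivable1P f p v).2|rewrite E].
by apply: DeriveDef; [exact: (derivable1P f p v).1|rewrite -E].
Qed.

Lemma is_derive_chain (F : R -> R) (g : V -> R) p v a b :
  is_derive (g p) 1 F a -> is_derive p v g b ->
  is_derive p v (fun q => F (g q)) (a * b).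
Proof.
move=> dF /is_derive_slice dg; apply/is_derive_slice.
apply: (is_derive1_comp (f := F) (g := fun h : R => g (h *: v + p))) => //.
by rewrite scale0r add0r.
Qed.

Lemma is_derive_rV n (f : V -> 'rV[R]_n) p v (l : 'rV[R]_n) :
  (forall j, is_derive p v (fun q => f q 0 j) (l 0 j)) -> is_derive p v f l.
Proof.
move=> df; have Df : derivable f p v.
  by apply/derivable_mxP => i j; rewrite ord1; have [] := df j.
apply: DeriveDef => //; rewrite derive_mx //; apply/matrixP => i j.
by rewrite ord1 mxE; have [_ ->] := df j.
Qed.

Lemma continuous_rV (n : nat) (f : V -> 'rV[R]_n) p :
  (forall j, {for p, continuous (fun q => f q 0 j)}) -> {for p, continuous f}.
Proof.
move=> cf; apply/cvgrPdist_le => /= eps eps0; near=> q.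
rewrite /Num.Def.normr /= mx_normrE (bigmax_le _ (ltW eps0)) //= => -[i j] _.
rewrite !mxE /= ord1; move: j; near: q; apply: filter_forall => j.
exact: ((cvgrPdist_le _ _).1 (cf j)).
Unshelve. all: by end_near. Qed.

End Directional.

(** * Functions of class C^k on an open set of the plane *)

Section ContinuouslyDifferentiable.
Variables (R : realType) (U : set (R * R)).
Hypothesis oU : open U.

Lemma Ck_continuous (W : normedModType R) k (f : R * R -> W) p :
  Ck k U f -> U p -> {for p, continuous f}.
Proof. by case: k => [|k] [cf _]; exact: cf. Qed.

Lemma near_open p : U p -> \forall q \near p, U q.
Proof. by move=> Up; exact: open_nbhs_nbhs. Qed.

(** As [U] is open, agreement on [U] passes to the partial derivatives there. This allows formulas
    valid only on [U], such as those for [scaling] before the time [T]. *)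
Lemma Ck_ext (W : normedModType R) k (f g : R * R -> W) :
  (forall p, U p -> f p = g p) -> Ck k U f -> Ck k U g.
Proof.
elim: k f g => [|k IH] f g fg.
  move=> [cf _]; split=> // p Up; have := cf p Up.
  rewrite /prop_for /continuous_at -(fg p Up); apply: cvg_trans.
  by apply: near_eq_cvg; apply: filterS (near_open Up) => q /fg.
move=> [cf [df Cx Ct]].
have nfg p : U p -> \forall q \near p, f q = g q.
  by move=> Up; apply: filterS (near_open Up) => q /fg.
split.
  move=> p Up; have := cf p Up; rewrite /prop_for /continuous_at -(fg p Up).
  by apply: cvg_trans; apply: near_eq_cvg; exact: nfg.
split.
- move=> p Up; have [d1 d2] := df p Up.
  by split; [apply: near_eq_derivable d1|apply: near_eq_derivable d2]; exact: nfg.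
- by apply: IH Cx => p Up; apply: near_eq_derive; exact: nfg.
- by apply: IH Ct => p Up; apply: near_eq_derive; exact: nfg.
Qed.

Lemma CkS (W : normedModType R) k (f fx ft : R * R -> W) :
    (forall p, U p -> {for p, continuous f}) ->
    (forall p, U p -> is_derive p (1, 0) f (fx p)) ->
    (forall p, U p -> is_derive p (0, 1) f (ft p)) ->
  Ck k U fx -> Ck k U ft -> Ck k.+1 U f.
Proof.
move=> cf dfx dft Cx Ct; split=> //; split.
- by move=> p Up; have [] := dfx p Up; have [] := dft p Up.
- by apply: Ck_ext Cx => p Up; have [_] := dfx p Up.
- by apply: Ck_ext Ct => p Up; have [_] := dft p Up.
Qed.

Lemma Ck_is_derive (W : normedModType R) k (f : R * R -> W) p : Ck k.+1 U f -> U p ->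
  is_derive p (1, 0) f (dx f p) /\ is_derive p (0, 1) f (dt f p).
Proof. by move=> [_ [df _ _]] /df[d1 d2]; split; exact: derivableP. Qed.

Lemma CkW (W : normedModType R) k (f : R * R -> W) : Ck k.+1 U f -> Ck k U f.
Proof.
elim: k f => [|k IH] f [cf [df Cx Ct]]; first by split.
split; first exact: cf.
split; [exact: df|exact: (IH _ Cx)|exact: (IH _ Ct)].
Qed.

Lemma Ck_cst (W : normedModType R) k (a : W) : Ck k U (fun=> a).
Proof.
elim: k a => [|k IH] a; first by split; [move=> p _; exact: cvg_cst|exact: I].
apply: (@CkS _ _ _ (fun=> 0) (fun=> 0)); try exact: (IH 0).
by move=> p _; exact: cvg_cst.
Qed.

Lemma Ck_fst k : Ck k U fst.
Proof.
case: k => [|k]; first by split; [move=> p _; exact: cvg_fst|exact: I].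
apply: (CkS (fx := fun=> 1 : R) (ft := fun=> 0 : R)); try exact: Ck_cst.
- by move=> p _; exact: cvg_fst.
- move=> p _; apply/is_derive_slice; have -> : (fun h : R => (h *: (1, 0) + p).1) =
      (fun h => h + p.1) by apply/funext => h /=; rewrite [_ *: _]mulr1.
  by derive_eq; rewrite addr0.
- move=> p _; apply/is_derive_slice; have -> : (fun h : R => (h *: (0, 1) + p).1) =
      (fun h => p.1) by apply/funext => h /=; rewrite scaler0 add0r.
  exact: is_derive_cst.
Qed.

Lemma Ck_add k (f g : R * R -> R) : Ck k U f -> Ck k U g ->
  Ck k U (fun p => f p + g p).
Proof.
elim: k f g => [|k IH] f g Cf Cg.
  split; last exact: I.
  by move=> p Up; apply: cvgD; [exact: Ck_continuous Cf Up|exact: Ck_continuous Cg Up].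
have [cf [_ fx ft]] := Cf; have [cg [_ gx gt]] := Cg.
apply: (@CkS _ _ _ (fun p => dx f p + dx g p) (fun p => dt f p + dt g p)).
- by move=> p Up; apply: cvgD; [exact: cf|exact: cg].
- move=> p Up; have [? _] := Ck_is_derive Cf Up; have [? _] := Ck_is_derive Cg Up.
  exact: is_deriveD.
- move=> p Up; have [_ ?] := Ck_is_derive Cf Up; have [_ ?] := Ck_is_derive Cg Up.
  exact: is_deriveD.
- exact: (IH _ _ fx gx).
- exact: (IH _ _ ft gt).
Qed.

Lemma Ck_mul k (f g : R * R -> R) : Ck k U f -> Ck k U g ->
  Ck k U (fun p => f p * g p).
Proof.
elim: k f g => [|k IH] f g Cf Cg.
  split; last exact: I.
  by move=> p Up; apply: cvgM; [exact: Ck_continuous Cf Up|exact: Ck_continuous Cg Up].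
have [cf [_ fx ft]] := Cf; have [cg [_ gx gt]] := Cg.
apply: (@CkS _ _ _ (fun p => f p * dx g p + g p * dx f p)
  (fun p => f p * dt g p + g p * dt f p)).
- by move=> p Up; apply: cvgM; [exact: cf|exact: cg].
- move=> p Up; have [? _] := Ck_is_derive Cf Up; have [? _] := Ck_is_derive Cg Up.
  exact: is_deriveM.
- move=> p Up; have [_ ?] := Ck_is_derive Cf Up; have [_ ?] := Ck_is_derive Cg Up.
  exact: is_deriveM.
- apply: Ck_add; first exact: (IH _ _ (CkW Cf) gx).
  exact: (IH _ _ (CkW Cg) fx).
- apply: Ck_add; first exact: (IH _ _ (CkW Cf) gt).
  exact: (IH _ _ (CkW Cg) ft).
Qed.

Lemma Ck_rV n k (f : R * R -> 'rV[R]_n) :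
  (forall j, Ck k U (fun p => f p 0 j)) -> Ck k U f.
Proof.
elim: k f => [|k IH] f Cf.
  split; last exact: I.
  by move=> p Up; apply: continuous_rV => j; exact: Ck_continuous (Cf j) Up.
apply: (@CkS _ _ _ (fun p => \row_j dx (fun p => f p 0 j) p)
  (fun p => \row_j dt (fun p => f p 0 j) p)).
- by move=> p Up; apply: continuous_rV => j; exact: Ck_continuous (Cf j) Up.
- move=> p Up; apply: is_derive_rV => j; rewrite mxE.
  by have [] := Ck_is_derive (Cf j) Up.
- move=> p Up; apply: is_derive_rV => j; rewrite mxE.
  by have [] := Ck_is_derive (Cf j) Up.
- apply: IH => j; under eq_fun do rewrite mxE.
  by have [_ []] := Cf j.
- apply: IH => j; under eq_fun do rewrite mxE.
  by have [_ []] := Cf j.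
Qed.

End ContinuouslyDifferentiable.

(** * The self-similar solution *)

Section SelfSimilar.
Variables (R : realType) (T : R).
Let U : set (R * R) := [set p | p.2 < T].
Definition scaling (p : R * R) : R := (Num.sqrt (T - p.2))^-1.
Definition profile_variable (p : R * R) : R := p.1 * scaling p.
Notation sg := scaling.
Notation Y := profile_variable.

Lemma open_halfplane : open U.
Proof.
have -> : U = snd @^-1` [set t | t < T] by [].
apply: open_comp; last exact: open_lt.
by move=> p _; exact: cvg_snd.
Qed.
Let oU := open_halfplane.

Lemma scaling_gt0 p : U p -> 0 < sg p.
Proof. by move=> Up; rewrite invr_gt0 sqrtr_gt0 subr_gt0. Qed.

Lemma is_derive_scaling p (v : R * R) : U p ->
  is_derive p v sg (v.2 * sg p ^+ 3 / 2).
Proof.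
move=> Up; have Tp : 0 < T - p.2 by rewrite subr_gt0.
have s0 : Num.sqrt (T - p.2) != 0 by rewrite gt_eqF // sqrtr_gt0.
have dsnd : is_derive p v snd v.2.
  apply/is_derive_slice; have -> : (fun h : R => (h *: v + p).2) =
      (fun h => h * v.2 + p.2) by apply/funext.
  by derive_eq; ring.
have dsqrt : is_derive (p.2 : R) 1 (fun t : R => Num.sqrt (T - t))
    ((2 * Num.sqrt (T - p.2))^-1 * (0 - 1)).
  have dsub : is_derive (p.2 : R) 1 (fun t : R => T - t) (0 - 1) by derive.
  exact: (is_derive1_comp (f := Num.sqrt) (g := fun t => T - t)
    (is_derive1_sqrt Tp) dsub).
have dsg : is_derive (p.2 : R) 1 (fun t : R => (Num.sqrt (T - t))^-1) (sg p ^+ 3 / 2).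
  derive_eq => //; rewrite /sg; field.
  by rewrite s0.
apply: is_derive_eq; first exact: is_derive_chain dsg dsnd.
by rewrite mulrC mulrA.
Qed.

Definition profile_variable_derivative (v p : R * R) : R :=
  v.1 * sg p + v.2 / 2 * (Y p * sg p ^+ 2).
Notation dY := profile_variable_derivative.

Lemma is_derive_fst (p v : R * R) : is_derive p v fst v.1.
Proof.
apply/is_derive_slice; have -> : (fun h : R => (h *: v + p).1) =
    (fun h => h * v.1 + p.1) by apply/funext.
by derive_eq; ring.
Qed.

Lemma is_derive_profile_variable p v : U p -> is_derive p v Y (dY v p).
Proof.
move=> Up; have ds := is_derive_scaling v Up; have df := is_derive_fst p v.
have /is_derive_eq := is_deriveM df ds; apply.
by rewrite /GRing.scale /= /dY /Y; field.
Qed.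

Lemma is_derive_profile (F : R -> R) a p v : U p -> is_derive (Y p) 1 F a ->
  is_derive p v (fun q => F (Y q)) (a * dY v p).
Proof.
by move=> Up dF; exact: is_derive_chain dF (is_derive_profile_variable v Up).
Qed.

Lemma continuous_scaling p : U p -> {for p, continuous sg}.
Proof.
move=> Up; apply: cvgV; first by rewrite gt_eqF // sqrtr_gt0 subr_gt0.
apply: (@cvg_comp _ _ _ (fun q : R * R => T - q.2) Num.sqrt).
  by apply: cvgB; [exact: cvg_cst|exact: cvg_snd].
exact: sqrt_continuous.
Qed.

(** The time derivative of [sg] is [sg ^+ 3 / 2], a polynomial in [sg], so the induction on the
    order closes. *)
Lemma Ck_scaling k : Ck k U sg.
Proof.
elim: k => [|k IH]; first by split; [exact: continuous_scaling|exact: I].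
apply: (CkS oU (fx := fun=> 0) (ft := fun p => sg p * (sg p * (sg p * 2^-1)))).
- exact: continuous_scaling.
- by move=> p Up; have /is_derive_eq := is_derive_scaling (1, 0) Up; apply; rewrite !mul0r.
- move=> p Up; have /is_derive_eq := is_derive_scaling (0, 1) Up; apply.
  by rewrite /=; field.
- exact: Ck_cst.
- by do !apply: Ck_mul => //; exact: Ck_cst.
Qed.

Lemma Ck_profile_variable k : Ck k U Y.
Proof. by apply: Ck_mul => //; [exact: Ck_fst|exact: Ck_scaling]. Qed.

Lemma Ck_profile k (F F' : R -> R) : (forall y : R, is_derive y 1 F (F' y)) ->
  Ck k U (fun p => F' (Y p)) -> Ck k.+1 U (fun p => F (Y p)).
Proof.
move=> dF CF'; have CdY v : Ck k U (dY v).
  apply: Ck_add => //; apply: Ck_mul => //; try exact: Ck_cst.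
    exact: Ck_scaling.
  apply: Ck_mul => //; first exact: Ck_profile_variable.
  by apply: Ck_mul => //; exact: Ck_scaling.
apply: (CkS oU (fx := fun p => F' (Y p) * dY (1, 0) p)
  (ft := fun p => F' (Y p) * dY (0, 1) p)).
- move=> p Up; apply: (@cvg_comp _ _ _ Y F).
    exact: (Ck_continuous (Ck_profile_variable 0) Up).
  exact: is_derive_continuous (dF (Y p)).
- by move=> p Up; exact: is_derive_profile.
- by move=> p Up; exact: is_derive_profile.
- exact: Ck_mul.
- exact: Ck_mul.
Qed.

Lemma Ck_profile0 (F F' : R -> R) : (forall y : R, is_derive y 1 F (F' y)) ->
  Ck 0 U (fun p => F (Y p)).
Proof.
move=> dF; split; last exact: I.
move=> p Up; apply: (@cvg_comp _ _ _ Y F).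
  exact: (Ck_continuous (Ck_profile_variable 0) Up).
exact: is_derive_continuous (dF (Y p)).
Qed.

Section Frame.
Variables (c alpha : R) (m n b : R -> 'rV[R]_3).
Hypothesis SF : serret_frenet c alpha m n b.
Notation beta := (Num.sqrt (1 - alpha ^+ 2)).
Let k (x : R) := c * expR (alpha * x ^+ 2 / 4).
Let tau (x : R) := - (beta * x / 2).

Let dk (x : R) : is_derive x 1 k (alpha / 2 * x * k x).
Proof. by rewrite /k; derive_eq; field. Qed.

Let Ck_k i : Ck i U (fun p => k (Y p)).
Proof.
elim: i => [|i IH]; first exact: Ck_profile0 dk.
apply: Ck_profile dk _; apply: Ck_mul => //; apply: Ck_mul => //.
  exact: Ck_cst.
exact: Ck_profile_variable.
Qed.

Let Ck_tau i : Ck i U (fun p => tau (Y p)).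
Proof.
apply: (Ck_ext oU (f := fun p => - (beta / 2) * Y p)).
  by move=> p _; rewrite /tau; field.
by apply: Ck_mul => //; [exact: Ck_cst|exact: Ck_profile_variable].
Qed.

(** The derivative of each vector involves the others, so the induction on the order has to carry
    all three. *)
Lemma Ck_frame i j : [/\ Ck i U (fun p => m (Y p) 0 j),
  Ck i U (fun p => n (Y p) 0 j) & Ck i U (fun p => b (Y p) 0 j)].
Proof.
have dm := sf_m SF j; have dn := sf_n SF j; have db := sf_b SF j.
elim: i => [|i [Cm Cn Cb]].
  by split; [exact: Ck_profile0 dm|exact: Ck_profile0 dn|exact: Ck_profile0 db].
split; [apply: Ck_profile dm _|apply: Ck_profile dn _|apply: Ck_profile db _].
- exact: (Ck_mul oU (Ck_k i) Cn).
- apply: Ck_add => //; last exact: (Ck_mul oU (Ck_tau i) Cb).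
  apply: Ck_mul => //; apply: (Ck_ext oU (f := fun p => -1 * k (Y p))).
    by move=> p _; rewrite mulN1r.
  by apply: Ck_mul => //; exact: Ck_cst.
- apply: Ck_mul => //; apply: (Ck_ext oU (f := fun p => -1 * tau (Y p))).
    by move=> p _; rewrite mulN1r.
  by apply: Ck_mul => //; exact: Ck_cst.
Qed.

Lemma Cinfty_self_similar : Cinfty U (self_similar m T).
Proof. by move=> i; apply: Ck_rV => // j; have [] := Ck_frame i j. Qed.

Let is_derive_frame p v (F F' : R -> 'rV[R]_3) : U p ->
  (forall y : R, is_derive y 1 F (F' y)) ->
  is_derive p v (fun q => F (Y q)) (dY v p *: F' (Y p)).
Proof.
move=> Up dF; apply: is_derive_rV => j; rewrite mxE mulrC.
apply: (is_derive_profile (F := fun y => F y 0 j)) => //.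
exact: is_derive_coord.
Qed.

Lemma self_similar_derivatives p : U p ->
  [/\ dx (self_similar m T) p = (sg p * k (Y p)) *: n (Y p),
    dt (self_similar m T) p = (Y p * sg p ^+ 2 / 2 * k (Y p)) *: n (Y p) &
    dx (dx (self_similar m T)) p = (sg p ^+ 2 * (alpha / 2 * Y p * k (Y p))) *: n (Y p)
      - (sg p ^+ 2 * k (Y p) ^+ 2) *: m (Y p)
      + (sg p ^+ 2 * k (Y p) * tau (Y p)) *: b (Y p)].
Proof.
have [dF _ _ _] := SF.
have dm (y : R) : is_derive y 1 m (k y *: n y) by have [] := dF y.
have dn (y : R) : is_derive y 1 n (- (k y *: m y) + tau y *: b y) by have [] := dF y.
have dxE q : U q -> dx (self_similar m T) q = (sg q * k (Y q)) *: n (Y q).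
  move=> Uq; rewrite /dx; have [_ ->] := is_derive_frame (1, 0) Uq dm.
  by rewrite scalerA /dY /= !mul0r mul1r addr0.
move=> Up; split; first exact: dxE.
  rewrite /dt; have [_ ->] := is_derive_frame (0, 1) Up dm.
  by rewrite scalerA /dY /= !mul0r add0r; congr (_ *: _); field.
rewrite {1}/dx (near_eq_derive (g := fun q => (sg q * k (Y q)) *: n (Y q))); last first.
  by apply: filterS (near_open oU Up) => q; exact: dxE.
suff [_ ->] : is_derive p (1, 0) (fun q => (sg q * k (Y q)) *: n (Y q))
  ((sg p ^+ 2 * (alpha / 2 * Y p * k (Y p))) *: n (Y p)
      - (sg p ^+ 2 * k (Y p) ^+ 2) *: m (Y p)
      + (sg p ^+ 2 * k (Y p) * tau (Y p)) *: b (Y p)) by [].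
apply: is_derive_rV => j; under eq_fun do rewrite mxE.
have dsg := is_derive_scaling (1, 0) Up.
have dkY := is_derive_profile (1, 0) Up (dk (Y p)).
have dnY := is_derive_profile (1, 0) Up (sf_n SF j (Y p)).
have dskn := is_deriveM (is_deriveM dsg dkY) dnY.
apply: (is_derive_eq dskn).
by rewrite !mxE mulrfctE /GRing.scale /= /dY /= /k /tau; field.
Qed.

Lemma enorm_scale (a : R) (u : 'rV[R]_3) : 0 <= a -> dot u u = 1 ->
  enorm (a *: u) = a.
Proof.
move=> a0 u1; rewrite /enorm (_ : dot _ _ = a ^+ 2 * dot u u).
  by rewrite u1 mulr1 sqrtr_sqr ger0_norm.
by rewrite /dot big_distrr; apply: eq_bigr => j _; rewrite !mxE /=; ring.
Qed.

Lemma cross_linear (u v w z : 'rV[R]_3) (r s t : R) :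
  cross u (r *: v - s *: w + t *: z) = r *: cross u v - s *: cross u w + t *: cross u z.
Proof. by apply: rowP3; rewrite !mxE /=; ring. Qed.

Lemma cross_self (u : 'rV[R]_3) : cross u u = 0.
Proof. by apply: rowP3; rewrite !mxE /=; ring. Qed.

Hypotheses (alpha01 : 0 < alpha <= 1) (c0 : 0 < c).

(** As [k' = alpha / 2 * x * k] and [tau = - beta * x / 2], the two cross products have opposite [b]
    parts in the equation, while their [n] parts add up to [alpha ^+ 2 + beta ^+ 2 = 1] times the
    time derivative. *)
Lemma LLG_self_similar p : U p -> LLG_at alpha beta (self_similar m T) p.
Proof.
move=> Up; have [_ dtE dxxE] := self_similar_derivatives Up.
have [mn mb] := sf_cross SF (Y p).
have beta2 : beta ^+ 2 = 1 - alpha ^+ 2.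
  have [a0 a1] := andP alpha01.
  by rewrite sqr_sqrtr // subr_ge0 expr_le1 // ltW.
rewrite /LLG_at dtE dxxE -/(Y p) -[self_similar m T p]/(m (Y p)).
rewrite cross_linear cross_self mn mb scaler0 subr0.
(* Puts the inner cross product into the three-term form of [cross_linear]. *)
have -> (r s : R) : r *: b (Y p) + s *: - n (Y p) =
    0 *: 0 - s *: n (Y p) + r *: b (Y p) by rewrite scale0r sub0r scalerN addrC.
rewrite cross_linear mn mb scaler0 add0r.
apply/rowP => j; rewrite !mxE /tau.
apply/eqP; rewrite -subr_eq0; apply/eqP.
transitivity ((1 - alpha ^+ 2 - beta ^+ 2) * (Y p * sg p ^+ 2 / 2 * k (Y p)) * n (Y p) 0 j).
  by field.
by rewrite beta2 subrr !mul0r.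
Qed.

Lemma self_similar_spec :
  [/\ Cinfty [set p | p.2 < T] (self_similar m T),
    forall x t : R, t < T -> sphere2 (self_similar m T (x, t)),
    forall x t : R, t < T -> LLG_at alpha beta (self_similar m T) (x, t) &
    forall x t : R, t < T -> enorm (dx (self_similar m T) (x, t))
      = c / Num.sqrt (T - t) * expR (alpha * x ^+ 2 / (4 * (T - t)))].
Proof.
split; first exact: Cinfty_self_similar.
- move=> x t tT; rewrite /sphere2 /= /enorm.
  by have [-> _ _] := sf_norm SF (x / Num.sqrt (T - t)); rewrite sqrtr1.
- by move=> x t tT; exact: LLG_self_similar.
move=> x t tT; have Up : U (x, t) by [].
have [-> _ _] := self_similar_derivatives Up.
have [_ n1 _] := sf_norm SF (Y (x, t)).
rewrite enorm_scale //; last first.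
  by rewrite mulr_ge0 ?(ltW (scaling_gt0 Up)) // mulr_ge0 ?expR_ge0 // ltW.
have Tt : 0 < T - t by rewrite subr_gt0.
rewrite /k /Y /sg /= exprMn exprVn sqr_sqrtr ?ltW //.
rewrite (_ : alpha * (x ^+ 2 / (T - t)) / 4 = alpha * x ^+ 2 / (4 * (T - t))).
  by ring.
by field; rewrite gt_eqF.
Qed.

End Frame.
End SelfSimilar.

(** * Smooth cutoffs and weak derivatives *)

Section SmoothFunctions.
Variable R : realType.
Implicit Types (f g : R -> R) (n k : nat) (x : R).

(** Taking off the innermost derivative, instead of the outermost as in [smooth], lets closure under
    sums, products and inverses go by induction on the order. *)
Fixpoint derivable_n n f : Prop :=
  if n is n'.+1 then (forall x, derivable f x 1) /\ derivable_n n' (derive1 f)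
  else True.

Lemma smoothP f : smooth f <-> forall n, derivable_n n f.
Proof.
split=> [sf n|df k].
  elim: n f sf => [//|n IH] f sf; split; first exact: (sf 0%N).
  by apply: IH => k x; rewrite -derive1Sn; exact: sf.
elim: k f df => [|k IH] f df x; first by have [d _] := df 1%N; exact: d.
rewrite derive1Sn; apply: IH => n.
by have [_] := df n.+1.
Qed.

Lemma derivable_nS n f (f' : R -> R) : (forall x : R, is_derive x 1 f (f' x)) ->
  derivable_n n f' -> derivable_n n.+1 f.
Proof.
move=> df dnf'; split; first by move=> x; have [] := df x.
rewrite (_ : derive1 f = f') //; apply/funext => x.
by rewrite derive1E; have [_] := df x.
Qed.

Lemma derivable_n_is_derive n f : derivable_n n.+1 f ->
  forall x : R, is_derive x 1 f (derive1 f x).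
Proof. by move=> [df _] x; rewrite derive1E; exact: derivableP. Qed.

Lemma derivable_nW n f : derivable_n n.+1 f -> derivable_n n f.
Proof.
elim: n f => [//|n IH] f [df d'f]; split; first exact: df.
exact: (IH _ d'f).
Qed.

Lemma derivable_n_cst n (a : R) : derivable_n n (fun=> a).
Proof.
elim: n a => [//|n IH] a; apply: (derivable_nS _ (IH 0)) => x; exact: is_derive_cst.
Qed.

Lemma derivable_n_add n f g : derivable_n n f -> derivable_n n g ->
  derivable_n n (fun x => f x + g x).
Proof.
elim: n f g => [//|n IH] f g Df Dg; have df := derivable_n_is_derive Df.
have dg := derivable_n_is_derive Dg; have [_ f'] := Df; have [_ g'] := Dg.
by apply: (derivable_nS _ (IH _ _ f' g')) => x; exact: is_derive_addf (df x) (dg x).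
Qed.

Lemma derivable_n_mul n f g : derivable_n n f -> derivable_n n g ->
  derivable_n n (fun x => f x * g x).
Proof.
elim: n f g => [//|n IH] f g Df Dg; have df := derivable_n_is_derive Df.
have dg := derivable_n_is_derive Dg; have [_ f'] := Df; have [_ g'] := Dg.
apply: (derivable_nS _ (derivable_n_add (IH _ _ f' (derivable_nW Dg))
  (IH _ _ (derivable_nW Df) g'))) => x.
exact: is_derive_mulf (df x) (dg x).
Qed.

Lemma derivable_n_scale n (a : R) f : derivable_n n f -> derivable_n n (fun x => a * f x).
Proof. exact: (derivable_n_mul (derivable_n_cst n a)). Qed.

Lemma derivable_n_id n : derivable_n n (fun x => x).
Proof.
case: n => [//|n].
by apply: (derivable_nS _ (derivable_n_cst n 1)) => x; exact: is_derive_id.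
Qed.

Lemma derivable_n_inv n f : (forall x, f x != 0) -> derivable_n n f ->
  derivable_n n (fun x => (f x)^-1).
Proof.
move=> f0; elim: n => [//|n IH] Df; have df := derivable_n_is_derive Df.
have IV := IH (derivable_nW Df); have [_ f'] := Df.
have dinv (x : R) : is_derive x 1 (fun x => (f x)^-1)
    (-1 * derive1 f x * ((f x)^-1 * (f x)^-1)).
  have dfx := df x; derive_eq => //; field; exact: f0.
apply: (derivable_nS dinv); apply: derivable_n_mul; first exact: derivable_n_scale.
exact: derivable_n_mul.
Qed.

Lemma derivable_n_affine n f (r s : R) : derivable_n n f ->
  derivable_n n (fun x => f (r * x + s)).
Proof.
elim: n f => [//|n IH] f Df; have df := derivable_n_is_derive Df.
have [_ f'] := Df; apply: (derivable_nS _ (derivable_n_scale r (IH _ f'))) => x.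
exact: is_derive_affine.
Qed.

(* For [k = 0] the standard example of a flat smooth function; the family is
   stable under differentiation, and dividing by [x] shifts the index. *)
Definition flat k (x : R) : R := if 0 < x then x ^- k * expR (- x^-1) else 0.

Lemma flat_ge0 k x : 0 <= flat k x.
Proof.
rewrite /flat; case: ifP => // x0.
by rewrite mulr_ge0 ?expR_ge0 // invr_ge0 exprn_ge0 // ltW.
Qed.

Lemma flat_eq0 k x : x <= 0 -> flat k x = 0.
Proof. by move=> x0; rewrite /flat ltNge x0. Qed.

Lemma flat_gt0 k x : 0 < x -> 0 < flat k x.
Proof. by move=> x0; rewrite /flat x0 mulr_gt0 ?expR_gt0 // invr_gt0 exprn_gt0. Qed.

Lemma flatS k x : flat k x = flat k.+1 x * x.
Proof.
rewrite /flat; case: ifP => [x0|_]; last by rewrite mul0r.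
rewrite exprS; field.
by rewrite expf_neq0 ?gt_eqF.
Qed.

(** From the term of order [k.+1] in the series of [expR x^-1]. Linear decay is all that continuity
    at 0 requires. *)
Lemma flat_le k x : `|flat k x| <= (k.+1)`!%:R * `|x|.
Proof.
rewrite ger0_norm ?flat_ge0 // /flat; case: ifP => [x0|_]; last first.
  by rewrite mulr_ge0.
have u0 : 0 < x^-1 by rewrite invr_gt0.
have := expR_ge1Dxn k (ltW u0); have f0 : 0 < (k.+1)`!%:R :> R by rewrite ltr0n fact_gt0.
move=> H; have {}H : x^-1 ^+ k.+1 <= (k.+1)`!%:R * expR x^-1.
  by rewrite mulrC -ler_pdivrMr //; apply: le_trans H; rewrite lerDr.
rewrite (gtr0_norm x0) expRN -exprVn ler_pdivrMr ?expR_gt0 //.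
rewrite mulrAC -ler_pdivrMr // -exprSr.
exact: H.
Qed.

Lemma is_derive_flat k x : is_derive x 1 (flat k) (flat k.+2 x - k%:R * flat k.+1 x).
Proof.
have [x0|x0|->] := ltgtP x 0.
- apply: (@near_eq_is_derive _ _ _ (fun=> 0)).
    near=> y; rewrite flat_eq0 // ltW //; near: y; exact: lt_nbhsl.
  rewrite !flat_eq0 ?ltW // mulr0 subrr; exact: is_derive_cst.
- apply: (@near_eq_is_derive _ _ _ (fun y : R => (y ^+ k)^-1 * expR (- y^-1))).
    near=> y; rewrite /flat ifT //; near: y; exact: lt_nbhsr.
  have x_neq0 : x != 0 by rewrite gt_eqF.
  have xk : x ^+ k != 0 by rewrite expf_neq0.
  derive_eq => //; rewrite /flat x0 !exprS.
  case: k xk => [|k] xk /=; first by field.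
  by rewrite !exprS; field; rewrite expf_neq0.
- rewrite !flat_eq0 // mulr0 subrr; apply/is_derive1_caratheodory.
  (* By [flatS] the difference quotient of [flat k] at 0 is [flat k.+1] itself. *)
  exists (flat k.+1); split.
  + by move=> z; rewrite [flat k 0]flat_eq0 // !subr0 -flatS.
  + rewrite /prop_for /continuous_at flat_eq0 //; apply/cvgr0Pnorm_le => eps eps0.
    near=> z; apply: le_trans (flat_le _ _) _.
    rewrite mulrC -ler_pdivlMr ?ltr0n ?fact_gt0 //.
    near: z; apply: (@cvgr0_norm_le _ _ _ _ _ id) => //.
    by rewrite divr_gt0 // ltr0n fact_gt0.
  + by rewrite flat_eq0.
Unshelve. all: by end_near. Qed.

Lemma derivable_n_flat n k : derivable_n n (flat k).
Proof.
elim: n k => [//|n IH] k; apply: (derivable_nS (is_derive_flat k)).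
apply: (@derivable_n_add _ (flat k.+2) (fun x => - (k%:R * flat k.+1 x))) => //.
rewrite (_ : (fun x => _) = (fun x => - k%:R * flat k.+1 x)).
  exact: derivable_n_scale.
by apply/funext => x; rewrite mulNr.
Qed.

(** The usual smooth transition from 0 to 1 across the unit interval; [1 - x] is written
    [-1 * x + 1] to match [is_derive_affine]. *)
Definition step (x : R) : R := flat 0 x / (flat 0 x + flat 0 (-1 * x + 1)).
Definition step' (x : R) : R :=
  (flat 2 x * flat 0 (-1 * x + 1) + flat 0 x * flat 2 (-1 * x + 1))
  / (flat 0 x + flat 0 (-1 * x + 1)) ^+ 2.

Lemma step_denom_gt0 x : 0 < flat 0 x + flat 0 (-1 * x + 1).
Proof.
have [x0|x0] := leP x 0.
  by rewrite flat_eq0 // add0r flat_gt0 //; lra.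
by rewrite ltr_wpDr ?flat_ge0 // flat_gt0.
Qed.

Lemma is_derive_step x : is_derive x 1 step (step' x).
Proof.
have d1 := is_derive_flat 0 x.
have d2 := is_derive_affine (is_derive_flat 0 (-1 * x + 1)).
have D0 : flat 0 x + flat 0 (-1 * x + 1) != 0 by rewrite gt_eqF ?step_denom_gt0.
by rewrite /step /step'; derive_eq => //; field.
Qed.

Lemma step'_ge0 x : 0 <= step' x.
Proof.
by rewrite divr_ge0 ?sqr_ge0 // addr_ge0 ?mulr_ge0 ?flat_ge0.
Qed.

Lemma step'_eq0 x : x <= 0 \/ 1 <= x -> step' x = 0.
Proof.
case=> x0; rewrite /step'; first by rewrite !(@flat_eq0 _ x) // !mul0r addr0 mul0r.
by rewrite !(@flat_eq0 _ (-1 * x + 1)) ?mulr0 ?addr0 ?mul0r //; lra.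
Qed.

Lemma step_le0 x : x <= 0 -> step x = 0.
Proof. by move=> x0; rewrite /step flat_eq0 // mul0r. Qed.

Lemma step_ge1 x : 1 <= x -> step x = 1.
Proof.
move=> x1; rewrite /step [flat 0 (-1 * x + 1)]flat_eq0; last by lra.
by rewrite addr0 divff // gt_eqF // flat_gt0 //; lra.
Qed.

Lemma step_ge0_le1 x : 0 <= step x <= 1.
Proof.
have D0 := step_denom_gt0 x.
rewrite divr_ge0 ?flat_ge0 ?(ltW D0) //= ler_pdivrMr // mul1r lerDl.
exact: flat_ge0.
Qed.

Lemma derivable_n_step n : derivable_n n step.
Proof.
have df := derivable_n_flat n 0; have da := derivable_n_affine (-1) 1 df.
apply: derivable_n_mul => //; apply: derivable_n_inv; last exact: derivable_n_add.
by move=> x; rewrite gt_eqF // step_denom_gt0.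
Qed.

End SmoothFunctions.

(** * Integrals over segments *)

Section SegmentIntegrals.
Variable R : realType.
Notation mu := (@lebesgue_measure R).
Implicit Types (f g u v : R -> R) (a b x : R).

Lemma segment_integrableM u f (M a b : R) : continuous u ->
    measurable_fun setT f -> (forall x, `|f x| <= M) ->
  mu.-integrable `[a, b] (EFin \o (fun x => u x * f x)).
Proof.
move=> cu mf fM; have uM : mu.-integrable `[a, b] (EFin \o (fun x => M * u x)).
  apply: continuous_integrable_segment => x.
  by apply: cvgM; [exact: cvg_cst|exact: cu].
apply: le_integrable uM => //.
  apply/measurable_EFinP/measurable_funTS/measurable_funM => //.
  exact: continuous_measurable_fun.
move=> x _; rewrite /= lee_fin !normrM mulrC ler_wpM2r //.
exact: le_trans (fM x) (ler_norm M).
Qed.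

Lemma integrableDR (A : set R) f g : measurable A ->
  mu.-integrable A (EFin \o f) -> mu.-integrable A (EFin \o g) ->
  mu.-integrable A (EFin \o (fun x => f x + g x)).
Proof.
move=> mA If Ig; rewrite (_ : EFin \o _ = (EFin \o f) \+ (EFin \o g))%E //.
exact: integrableD.
Qed.

Lemma segment_integralD f a b x : a <= x <= b -> mu.-integrable `[a, b] (EFin \o f) ->
  \int[mu]_(y in `[a, b]) f y =
  \int[mu]_(y in `[a, x]) f y + \int[mu]_(y in `[x, b]) f y.
Proof.
move=> /andP[ax xb] If; apply/eqP; rewrite addrC -subr_eq; apply/eqP.
rewrite Rintegral_itvB ?bnd_simp // Rintegral_itv_obnd_cbnd //.
by apply: integrableS If => //; apply: subset_itvr; rewrite bnd_simp.
Qed.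

Lemma segment_integral_le f (K a b : R) : a <= b -> mu.-integrable `[a, b] (EFin \o f) ->
  (forall x, a <= x <= b -> `|f x| <= K) ->
  `|\int[mu]_(x in `[a, b]) f x| <= K * (b - a).
Proof.
move=> ab If fK; apply: le_trans (le_normr_Rintegral _ If) _ => //.
have -> : K * (b - a) = \int[mu]_(x in `[a, b]) (fun=> K) x.
  rewrite Rintegral_cst //= lebesgue_measure_itv /= lte_fin.
  by case: ltgtP ab => // -> _; rewrite subrr.
apply: le_Rintegral => //.
- exact: integrable_norm.
- by apply: continuous_integrable_segment => x; exact: cvg_cst.
Qed.

Lemma segment_integral_derive f (F : R -> R) a b : a <= b -> continuous f ->
  (forall x, is_derive x 1 F (f x)) -> \int[mu]_(x in `[a, b]) f x = F b - F a.
Proof.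
move=> + cf dF; rewrite le_eqVlt => /predU1P[->|ab].
  by rewrite set_itv1 Rintegral_set1 subrr.
have cF x : {for x, continuous F} by exact: is_derive_continuous (dF x).
rewrite /Rintegral (@continuous_FTC2 R f F) //.
- exact: continuous_subspaceT.
- split.
  + by move=> x _; have [] := dF x.
  + by apply: cvg_at_right_filter; exact: cF.
  + by apply: cvg_at_left_filter; exact: cF.
- by move=> x _; rewrite derive1E; have [_ ->] := dF x.
Qed.

Lemma Rintegral_supported f a b : (forall x, ~~ (a <= x <= b) -> f x = 0) ->
  \int[mu]_(x in setT) f x = \int[mu]_(x in `[a, b]) f x.
Proof.
move=> f0; rewrite [RHS]Rintegral_mkcond; congr Rintegral; apply/funext => x.
rewrite patchE; case: ifPn => // xab; rewrite f0 //.
by apply: contraNN xab => ab; rewrite inE /= in_itv.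
Qed.

End SegmentIntegrals.

(** * Integration by parts against a weak derivative *)

Section Cutoff.
Variable R : realType.
Notation mu := (@lebesgue_measure R).

Lemma continuous_derivable_n (f : R -> R) : derivable_n 1 f -> continuous f.
Proof.
by move=> df x; exact: is_derive_continuous (derivable_n_is_derive df x).
Qed.

Lemma continuous_step' : continuous (@step' R).
Proof.
have [_ [ds _]] := @derivable_n_step R 2.
rewrite (_ : @step' R = derive1 (@step R)).
  by apply: continuous_derivable_n; split.
by apply/funext => x; rewrite derive1E; have [_ ->] := is_derive_step x.
Qed.

Variables (f g N N' : R -> R) (Mf Mg L eta a b : R).
Hypotheses (mf : measurable_fun setT f) (mg : measurable_fun setT g).
Hypotheses (f_le : forall x, `|f x| <= Mf) (g_le : forall x, `|g x| <= Mg).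
Hypothesis fg : weak_derivative f g.
Hypotheses (dN : forall x : R, is_derive x 1 N (N' x)) (sN : smooth N).
Hypotheses (N_le : forall x, `|N x| <= L) (N'_le : forall x, `|N' x| <= L).
Hypothesis ab : a <= b.
Hypothesis N_eta : forall x, a - 1 <= x <= a \/ b <= x <= b + 1 -> `|N x| <= eta.

Let h x := N' x * f x + N x * g x.

Let cN : continuous N.
Proof. by move=> x; exact: is_derive_continuous (dN x). Qed.

Let cN' : continuous N'.
Proof.
have [_ dN'] := (smoothP N).1 sN 2.
rewrite (_ : N' = derive1 N); first exact: continuous_derivable_n.
by apply/funext => x; rewrite derive1E; have [_ ->] := dN x.
Qed.

Section Ramp.
Variable delta : R.
Hypotheses (delta0 : 0 < delta) (delta1 : delta <= 1).
Let r := delta^-1.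
(** [s1] rises from 0 at [a - delta] to 1 at [a], and [s2] falls from 1 at [b] to 0 at [b + delta].
    The ramps lie outside the segment, on which the cutoff [c] is 1. *)
Let s1 x := step (r * x + (1 - a * r)).
Let s2 x := step (- r * x + (1 + b * r)).
Let s1' x := r * step' (r * x + (1 - a * r)).
Let s2' x := - r * step' (- r * x + (1 + b * r)).
Let c x := s1 x * s2 x.
Let c' x := s1' x * s2 x + s1 x * s2' x.
Let A := a - delta.
Let B := b + delta.

Let r0 : 0 < r. Proof. by rewrite invr_gt0. Qed.

Let ds1 (x : R) : is_derive x 1 s1 (s1' x).
Proof. by apply: is_derive_affine; exact: is_derive_step. Qed.
Let ds2 (x : R) : is_derive x 1 s2 (s2' x).
Proof. by apply: is_derive_affine; exact: is_derive_step. Qed.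
Let dc (x : R) : is_derive x 1 c (c' x).
Proof. exact: is_derive_mulf (ds1 x) (ds2 x). Qed.

Let continuous_affine_step' (s t : R) : continuous (fun x => step' (s * x + t)).
Proof.
move=> x; apply: (@cvg_comp _ _ _ (fun y => s * y + t) (@step' R)).
  by apply: cvgD; [apply: cvgM; [exact: cvg_cst|exact: cvg_id]|exact: cvg_cst].
exact: continuous_step'.
Qed.

Let cs1' : continuous s1'.
Proof. by move=> x; apply: cvgM; [exact: cvg_cst|exact: continuous_affine_step']. Qed.
Let cs2' : continuous s2'.
Proof. by move=> x; apply: cvgM; [exact: cvg_cst|exact: continuous_affine_step']. Qed.
Let cs1 : continuous s1.
Proof. by move=> x; exact: is_derive_continuous (ds1 x). Qed.
Let cs2 : continuous s2.
Proof. by move=> x; exact: is_derive_continuous (ds2 x). Qed.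
Let cc : continuous c.
Proof. by move=> x; exact: is_derive_continuous (dc x). Qed.
Let cc' : continuous c'.
Proof.
move=> x; apply: cvgD; apply: cvgM.
- exact: cs1'.
- exact: cs2.
- exact: cs1.
- exact: cs2'.
Qed.

Let arg1 x : r * x + (1 - a * r) = (x - A) * r.
Proof. by rewrite /A /r; field; rewrite gt_eqF. Qed.
Let arg2 x : - r * x + (1 + b * r) = (B - x) * r.
Proof. by rewrite /B /r; field; rewrite gt_eqF. Qed.

Let s1'_ge0 x : 0 <= s1' x.
Proof. by rewrite mulr_ge0 ?step'_ge0 // ltW. Qed.
Let s2'_le0 x : s2' x <= 0.
Proof. by rewrite /s2' mulNr oppr_le0 mulr_ge0 ?step'_ge0 // ltW. Qed.

Let s1_left x : x <= A -> s1 x = 0 /\ s1' x = 0.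
Proof.
move=> xA; have xr : (x - A) * r <= 0 by rewrite pmulr_lle0 // subr_le0.
by rewrite /s1 /s1' arg1 step_le0 // step'_eq0 ?mulr0 //; left.
Qed.
Let s1_right x : a <= x -> s1 x = 1 /\ s1' x = 0.
Proof.
move=> ax; have xr : 1 <= (x - A) * r by rewrite ler_pdivlMr // mul1r /A; lra.
by rewrite /s1 /s1' arg1 step_ge1 // step'_eq0 ?mulr0 //; right.
Qed.
Let s2_right x : B <= x -> s2 x = 0 /\ s2' x = 0.
Proof.
move=> xB; have xr : (B - x) * r <= 0 by rewrite pmulr_lle0 // subr_le0.
by rewrite /s2 /s2' arg2 step_le0 // step'_eq0 ?mulr0 //; left.
Qed.
Let s2_left x : x <= b -> s2 x = 1 /\ s2' x = 0.
Proof.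
move=> xb; have xr : 1 <= (B - x) * r by rewrite ler_pdivlMr // mul1r /B; lra.
by rewrite /s2 /s2' arg2 step_ge1 // step'_eq0 ?mulr0 //; right.
Qed.

Let c_ge0_le1 x : `|c x| <= 1.
Proof.
have /andP[p0 p1] := step_ge0_le1 (r * x + (1 - a * r)).
have /andP[q0 q1] := step_ge0_le1 (- r * x + (1 + b * r)).
by rewrite -[leRHS]mulr1; apply: normM_le; rewrite ger0_norm.
Qed.

Let c_out x : ~~ (A <= x <= B) -> c x = 0 /\ c' x = 0.
Proof.
rewrite negb_and -!ltNge => /orP[xA|xB].
  by have [p p'] := s1_left (ltW xA); rewrite /c /c' p p' !mul0r addr0.
by have [p p'] := s2_right (ltW xB); rewrite /c /c' p p' !mulr0 addr0.
Qed.

Lemma cutoff_test_function : test_function (fun x => N x * c x).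
Proof.
split.
  apply/smoothP => n; apply: derivable_n_mul; first exact: (smoothP N).1 sN n.
  by apply: derivable_n_mul; apply: derivable_n_affine; exact: derivable_n_step.
apply: (@subclosed_compact _ _ `[A, B]); [exact: closed_closure|exact: segment_compact|].
rewrite [X in _ `<=` X]((closure_id `[A, B]).1 (@itv_closed _ _ _ _)).
apply: closure_subset => x /= Nc; rewrite in_itv /=.
by apply: contraNT Nc => /c_out[-> _]; rewrite mulr0.
Qed.

Let h_le x : `|h x| <= L * (Mf + Mg).
Proof. by rewrite mulrDr; apply: normD_le; exact: normM_le. Qed.

Let Aa : A <= a. Proof. by rewrite gerBl ltW. Qed.
Let bB : b <= B. Proof. by rewrite lerDl ltW. Qed.
Let AB : A <= B. Proof. exact: le_trans Aa (le_trans ab bB). Qed.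

Let I_ch s t : mu.-integrable `[s, t] (EFin \o (fun x => c x * h x)).
Proof.
have E : (fun x => c x * h x) = (fun x => c x * N' x * f x + c x * N x * g x).
  by apply/funext => x; rewrite /h; ring.
rewrite E; apply: integrableDR => //.
  apply: (segment_integrableM _ _ _ mf f_le) => x.
  by apply: cvgM; [exact: cc|exact: cN'].
apply: (segment_integrableM _ _ _ mg g_le) => x.
by apply: cvgM; [exact: cc|exact: cN].
Qed.

Let I_cf s t : mu.-integrable `[s, t] (EFin \o (fun x => N x * c' x * f x)).
Proof.
apply: (segment_integrableM _ _ _ mf f_le) => x.
by apply: cvgM; [exact: cN|exact: cc'].
Qed.

(** This is the definition of the weak derivative tested on [N * c]. *)
Lemma cutoff_identity :
  \int[mu]_(x in `[A, B]) (c x * h x) + \int[mu]_(x in `[A, B]) (N x * c' x * f x) = 0.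
Proof.
have dE : derive1 (fun x => N x * c x) = (fun x => N' x * c x + N x * c' x).
  apply/funext => x; rewrite derive1E.
  by have [_ ->] := is_derive_mulf (dN x) (dc x).
have /eqP := fg cutoff_test_function; rewrite dE -subr_eq0 opprK => /eqP E.
rewrite -RintegralD // -[RHS]E.
rewrite [X in _ = X + _](@Rintegral_supported _ _ A B); last first.
  by move=> x /c_out[-> ->]; rewrite !mulr0 addr0 mulr0.
rewrite [X in _ = _ + X](@Rintegral_supported _ _ A B); last first.
  by move=> x /c_out[-> _]; rewrite !mulr0.
rewrite -RintegralD //.
- by apply: eq_Rintegral => x _; rewrite /h; ring.
- rewrite (_ : (fun x => _) = (fun x => (N' x * c x + N x * c' x) * f x)); last first.
    by apply/funext => x; rewrite mulrC.
  apply: (segment_integrableM _ _ _ mf f_le) => x.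
  by apply: cvgD; apply: cvgM; [exact: cN'|exact: cc|exact: cN|exact: cc'].
- rewrite (_ : (fun x => _) = (fun x => (N x * c x) * g x)); last first.
    by apply/funext => x; rewrite mulrC.
  apply: (segment_integrableM _ _ _ mg g_le) => x.
  by apply: cvgM; [exact: cN|exact: cc].
Qed.

(** The bound has the primitive [eta * Mf * (s1 - s2)], whose total increment is [2 * eta * Mf]
    whatever [delta]: steep ramps cost nothing. *)
Let cf_le x : A <= x <= B -> `|N x * c' x * f x| <= eta * Mf * (s1' x - s2' x).
Proof.
move=> /andP[Ax xB]; have [p0 p1] := andP (step_ge0_le1 (r * x + (1 - a * r))).
have [q0 q1] := andP (step_ge0_le1 (- r * x + (1 + b * r))).
have c'_le : `|c' x| <= s1' x - s2' x.
  rewrite -[X in _ <= X - _]mulr1 -[X in _ <= _ - X]mul1r.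
  rewrite -mulrN; apply: normD_le; apply: normM_le.
  - by rewrite ger0_norm.
  - by rewrite ger0_norm.
  - by rewrite ger0_norm.
  - by rewrite ler0_norm.
have ramp : a - 1 <= x <= a \/ b <= x <= b + 1 ->
    `|N x * c' x * f x| <= eta * Mf * (s1' x - s2' x).
  move=> /N_eta Nx; rewrite [leRHS]mulrAC.
  by apply: normM_le => //; exact: normM_le.
have [xa|ax] := leP x a.
  by apply: ramp; left; rewrite xa andbT; apply: le_trans Ax; rewrite lerD2l lerN2.
have [bx|xb] := leP b x.
  by apply: ramp; right; rewrite bx /=; apply: le_trans xB _; rewrite lerD2l.
have [_ z1] := s1_right (ltW ax); have [_ z2] := s2_left (ltW xb).
by rewrite /c' z1 z2 mul0r mulr0 addr0 mulr0 mul0r normr0 subrr mulr0.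
Qed.

Lemma weak_ibp_ramp :
  `|\int[mu]_(x in `[a, b]) h x| <= 2 * Mf * eta + delta * (2 * (L * (Mf + Mg))).
Proof.
have E := cutoff_identity; have I1 := I_ch A B.
rewrite (@segment_integralD _ _ A B a) ?Aa ?(le_trans ab) // in E.
rewrite (@segment_integralD _ _ a B b) ?ab ?bB // in E.
have cE : \int[mu]_(x in `[a, b]) (c x * h x) = \int[mu]_(x in `[a, b]) h x.
  apply: eq_Rintegral => x; rewrite inE /= in_itv /= => /andP[ax xb].
  have [p _] := s1_right ax; have [q _] := s2_left xb.
  by rewrite /c p q !mul1r.
rewrite cE in E.
have ch_le x : `|c x * h x| <= L * (Mf + Mg).
  by rewrite -[leRHS]mul1r; apply: normM_le.
have B1 : `|\int[mu]_(x in `[A, a]) (c x * h x)| <= L * (Mf + Mg) * delta.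
  have := segment_integral_le Aa (I_ch A a) (fun x _ => ch_le x).
  by rewrite (_ : a - A = delta) //; rewrite /A; ring.
have B2 : `|\int[mu]_(x in `[b, B]) (c x * h x)| <= L * (Mf + Mg) * delta.
  have := segment_integral_le bB (I_ch b B) (fun x _ => ch_le x).
  by rewrite (_ : B - b = delta) //; rewrite /B; ring.
have B3 : `|\int[mu]_(x in `[A, B]) (N x * c' x * f x)| <= eta * Mf * 2.
  apply: le_trans (le_normr_Rintegral _ (I_cf A B)) _ => //.
  pose F x := eta * Mf * (s1 x - s2 x).
  have dF (x : R) : is_derive x 1 F (eta * Mf * (s1' x - s2' x)).
    have d1 := ds1 x; have d2 := ds2 x; rewrite /F; derive_eq; ring.
  have cF : continuous (fun x => eta * Mf * (s1' x - s2' x)).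
    move=> x; apply: cvgM; first exact: cvg_cst.
    by apply: cvgB; [exact: cs1'|exact: cs2'].
  have -> : eta * Mf * 2 = \int[mu]_(x in `[A, B]) (eta * Mf * (s1' x - s2' x)).
    rewrite (segment_integral_derive AB cF dF) /F.
    have [-> _] := s1_left (lexx A); have [-> _] := s2_right (lexx B).
    have [-> _] := s1_right (le_trans ab bB).
    have [-> _] := s2_left (le_trans Aa ab); ring.
  apply: le_Rintegral => //.
  - exact: integrable_norm (I_cf A B).
  - exact: continuous_integrable_segment.
have {}E : \int[mu]_(x in `[a, b]) h x =
    - (\int[mu]_(x in `[A, a]) (c x * h x) + \int[mu]_(x in `[b, B]) (c x * h x)
    + \int[mu]_(x in `[A, B]) (N x * c' x * f x)).
  by apply/eqP; rewrite -addr_eq0 -[X in _ == X]E; apply/eqP; ring.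
rewrite E normrN; apply: le_trans (normD_le (normD_le B1 B2) B3) _.
by rewrite le_eqVlt; apply/predU1P; left; ring.
Qed.

End Ramp.

(* Integration by parts on a segment, up to the boundary terms: [f] has no
   pointwise values, so that the primitive is multiplied by a smooth cutoff
   whose ramps shrink to the end points. *)
Lemma weak_integration_by_parts :
  `|\int[mu]_(x in `[a, b]) (N' x * f x + N x * g x)| <= 2 * Mf * eta.
Proof.
have K0 : 0 <= 2 * (L * (Mf + Mg)).
  have p (F : R -> R) M : (forall x, `|F x| <= M) -> 0 <= M.
    by move=> /(_ 0); exact: le_trans.
  by rewrite mulr_ge0 // mulr_ge0 ?addr_ge0 //; (exact: p N_le || exact: p f_le
    || exact: p g_le).
set K := 2 * (L * (Mf + Mg)) in K0.
(* The minimum with 1 keeps the ramps where [eta] bounds [N]; [K + 1] is used because [K] may be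
   0. *)
apply/ler_addgt0Pr => e e0; pose delta := Num.min 1 (e / (K + 1)).
have eK : 0 < e / (K + 1) by rewrite divr_gt0 // ltr_wpDl.
have delta0 : 0 < delta by rewrite lt_min ltr01 eK.
have delta1 : delta <= 1 by rewrite ge_min lexx.
apply: le_trans (weak_ibp_ramp delta0 delta1) _; rewrite lerD2l -/K.
apply: (@le_trans _ _ (e / (K + 1) * K)).
  by rewrite ler_wpM2r // ge_min lexx orbT.
rewrite mulrAC ler_pdivrMr ?ltr_wpDl // ler_pM2l //; lra.
Qed.

End Cutoff.

(** * Convergence to zero at the blow-up time *)

Section ImproperIntegral.
Variable R : realType.
Notation mu := (@lebesgue_measure R).
Implicit Types (u v : R -> R) (a b x : R).

Lemma improper_integralD u v (k l : R) : improper_integral u k ->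
  improper_integral v l -> improper_integral (fun x => u x + v x) (k + l).
Proof.
move=> [Iu uk] [Iv vl]; split=> [a b|]; first exact: integrableDR.
have -> : (fun ab : R * R => \int[mu]_(x in `[ab.1, ab.2]) (u x + v x)) =
    (fun ab => \int[mu]_(x in `[ab.1, ab.2]) u x + \int[mu]_(x in `[ab.1, ab.2]) v x).
  by apply/funext => ab; rewrite RintegralD.
exact: cvgD.
Qed.

(** A Cauchy criterion at each end separately, as [a] and [b] go to infinity independently; [K]
    survives in the limit. *)
Lemma improper_integral_of_bounds u (g : R -> R) (K : R) :
    (forall a b, mu.-integrable `[a, b] (EFin \o u)) ->
    (forall a b, 1 <= a -> a <= b -> `|\int[mu]_(x in `[a, b]) u x| <= g a) ->
    (forall a b, b <= -1 -> a <= b -> `|\int[mu]_(x in `[a, b]) u x| <= g (- b)) ->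
    (forall a b, a <= b -> `|\int[mu]_(x in `[a, b]) u x| <= K) ->
    g x @[x --> +oo] --> (0 : R) ->
  exists2 l, improper_integral u l & `|l| <= K.
Proof.
move=> Iu gr gl uK g0.
have [|L0 lim0 _] := @increment_bounded_cvg R
    (fun b => \int[mu]_(x in `[1, b]) u x) g 1 _ g0.
  move=> x y x1 xy; rewrite (@segment_integralD _ _ 1 y x) ?x1 //.
  by rewrite addrAC subrr add0r; exact: gr.
have [|L1 lim1 _] := @increment_bounded_cvg R
    (fun a => \int[mu]_(x in `[- a, -1]) u x) g 1 _ g0.
  move=> x y x1 xy; rewrite (@segment_integralD _ _ (- y) (-1) (- x)) ?lerN2 ?x1 ?xy //.
  rewrite addrK; have := gl (- y) (- x); rewrite opprK !lerN2; exact.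
pose F (ab : R * R) := \int[mu]_(x in `[ab.1, ab.2]) u x.
pose FP := filter_prod (-oo : set_system R) (+oo : set_system R).
have fstNy : (fun ab => ab.1) @ FP --> (-oo : set_system R) by exact: cvg_fst.
have sndy : (fun ab => ab.2) @ FP --> (+oo : set_system R) by exact: cvg_snd.
have near1 (r : R) : \forall ab \near FP, ab.1 <= r.
  exact: (fstNy _ (nbhs_ninfty_le (num_real r))).
have near2 (r : R) : \forall ab \near FP, r <= ab.2.
  exact: (sndy _ (nbhs_pinfty_ge (num_real r))).
have lim : F ab @[ab --> FP] --> L1 + \int[mu]_(x in `[-1, 1]) u x + L0.
  have lim2 : \int[mu]_(x in `[- - ab.1, -1]) u x + \int[mu]_(x in `[-1, 1]) u x
      + \int[mu]_(x in `[1, ab.2]) u x @[ab --> FP]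
      --> L1 + \int[mu]_(x in `[-1, 1]) u x + L0.
    apply: cvgD; [apply: cvgD; last exact: cvg_cst|].
      apply: (cvg_comp _ _ _ lim1); exact/cvgNry.
    exact: (cvg_comp _ _ sndy lim0).
  apply: cvg_trans lim2; apply: near_eq_cvg.
  near=> ab; rewrite /F opprK.
  have a1 : ab.1 <= -1.
    by near: ab; exact: near1.
  have b1 : 1 <= ab.2.
    by near: ab; exact: near2.
  rewrite (@segment_integralD _ _ ab.1 ab.2 1); last 2 first.
  - by rewrite b1 andbT; apply: le_trans a1 _; lra.
  - exact: Iu.
  rewrite (@segment_integralD _ _ ab.1 1 (-1)) ?a1 //=; lra.
exists (L1 + \int[mu]_(x in `[-1, 1]) u x + L0); first by split.
apply/ler_addgt0Pr => eps eps0.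
have /cvgrPdist_le/(_ eps eps0) limd := lim.
near FP => ab.
have a1 : ab.1 <= 0.
  by near: ab; exact: near1.
have b1 : 0 <= ab.2.
  by near: ab; exact: near2.
have d : `|L1 + \int[mu]_(x in `[-1, 1]) u x + L0 - F ab| <= eps.
  by near: ab; exact: limd.
rewrite -[X in `|X|](subrK (F ab)) addrC.
by apply: normD_le => //; apply: uK; exact: le_trans a1 b1.
Unshelve. all: by end_near. Qed.

End ImproperIntegral.

(** * Essentially bounded functions *)

Section EssentiallyBounded.
Variable R : realType.
Notation mu := (@lebesgue_measure R).
Implicit Types f g : R -> R.

(** The integration by parts asks for bounds at every point. Clipping at an essential bound provides
    them and changes the function on a null set only. *)
Lemma Linfty_truncation f : Linfty f -> measurable_fun setT f /\
  exists f' M, [/\ measurable_fun setT f', forall x, `|f' x| <= M &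
    {ae mu, forall x, f x = f' x}].
Proof.
move=> /andP[]; rewrite !inE => mf; rewrite /= /finite_norm unlock => finf.
split=> //.
have mu0 : (0 < mu setT)%E.
  apply: (@lt_le_trans _ _ (mu `[0, 1])).
    by rewrite lebesgue_measure_itv /= lte_fin ltr01 sube0 lte_fin.
  by apply: le_measure; rewrite ?inE.
rewrite mu0 in finf.
have [M fM] : exists M : R, (ess_sup mu (abse \o (EFin \o f)) <= M%:E)%E.
  move: finf; case: (ess_sup _ _) => [r _|//|_]; first by exists r.
  by exists 0; rewrite leNye.
exists (fun x => Num.max (- `|M|) (Num.min (f x) `|M|)), `|M|; split.
- apply: measurable_maxr; first exact: measurable_cst.
  by apply: measurable_minr => //; exact: measurable_cst.
- move=> x; rewrite ler_norml le_max lexx /= ge_max ge_min lexx orbT andbT.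
  by rewrite (le_trans _ (normr_ge0 M)) // oppr_le0.
- have /ess_supP := fM; apply: filterS => x /=.
  rewrite lee_fin => fxM; have {}fxM := le_trans fxM (ler_norm M).
  move: fxM; rewrite ler_norml => /andP[f1 f2].
  by rewrite (min_idPl f2) (max_idPr f1).
Qed.

Lemma ae_eq_Rintegral (D : set R) f g : measurable D ->
  measurable_fun setT f -> measurable_fun setT g ->
  {ae mu, forall x, f x = g x} ->
  \int[mu]_(x in D) f x = \int[mu]_(x in D) g x.
Proof.
move=> mD mf mg fg; congr fine; apply: ae_eq_integral => //.
- exact/measurable_EFinP/measurable_funTS.
- exact/measurable_EFinP/measurable_funTS.
- apply: filterS fg => [|x -> //]; exact: (ae_filter_ringOfSetsType mu).
Qed.

Lemma ae_eq_RintegralM (D : set R) f g (u : R -> R) : measurable D -> continuous u ->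
  measurable_fun setT f -> measurable_fun setT g ->
  {ae mu, forall x, f x = g x} ->
  \int[mu]_(x in D) (u x * f x) = \int[mu]_(x in D) (u x * g x).
Proof.
move=> mD cu mf mg fg; have mu' := continuous_measurable_fun cu.
apply: ae_eq_Rintegral => //; try exact: measurable_funM.
apply: filterS fg => [|x -> //]; exact: (ae_filter_ringOfSetsType mu).
Qed.

Lemma weak_derivative_ae f g f' g' :
  measurable_fun setT f -> measurable_fun setT f' -> {ae mu, forall x, f x = f' x} ->
  measurable_fun setT g -> measurable_fun setT g' -> {ae mu, forall x, g x = g' x} ->
  weak_derivative f g -> weak_derivative f' g'.
Proof.
move=> mf mf' ff' mg mg' gg' fg eta Teta; have [seta _] := Teta.
have deta : derivable_n 2 eta by exact: (smoothP eta).1 seta 2.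
have ceta : continuous eta by exact: continuous_derivable_n (derivable_nW deta).
have ceta' : continuous (derive1 eta) by have [_] := deta; exact: continuous_derivable_n.
have swap (u v : R -> R) : \int[mu]_(x in setT) (u x * v x) =
    \int[mu]_(x in setT) (v x * u x) by apply: eq_Rintegral => x _; rewrite mulrC.
have E1 := ae_eq_RintegralM measurableT ceta' mf mf' ff'.
have E2 := ae_eq_RintegralM measurableT ceta mg mg' gg'.
rewrite (swap f' (derive1 eta)) -E1 (swap (derive1 eta) f) (fg eta Teta).
by rewrite (swap g eta) E2 (swap eta g').
Qed.

End EssentiallyBounded.

(** * The rescaled profile against a function with bounded weak derivative *)

Section Oscillation.
Variable R : realType.
Notation mu := (@lebesgue_measure R).

(** The majorant has primitive [atan] and total mass pi. It comes from squaring
    [1 + z / 2 <= expR (z / 2)], where the left side is at least [a / 8 * (1 + y ^+ 2)]; 128 is 2 *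
    64. *)
Lemma gaussian_le_lorentz (a y : R) : 0 < a <= 1 ->
  (1 + `|y|) * expR (- a * y ^+ 2 / 4) <= 128 / a ^+ 2 / (1 + y ^+ 2).
Proof.
move=> /andP[a0 a1]; set z := a * y ^+ 2 / 4.
have -> : - a * y ^+ 2 / 4 = - z by rewrite /z !mulNr.
have y2 : 0 <= y ^+ 2 by exact: sqr_ge0.
have D0 : 0 < 1 + y ^+ 2 by rewrite ltr_wpDr.
have u0 : 0 < a / 8 * (1 + y ^+ 2) by rewrite mulr_gt0 // divr_gt0.
have le1 : a / 8 * (1 + y ^+ 2) <= expR (z / 2).
  apply: le_trans (expR_ge1Dx _); rewrite /z; lra.
have le2 : (a / 8 * (1 + y ^+ 2)) ^+ 2 <= expR z.
  rewrite (_ : expR z = expR (z / 2) ^+ 2); last by rewrite -expRM_natr; congr expR; lra.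
  by apply: lerXn2r; rewrite ?nnegrE ?expR_ge0 // ltW.
rewrite expRN ler_pdivrMr ?expR_gt0 //.
have y1 : 1 + `|y| <= 2 * (1 + y ^+ 2).
  by have := real_normK (num_real y); nra.
apply: le_trans y1 _.
rewrite (_ : 2 * (1 + y ^+ 2) =
  128 / a ^+ 2 / (1 + y ^+ 2) * (a / 8 * (1 + y ^+ 2)) ^+ 2); last first.
  by field; rewrite !gt_eqF.
by rewrite ler_wpM2l // divr_ge0 ?(ltW D0) // divr_ge0 // sqr_ge0.
Qed.

Lemma derivable_n_gauss i (a : R) : derivable_n i (fun y => expR (a * y ^+ 2 / 4)).
Proof.
elim: i => [//|i IH].
have dgauss (y : R) : is_derive y 1 (fun y => expR (a * y ^+ 2 / 4))
    (a / 2 * y * expR (a * y ^+ 2 / 4)) by derive_eq; field.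
apply: (derivable_nS dgauss); apply: derivable_n_mul => //.
apply: derivable_n_scale; exact: derivable_n_id.
Qed.

Variables (c alpha : R) (m n b : R -> 'rV[R]_3) (j : 'I_3).
Hypotheses (SF : serret_frenet c alpha m n b) (alpha01 : 0 < alpha <= 1) (c0 : 0 < c).
Notation beta := (Num.sqrt (1 - alpha ^+ 2)).
Let e (x : R) := expR (- alpha * x ^+ 2 / 4).
Let mj x := m x 0 j.
Let nj x := n x 0 j.
Let bj x := b x 0 j.
Let tau (x : R) := - (beta * x / 2).

Lemma derivable_n_frame i : [/\ derivable_n i mj, derivable_n i nj & derivable_n i bj].
Proof.
have dm := sf_m SF j; have dn := sf_n SF j; have db := sf_b SF j.
elim: i => [|i [Im In Ib]]; first by [].
have Dk := derivable_n_scale c (derivable_n_gauss i alpha).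
have Dt (s : R) : derivable_n i (fun x => - (s * (beta * x / 2))).
  rewrite (_ : (fun x => _) = (fun x => - (s * beta / 2) * x)).
    by apply: derivable_n_scale; exact: derivable_n_id.
  by apply/funext => x; field.
split.
- by apply: (derivable_nS dm); exact: derivable_n_mul.
- apply: (derivable_nS dn); apply: derivable_n_add.
    apply: derivable_n_mul => //.
    rewrite (_ : (fun x => _) = (fun x => -1 * (c * expR (alpha * x ^+ 2 / 4)))).
      exact: derivable_n_scale.
    by apply/funext => x; rewrite mulN1r.
  apply: derivable_n_mul => //.
  by have := Dt 1; under eq_fun do rewrite mul1r.
- apply: (derivable_nS db); apply: derivable_n_mul => //.
  by have := Dt (-1); under eq_fun do rewrite mulN1r.
Qed.

Let comp_le1 x : [/\ `|mj x| <= 1, `|nj x| <= 1 & `|bj x| <= 1].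
Proof.
have := sf_col SF x j j; rewrite eqxx mulr1n -!expr2 => E.
have sq (z : R) : z ^+ 2 <= 1 -> `|z| <= 1.
  by move=> z1; rewrite -(@ler_pXn2r _ 2) ?nnegrE // expr1n real_normK ?num_real.
have p1 := sqr_ge0 (m x 0 j); have p2 := sqr_ge0 (n x 0 j); have p3 := sqr_ge0 (b x 0 j).
by split; apply: sq; rewrite /mj /nj /bj; move: p1 p2 p3 E; nra.
Qed.

(* [q = n / k], and [m = rem - q'] with an integrable [rem]. *)
Let q y := c^-1 * (e y * nj y).
Let rem y := c^-1 * e y * (tau y * bj y - alpha * y / 2 * nj y).

Let e_gt0 y : 0 < e y. Proof. exact: expR_gt0. Qed.
Let cV0 : 0 <= c^-1. Proof. by rewrite invr_ge0 ltW. Qed.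

Let dq (y : R) : is_derive y 1 q (rem y - mj y).
Proof.
have dn := sf_n SF j y; have de : is_derive y 1 e (- (alpha * y / 2) * e y).
  exact: is_derive_expRN.
have kE : expR (alpha * y ^+ 2 / 4) = (e y)^-1 by rewrite /e !mulNr expRN invrK.
rewrite kE in dn; rewrite /q /rem /tau /mj /bj /nj; derive_eq; field.
by rewrite !gt_eqF.
Qed.

Let beta01 : 0 <= beta <= 1.
Proof.
by rewrite sqrtr_ge0 /= -[leRHS]sqrtr1 ler_wsqrtr // lerBlDr lerDl sqr_ge0.
Qed.

Let rem_le y : `|rem y| <= c^-1 * (`|y| * e y).
Proof.
have [_ n1 b1] := comp_le1 y; have [a0 a1] := andP alpha01; have [be0 be1] := andP beta01.
have y0 := normr_ge0 y.
rewrite /rem [`|y| * e y]mulrC mulrA; apply: normM_le.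
  by rewrite ger0_norm // mulr_ge0 // ltW.
rewrite [leRHS](_ : _ = 1 * `|y| / 2 * 1 + 1 * `|y| / 2 * 1); last by field.
apply: normB_le; apply: normM_le => //.
  rewrite /tau normrN; apply: normM_le; last by rewrite ger0_norm.
  by apply: normM_le => //; rewrite ger0_norm.
apply: normM_le; last by rewrite ger0_norm.
by apply: normM_le => //; rewrite ger0_norm // ltW.
Qed.

Let K := 128 / alpha ^+ 2.
Let K0 : 0 <= K. Proof. by rewrite divr_ge0 // sqr_ge0. Qed.

Let lorentz y : (1 + `|y|) * e y <= K / (1 + y ^+ 2).
Proof. exact: gaussian_le_lorentz. Qed.

Let onesqr_ge1 (y : R) : 1 <= 1 + y ^+ 2.
Proof. by rewrite lerDl sqr_ge0. Qed.

Let q_le y : `|q y| <= c^-1 * (K / (1 + y ^+ 2)).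
Proof.
have [_ n1 _] := comp_le1 y; apply: normM_le; first by rewrite ger0_norm.
apply: le_trans (lorentz y); rewrite mulrC.
apply: normM_le; last by rewrite ger0_norm // ltW.
by apply: le_trans n1 _; rewrite lerDl.
Qed.

Section Scaled.
Variables (lam : R) (f g : R -> R) (Mf Mg : R).
Hypothesis lam0 : 0 < lam.
Hypotheses (mf : measurable_fun setT f) (mg : measurable_fun setT g).
Hypotheses (f_le : forall x, `|f x| <= Mf) (g_le : forall x, `|g x| <= Mg).
Hypothesis fg : weak_derivative f g.

Let Mf0 : 0 <= Mf. Proof. exact: le_trans (f_le 0). Qed.
Let Mg0 : 0 <= Mg. Proof. exact: le_trans (g_le 0). Qed.

(** The added 0 matches the affine form of [is_derive_affine] and [derivable_n_affine]. *)
Let y x := lam^-1 * x + 0.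
Let N x := lam * q (y x).
Let N' x := rem (y x) - mj (y x).
Let kappa := c^-1 * (lam * Mg + Mf) * K.

Let dN (x : R) : is_derive x 1 N (N' x).
Proof.
have d := is_derive_affine (dq (y x)); rewrite /N; derive_eq.
by rewrite /N'; field; rewrite gt_eqF.
Qed.

Let sN : smooth N.
Proof.
apply/smoothP => i; apply: derivable_n_scale; apply: derivable_n_affine.
apply: derivable_n_scale; apply: derivable_n_mul; first exact: derivable_n_gauss.
by have [] := derivable_n_frame i.
Qed.

Let N_le x : `|N x| <= lam * (c^-1 * K) / (1 + y x ^+ 2).
Proof.
rewrite -mulrA; apply: normM_le; first by rewrite ger0_norm // ltW.
by rewrite -mulrA; exact: q_le.
Qed.

Let cvK : 0 <= c^-1 * K. Proof. by rewrite mulr_ge0. Qed.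

Let div_le (M z : R) : 0 <= M -> M / (1 + z ^+ 2) <= M.
Proof.
by move=> M0; rewrite ler_pdivrMr ?(lt_le_trans ltr01) // ler_peMr.
Qed.

(** One bound for both [N] and [N']. Its size is immaterial, since it disappears when the ramps
    shrink. *)
Let N_bounded x : `|N x| <= lam * (c^-1 * K) + c^-1 * K + 1.
Proof.
apply: le_trans (N_le x) _; apply: le_trans (div_le _ _) _.
  by rewrite mulr_ge0 // ltW.
by rewrite -addrA lerDl addr_ge0.
Qed.

Let N'_bounded x : `|N' x| <= lam * (c^-1 * K) + c^-1 * K + 1.
Proof.
have [m1 _ _] := comp_le1 (y x).
have r1 : `|rem (y x)| <= c^-1 * K.
  apply: le_trans (rem_le _) _; rewrite ler_wpM2l //.
  apply: le_trans (div_le (y x) K0); apply: le_trans (lorentz _).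
  by rewrite ler_wpM2r ?(ltW (e_gt0 _)) // lerDr.
rewrite -[leRHS]addrA; apply: le_trans (normB_le r1 m1) _.
by rewrite lerDr mulr_ge0 // ltW.
Qed.

Let cN : continuous N.
Proof. by move=> x; exact: is_derive_continuous (dN x). Qed.

Let cy : continuous y.
Proof.
move=> x; apply: cvgD; last exact: cvg_cst.
by apply: cvgM; [exact: cvg_cst|exact: cvg_id].
Qed.

Let cmy : continuous (fun x => mj (y x)).
Proof.
move=> x; apply: (@cvg_comp _ _ _ y mj); first exact: cy.
exact: is_derive_continuous (sf_m SF j _).
Qed.

Let cremy : continuous (fun x => rem (y x)).
Proof.
have [Dm Dn Db] := derivable_n_frame 1.
have cr : continuous rem.
  apply: continuous_derivable_n; apply: derivable_n_mul.
    by apply: derivable_n_scale; exact: derivable_n_gauss.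
  rewrite (_ : (fun y => _) = (fun y => (- (beta / 2) * y) * bj y
      + (- (alpha / 2) * y) * nj y)).
    have lin (s : R) : derivable_n 1 (fun y => s * y).
      by apply: derivable_n_scale; exact: derivable_n_id.
    apply: derivable_n_add; first exact: (derivable_n_mul (lin _) Db).
    exact: (derivable_n_mul (lin _) Dn).
  by apply/funext => z; rewrite /tau; field.
by move=> x; apply: (@cvg_comp _ _ _ y rem); [exact: cy|exact: cr].
Qed.

Let I_f (u : R -> R) s t : continuous u ->
  mu.-integrable `[s, t] (EFin \o (fun x => u x * f x)).
Proof. by move=> cu; exact: segment_integrableM cu mf f_le. Qed.
Let I_g (u : R -> R) s t : continuous u ->
  mu.-integrable `[s, t] (EFin \o (fun x => u x * g x)).
Proof. by move=> cu; exact: segment_integrableM cu mg g_le. Qed.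

(** As [mj = rem - q'], the integrand is [N * g + rem * f] minus [N' * f + N * g]. The latter is
    left to the boundary terms, and the former is dominated by a Lorentzian with primitive a
    multiple of [atan]. *)
Lemma scaled_segment_le (s t eta : R) : s <= t ->
    (forall x, s - 1 <= x <= s \/ t <= x <= t + 1 -> `|N x| <= eta) ->
  `|\int[mu]_(x in `[s, t]) (mj (x / lam) * f x)|
    <= 2 * Mf * eta + kappa * lam * (atan (t / lam) - atan (s / lam)).
Proof.
move=> st Neta.
have yE x : x / lam = y x by rewrite /y addr0 mulrC.
have B1 := weak_integration_by_parts mf mg f_le g_le fg dN sN N_bounded N'_bounded st Neta.
have cN' : continuous N' by move=> x; apply: cvgB; [exact: cremy|exact: cmy].
have I1 : mu.-integrable `[s, t] (EFin \o (fun x => N' x * f x + N x * g x)).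
  by apply: integrableDR => //; [exact: I_f|exact: I_g].
have I2 : mu.-integrable `[s, t] (EFin \o (fun x => N x * g x + rem (y x) * f x)).
  by apply: integrableDR => //; [exact: I_g|exact: I_f].
have -> : \int[mu]_(x in `[s, t]) (mj (x / lam) * f x) =
    \int[mu]_(x in `[s, t]) (N x * g x + rem (y x) * f x)
    - \int[mu]_(x in `[s, t]) (N' x * f x + N x * g x).
  rewrite -RintegralB //; apply: eq_Rintegral => x _; rewrite yE /N'; ring.
rewrite [leRHS]addrC; apply: normB_le => //.
apply: le_trans (le_normr_Rintegral _ I2) _ => //.
pose D x := kappa / (1 + y x ^+ 2).
have kappa0 : 0 <= kappa.
  apply: mulr_ge0 => //; apply: mulr_ge0 => //; apply: addr_ge0 => //.
  by apply: mulr_ge0 => //; exact: ltW.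
have cD : continuous D.
  move=> x; apply: cvgM; first exact: cvg_cst.
  apply: cvgV; first by rewrite gt_eqF // (lt_le_trans ltr01).
  apply: cvgD; first exact: cvg_cst.
  by rewrite expr2; apply: cvgM; exact: cy.
have dD (x : R) : is_derive x 1 (fun x => kappa * lam * atan (lam^-1 * x + 0)) (D x).
  have datan : is_derive (y x) 1 atan ((1 + y x ^+ 2)^-1).
    by apply: DeriveDef; [exact: derivable_atan|rewrite -derive1E derive1_atan].
  have d := is_derive_affine datan; derive_eq; rewrite /D; field.
  by rewrite !gt_eqF // (lt_le_trans ltr01).
rewrite (_ : kappa * lam * _ = \int[mu]_(x in `[s, t]) D x); last first.
  by rewrite (segment_integral_derive st cD dD) !yE /y; ring.
apply: le_Rintegral => //; first exact: integrable_norm I2.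
  exact: continuous_integrable_segment.
move=> x _; rewrite /D /kappa.
have [_ n1 _] := comp_le1 (y x).
have e0 := ltW (e_gt0 (y x)).
have E1 : `|N x * g x| <= lam * (c^-1 * ((1 + `|y x|) * e (y x))) * Mg.
  apply: normM_le => //; apply: normM_le; first by rewrite ger0_norm // ltW.
  apply: normM_le; first by rewrite ger0_norm.
  rewrite mulrC; apply: normM_le; last by rewrite ger0_norm.
  by apply: le_trans n1 _; rewrite lerDl.
have E2 : `|rem (y x) * f x| <= c^-1 * ((1 + `|y x|) * e (y x)) * Mf.
  apply: normM_le => //; apply: le_trans (rem_le _) _; rewrite ler_wpM2l //.
  by rewrite ler_wpM2r // lerDr.
apply: le_trans (normD_le E1 E2) _.
rewrite [leLHS](_ : _ = c^-1 * (lam * Mg + Mf) * ((1 + `|y x|) * e (y x))); last by ring.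
rewrite -[leRHS]mulrA ler_wpM2l //.
apply: mulr_ge0 => //; apply: addr_ge0 => //.
by apply: mulr_ge0 => //; exact: ltW.
Qed.

(** The term [2 * Mf] comes from the boundary and pi is the total increment of [atan]. The front
    factor [lam] gives the convergence to 0. *)
Definition oscillation_bound := lam * (c^-1 * K * (2 * Mf + (lam * Mg + Mf) * pi)).

Lemma scaled_improper_integral :
  (exists l, improper_integral (fun x => mj (x / lam) * f x) l /\
     `|l| <= oscillation_bound) /\
  (forall s t, s <= t ->
     `|\int[mu]_(x in `[s, t]) (mj (x / lam) * f x)| <= oscillation_bound).
Proof.
have kl0 : 0 <= kappa * lam.
  have l0 := ltW lam0; apply: mulr_ge0 => //; apply: mulr_ge0 => //.
  by apply: mulr_ge0 => //; apply: addr_ge0 => //; exact: mulr_ge0.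
have pi2 (z : R) : - (pi / 2) < atan z < pi / 2 by rewrite atan_gtNpi2 atan_ltpi2.
pose A := lam * (c^-1 * K).
have A0 : 0 <= A by rewrite mulr_ge0 // ltW.
have total s t : s <= t ->
    `|\int[mu]_(x in `[s, t]) (mj (x / lam) * f x)| <= oscillation_bound.
  move=> st; have N_A x : `|N x| <= A by apply: le_trans (N_le x) _; exact: div_le.
  apply: le_trans (scaled_segment_le st (eta := A) (fun x _ => N_A x)) _.
  have -> : oscillation_bound = 2 * Mf * A + kappa * lam * pi.
    by rewrite /oscillation_bound /A /kappa; ring.
  rewrite lerD2l ler_wpM2l //.
  by have := pi2 (t / lam); have := pi2 (s / lam); lra.
split=> //.
(* The ramp next to the end point [x] starts at [x - 1], hence the shift in the first term; the
   second is the Lorentzian mass beyond [x]. *)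
pose G x := 2 * Mf * (A / (1 + ((x - 1) / lam) ^+ 2))
  + kappa * lam * (pi / 2 - atan (x / lam)).
have A_mono (z w : R) : `|w| <= `|z| -> A / (1 + z ^+ 2) <= A / (1 + w ^+ 2).
  move=> wz; rewrite ler_wpM2l // lef_pV2 ?posrE ?(lt_le_trans ltr01) // lerD2l.
  by rewrite -real_normK ?num_real // -[leRHS]real_normK ?num_real // lerXn2r.
have [||||| l imp le_l] := @improper_integral_of_bounds R
    (fun x => mj (x / lam) * f x) G oscillation_bound.
- move=> s t; rewrite (_ : (fun x => _) = (fun x => mj (y x) * f x)).
    exact: I_f.
  by apply/funext => x; rewrite /y addr0 [lam^-1 * x]mulrC.
- move=> s t s1 st.
  apply: le_trans (scaled_segment_le st (eta := A / (1 + ((s - 1) / lam) ^+ 2)) _) _.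
    move=> x Hx; apply: le_trans (N_le x) _; apply: A_mono.
    have xs : s - 1 <= x by case: Hx => /andP[]; lra.
    rewrite /y addr0 [lam^-1 * x]mulrC !normrM ler_wpM2r //.
    by rewrite !ger0_norm //; lra.
  rewrite /G lerD2l ler_wpM2l //.
  by have := pi2 (t / lam); lra.
- move=> s t t1 st.
  apply: le_trans (scaled_segment_le st (eta := A / (1 + ((- t - 1) / lam) ^+ 2)) _) _.
    move=> x Hx; apply: le_trans (N_le x) _; apply: A_mono.
    have xs : x <= t + 1 by case: Hx => /andP[]; lra.
    rewrite /y addr0 [lam^-1 * x]mulrC !normrM ler_wpM2r //.
    by rewrite ger0_norm ?ler0_norm //; lra.
  rewrite /G lerD2l ler_wpM2l // mulNr atanN.
  by have := pi2 (s / lam); lra.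
- exact: total.
- rewrite -[0]addr0; apply: cvgD.
    rewrite -[0](mulr0 (2 * Mf)); apply: cvgM; first exact: cvg_cst.
    apply: (@cvg0_pinfty_inv _ _ (A * (1 + lam ^+ 2))) => x x1.
    have den (z : R) : 0 < 1 + z ^+ 2 by rewrite (lt_le_trans ltr01).
    rewrite ger0_norm ?divr_ge0 ?(ltW (den _)) //.
    rewrite ler_pdivrMr // mulrAC ler_pdivlMr; last by lra.
    rewrite -[leRHS]mulrA; apply: ler_wpM2l => //.
    rewrite [leRHS](_ : _ = 1 + lam ^+ 2 + (x - 1) ^+ 2 + ((x - 1) / lam) ^+ 2); last first.
      by field; rewrite gt_eqF.
    (* The square gives [2 * (x - 1) <= lam ^+ 2 + ((x - 1) / lam) ^+ 2], which bounds the
       denominator below linearly in [x]. *)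
    have : 0 <= (lam - (x - 1) / lam) ^+ 2 by exact: sqr_ge0.
    rewrite (_ : (lam - _) ^+ 2 = lam ^+ 2 - 2 * (x - 1) + ((x - 1) / lam) ^+ 2);
      last by field; rewrite gt_eqF.
    have := sqr_ge0 (x - 1); lra.
  rewrite -[0](mulr0 (kappa * lam)); apply: cvgM; first exact: cvg_cst.
  rewrite -[0](subrr (pi / 2)); apply: cvgB; first exact: cvg_cst.
  have xlam : x / lam @[x --> +oo] --> +oo.
    by apply: gt0_cvgMly; [rewrite invr_gt0|exact: cvg_id].
  exact: (@cvg_comp _ _ _ (fun x => x / lam) (@atan R) _ _ _ xlam (@cvgy_atan R)).
by exists l.
Qed.

End Scaled.
End Oscillation.

(** * From segments to the whole line *)

Section Vanishing.
Variable R : realType.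
Notation mu := (@lebesgue_measure R).

Lemma ae_eq_integrableM (D : set R) (u f f' : R -> R) : measurable D -> continuous u ->
  measurable_fun setT f -> measurable_fun setT f' -> {ae mu, forall x, f x = f' x} ->
  mu.-integrable D (EFin \o (fun x => u x * f' x)) ->
  mu.-integrable D (EFin \o (fun x => u x * f x)).
Proof.
move=> mD cu mf mf' ff' /integrableP[muf' fin].
have mEu (h : R -> R) : measurable_fun setT h ->
    measurable_fun D (EFin \o (fun x => u x * h x)).
  move=> mh; apply/measurable_EFinP/measurable_funTS/measurable_funM => //.
  exact: continuous_measurable_fun.
apply/integrableP; split; first exact: mEu.
have -> : (\int[mu]_(x in D) `|(u x * f x)%:E| = \int[mu]_(x in D) `|(u x * f' x)%:E|)%E.
  apply: ae_eq_integral => //.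
  - by apply: measurableT_comp => //; exact: mEu.
  - by apply: measurableT_comp => //; exact: mEu.
  - by apply: filterS ff' => [|x /= -> //]; exact: (ae_filter_ringOfSetsType mu).
exact: fin.
Qed.

(** Lets Schwartz functions enter the estimate made for weak derivatives. *)
Lemma weak_derivative_smooth (eta : R -> R) : smooth eta ->
  weak_derivative eta (derive1 eta).
Proof.
move=> seta psi [spsi cpsi].
have deta := derivable_n_is_derive ((smoothP eta).1 seta 1).
have dpsi := derivable_n_is_derive ((smoothP psi).1 spsi 1).
have ceta : continuous eta by move=> x; exact: is_derive_continuous (deta x).
have cpsi0 : continuous psi by move=> x; exact: is_derive_continuous (dpsi x).
have ceta' : continuous (derive1 eta).
  by have [_] := (smoothP eta).1 seta 2; exact: continuous_derivable_n.
have cpsi' : continuous (derive1 psi).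
  by have [_] := (smoothP psi).1 spsi 2; exact: continuous_derivable_n.
have [A psiA] : exists A : R, forall x, A < `|x| -> psi x = 0.
  have /compact_bounded[A0 [_ HA]] := cpsi.
  exists (A0 + 1) => x xA; apply/eqP; apply: contraTT xA => psix; rewrite -leNgt.
  by apply: (HA (A0 + 1)); [rewrite ltrDl|apply: subset_closure].
have psi'A x : A < `|x| -> derive1 psi x = 0.
  move=> xA; rewrite derive1E (near_eq_derive (g := fun=> 0)); first exact: derive_cst.
  near=> z; apply: psiA; near: z.
  by apply: (cvgr_gt `|x|) => //; apply: cvg_norm; exact: cvg_id.
pose B := `|A| + 1.
have B0 : 0 < B by rewrite ltr_wpDl.
have AB : A < B by rewrite /B; have := ler_norm A; lra.
have out x : ~~ (- B <= x <= B) -> A < `|x|.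
  by rewrite -ler_norml -ltNge; exact: lt_trans.
have I1 : mu.-integrable `[- B, B] (EFin \o (fun x => eta x * derive1 psi x)).
  by apply: continuous_integrable_segment => x; apply: cvgM; [exact: ceta|exact: cpsi'].
have I2 : mu.-integrable `[- B, B] (EFin \o (fun x => derive1 eta x * psi x)).
  by apply: continuous_integrable_segment => x; apply: cvgM; [exact: ceta'|exact: cpsi0].
rewrite (@Rintegral_supported _ _ (- B) B); last first.
  by move=> x /out /psi'A ->; rewrite mulr0.
rewrite (@Rintegral_supported _ (fun x => _ * psi x) (- B) B); last first.
  by move=> x /out /psiA ->; rewrite mulr0.
apply/eqP; rewrite -addr_eq0 addrC -RintegralD //; apply/eqP.
have -> : \int[mu]_(x in `[- B, B]) (derive1 eta x * psi x + eta x * derive1 psi x)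
    = eta B * psi B - eta (- B) * psi (- B).
  apply: (segment_integral_derive (F := fun x => eta x * psi x)).
  - by rewrite ge0_cp // ltW.
  - by move=> x; apply: cvgD; apply: cvgM; [exact: ceta'|exact: cpsi0|exact: ceta|
      exact: cpsi'].
  - by move=> x; exact: is_derive_mulf (deta x) (dpsi x).
by rewrite !psiA ?normrN ?(gtr0_norm B0) // !mulr0 subrr.
Unshelve. all: by end_near. Qed.

Lemma integrable_oneDsqrV :
  mu.-integrable setT (EFin \o (fun x : R => (1 + x ^+ 2)^-1)).
Proof.
have c : continuous (fun x : R => (1 + x ^+ 2)^-1) by exact: continuous_oneDsqrV.
have mc : measurable_fun setT (EFin \o (fun x : R => (1 + x ^+ 2)^-1)).
  by apply/measurable_EFinP; exact: continuous_measurable_fun.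
have p (x : R) : 0 <= (1 + x ^+ 2)^-1 by rewrite invr_ge0 addr_ge0 ?sqr_ge0.
apply/integrableP; split => //.
have -> : (\int[mu]_x `|(1 + x ^+ 2)^-1%:E| = \int[mu]_x ((1 + x ^+ 2)^-1)%:E)%E.
  by apply: eq_integral => x _; rewrite /= ger0_norm.
rewrite ge0_symfun_integralT //; last by move=> x /=; rewrite sqrrN.
rewrite -set_itvcy (_ : (\int[_]_(x in _) _)%E = (pi / 2)%:E).
  by rewrite -EFinM ltry.
exact: integral0y_oneDsqr.
Qed.

(** Dominated convergence along the segments from [- n] to [n]. For Schwartz functions it carries
    the bound on segments over to the Lebesgue integral. *)
Lemma norm_Rintegral_le_of_segments (F : R -> R) (K : R) :
  mu.-integrable setT (EFin \o F) ->
  (forall s t, s <= t -> `|\int[mu]_(x in `[s, t]) F x| <= K) ->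
  `|\int[mu]_(x in setT) F x| <= K.
Proof.
move=> IF FK; have [mF _] := integrableP _ _ _ IF.
pose G n x := ((F \_ `[- n%:R, n%:R]) x)%:E.
have mG n : measurable_fun setT (G n).
  apply/measurable_EFinP/(measurable_restrictT _ _).1 => //.
  by apply: measurable_funTS; exact/measurable_EFinP.
have [| | |_ _] := @dominated_convergence _ _ R mu setT measurableT G (EFin \o F)
  (abse \o (EFin \o F)) mG mF.
- apply/aeW => x _; apply: cvg_near_cst; near=> n.
  rewrite /G patchE ifT // inE /= in_itv /= -ler_norml.
  by near: n; exact: nbhs_infty_ger.
- exact: integrable_abse.
- apply/aeW => x n _; rewrite /G patchE; case: ifP => //= _.
  by rewrite normr0 lee_fin.
have GE n : (\int[mu]_x G n x)%E = (\int[mu]_(x in `[- n%:R, n%:R]) F x)%:E.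
  rewrite /Rintegral fineK; last first.
    apply: integrable_fin_num => //; exact: integrableS IF.
  by rewrite [RHS]integral_mkcond restrict_EFin.
rewrite (_ : [sequence _]_n = (fun n => (\int[mu]_(x in `[- n%:R, n%:R]) F x)%:E));
  last by apply/funext => n; exact: GE.
rewrite (_ : (\int[mu]_x _)%E = (\int[mu]_(x in setT) F x)%:E); last first.
  by rewrite /Rintegral fineK //; apply: integrable_fin_num.
move=> /fine_cvgP[_] /= lim; apply/ler_addgt0Pr => eps eps0.
have /cvgrPdist_le/(_ eps eps0) limd := lim.
near \oo => n.
have d : `|\int[mu]_(x in setT) F x - \int[mu]_(x in `[- n%:R, n%:R]) F x| <= eps.
  by near: n; exact: limd.
rewrite -[X in `|X|](subrK (\int[mu]_(x in `[- n%:R, n%:R]) F x)) addrC.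
by apply: normD_le => //; apply: FK; rewrite ge0_cp.
Unshelve. all: by end_near. Qed.

End Vanishing.

(** * Vanishing of the pairings at the blow-up time *)

Section OscillationLimit.
Variables (R : realType) (c alpha : R) (m n b : R -> 'rV[R]_3).
Hypotheses (SF : serret_frenet c alpha m n b) (alpha01 : 0 < alpha <= 1) (c0 : 0 < c).
Notation mu := (@lebesgue_measure R).

Lemma oscillation_bound_cvg0 (Mf Mg T : R) :
  oscillation_bound c alpha (Num.sqrt (T - t)) Mf Mg @[t --> T^'-] --> (0 : R).
Proof.
have ct : continuous (fun t => oscillation_bound c alpha (Num.sqrt (T - t)) Mf Mg).
  have cs : continuous (fun t : R => Num.sqrt (T - t)).
    move=> t; apply: (@cvg_comp _ _ _ (fun t => T - t) Num.sqrt).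
      by apply: cvgB; [exact: cvg_cst|exact: cvg_id].
    exact: sqrt_continuous.
  move=> t; apply: cvgM; first exact: cs.
  apply: cvgM; first exact: cvg_cst.
  apply: cvgD; first exact: cvg_cst.
  apply: cvgM; last exact: cvg_cst.
  by apply: cvgD; [apply: cvgM; [exact: cs|exact: cvg_cst]|exact: cvg_cst].
have -> : (0 : R) = oscillation_bound c alpha (Num.sqrt (T - T)) Mf Mg.
  by rewrite subrr sqrtr0 /oscillation_bound mul0r.
exact: cvg_at_left_filter (ct T).
Qed.

Let cm j (lam : R) : continuous (fun x : R => m (x / lam) 0 j).
Proof.
move=> x; apply: (@cvg_comp _ _ _ (fun x => x / lam) (fun y => m y 0 j)).
  by apply: cvgM; [exact: cvg_id|exact: cvg_cst].
exact: is_derive_continuous (sf_m SF j _).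
Qed.

(** [Mf] and [Mg] are chosen before [lam]: the bound must tend to 0 with [lam] for a fixed
    function. *)
Lemma W1infty_improper_integral (f : R -> R) j : W1infty f ->
  exists Mf Mg, forall lam, 0 < lam -> exists l,
    improper_integral (fun x => m (x / lam) 0 j * f x) l /\
    `|l| <= oscillation_bound c alpha lam Mf Mg.
Proof.
move=> [/Linfty_truncation[mf [f' [Mf [mf' f'M ff']]]]].
move=> [g /Linfty_truncation[mg [g' [Mg [mg' g'M gg']]]] fg].
exists Mf, Mg => lam lam0.
have fg' := weak_derivative_ae mf mf' ff' mg mg' gg' fg.
have [[l [[I lim] l_le]] _] :=
  scaled_improper_integral j SF alpha01 c0 lam0 mf' mg' f'M g'M fg'.
exists l; split=> //; split=> [s t|]; first exact: ae_eq_integrableM ff' (I s t).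
rewrite (_ : (fun ab : R * R => _) =
    (fun ab => \int[mu]_(x in `[ab.1, ab.2]) (m (x / lam) 0 j * f' x))) //.
by apply/funext => ab; exact: ae_eq_RintegralM.
Qed.

Lemma W1infty3_pairing (phi : R -> 'rV[R]_3) (T : R) : W1infty3 phi ->
  exists2 J : R -> R, forall t, t < T ->
    improper_integral (fun x => dot (self_similar m T (x, t)) (phi x)) (J t) &
    J @ T^'- --> (0 : R).
Proof.
move=> Wphi.
have H j := W1infty_improper_integral j (Wphi j).
have [Mf /choice[Mg HM]] := choice H.
have lam0 t : t < T -> 0 < Num.sqrt (T - t) by move=> tT; rewrite sqrtr_gt0 subr_gt0.
have ex (tj : R * 'I_3) : exists l, tj.1 < T ->
    improper_integral (fun x => m (x / Num.sqrt (T - tj.1)) 0 tj.2 * phi x 0 tj.2) l /\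
    `|l| <= oscillation_bound c alpha (Num.sqrt (T - tj.1)) (Mf tj.2) (Mg tj.2).
  (* The choice of a value needs one for every time; 0 is the default from [T] on. *)
  case: tj => t j /=; have [tT|_] := ltP t T; last by exists 0.
  by have [l Hl] := HM j _ (lam0 t tT); exists l.
have [L HL] := choice ex.
exists (fun t => L (t, 0) + L (t, 1) + L (t, 2)).
  move=> t tT; rewrite (_ : (fun x => _) = (fun x =>
      m (x / Num.sqrt (T - t)) 0 0 * phi x 0 0 + m (x / Num.sqrt (T - t)) 0 1 * phi x 0 1
      + m (x / Num.sqrt (T - t)) 0 2 * phi x 0 2)); last first.
    apply/funext => x; rewrite /dot !big_ord_recl big_ord0 addr0 addrA.
    have e1 : lift ord0 (ord0 : 'I_2) = 1 :> 'I_3 by exact: val_inj.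
    have e2 : lift ord0 (lift (ord0 : 'I_2) (ord0 : 'I_1)) = 2 :> 'I_3 by exact: val_inj.
    by rewrite e1 e2.
  have imp j := (HL (t, j) tT).1.
  by apply: improper_integralD; [apply: improper_integralD|]; exact: imp.
have L0 j : L (t, j) @[t --> T^'-] --> (0 : R).
  apply/cvgr0Pnorm_le => eps eps0; near=> t.
  have tT : t < T by near: t; exact: nbhs_left_lt.
  apply: le_trans (HL (t, j) tT).2 _ => /=; apply: le_trans (ler_norm _) _.
  by near: t; apply: cvgr0_norm_le => //; exact: oscillation_bound_cvg0.
by have := cvgD (cvgD (L0 0) (L0 1)) (L0 2); rewrite !addr0; exact.
Unshelve. all: by end_near. Qed.

Lemma tempered_cvg0_self_similar (T : R) :
  tempered_cvg0 (T^'- : set_system R) (fun t x => self_similar m T (x, t)).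
Proof.
move=> j eta [seta dec].
have lam0 t : t < T -> 0 < Num.sqrt (T - t) by move=> tT; rewrite sqrtr_gt0 subr_gt0.
have [M0 eta0] := dec 0%N 0%N; have [M1 eta1] := dec 0%N 1%N; have [M2 eta2] := dec 2%N 0%N.
have eta_le x : `|eta x| <= M0 by have := eta0 x; rewrite expr0 mul1r.
have eta'_le x : `|derive1 eta x| <= M1 by have := eta1 x; rewrite expr0 mul1r.
have D := (smoothP eta).1 seta 2.
have ceta : continuous eta by exact: continuous_derivable_n (derivable_nW D).
have ceta' : continuous (derive1 eta) by have [_] := D; exact: continuous_derivable_n.
(* The seminorms of orders 0 and 2 give an integrable majorant, so a true Lebesgue integral exists,
   unlike for a general [phi]. *)
have decay x : `|eta x| <= `|(M0 + M2) * (1 + x ^+ 2)^-1|.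
  have d0 : 0 < 1 + x ^+ 2 by rewrite ltr_pwDl ?sqr_ge0.
  apply: le_trans (ler_norm _); rewrite ler_pdivlMr // mulrDr mulr1 lerD //.
  by have := eta2 x; rewrite normrM (ger0_norm (sqr_ge0 x)) mulrC.
have m_le y : `|m y 0 j| <= 1.
  have := sf_col SF y j j; rewrite eqxx mulr1n -!expr2 => E.
  rewrite -(@ler_pXn2r _ 2) ?nnegrE // expr1n real_normK ?num_real // -[leRHS]E.
  by rewrite -addrA lerDl addr_ge0 ?sqr_ge0.
have I t : mu.-integrable setT (fun x => (m (x / Num.sqrt (T - t)) 0 j * eta x)%:E).
  have ID := integrableZl measurableT (M0 + M2) (@integrable_oneDsqrV R).
  apply: le_integrable ID => //.
    apply/measurable_EFinP/measurable_funM; last exact: continuous_measurable_fun.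
    exact: (continuous_measurable_fun (@cm j (Num.sqrt (T - t)))).
  move=> x _; rewrite -EFinM /= lee_fin normrM -[leRHS]mul1r.
  by apply: ler_pM.
split; first by apply: nearW => t; exact: I.
apply/cvgr0Pnorm_le => eps eps0; near=> t.
have tT : t < T by near: t; exact: nbhs_left_lt.
have := scaled_improper_integral j SF alpha01 c0 (lam0 t tT)
  (continuous_measurable_fun ceta) (continuous_measurable_fun ceta') eta_le eta'_le
  (weak_derivative_smooth seta).
move=> [_ seg].
apply: le_trans (norm_Rintegral_le_of_segments (I t) seg) _.
apply: le_trans (ler_norm _) _.
by near: t; apply: cvgr0_norm_le => //; exact: oscillation_bound_cvg0.
Unshelve. all: by end_near. Qed.

End OscillationLimit.

Theorem theorem1p3 (R : realType) :
  exists2 C : R, 0 < C &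
  forall (alpha c : R), 0 < alpha <= 1 -> 0 < c ->
  let beta := Num.sqrt (1 - alpha ^+ 2) in
  forall m n b : R -> 'rV[R]_3, serret_frenet c alpha m n b ->
  [/\ (* (i) *)
      forall T : R,
      [/\ Cinfty [set p | p.2 < T] (self_similar m T),
          forall x t : R, t < T -> sphere2 (self_similar m T (x, t)),
          forall x t : R, t < T -> LLG_at alpha beta (self_similar m T) (x, t) &
          forall x t : R, t < T ->
            enorm (dx (self_similar m T) (x, t))
            = c / Num.sqrt (T - t) * expR (alpha * x ^+ 2 / (4 * (T - t)))],
      (* (ii) *)
      forall x : R, [/\ m (- x) 0 0 = m x 0 0,
                        m (- x) 0 1 = - m x 0 1 &
                        m (- x) 0 2 = - m x 0 2],
      exists rho B phi : 'I_3 -> R,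
      [/\ (* (iii) *)
          forall j : 'I_3,
            [/\ 0 <= rho j <= 1, -1 <= B j <= 1, 0 <= phi j < 2 * pi &
                profile_asymptotics C c alpha beta (fun x => m x 0 j)
                  (rho j) (B j) (phi j)],
          [/\ \sum_(j < 3) rho j ^+ 2 = 2,
              \sum_(j < 3) B j ^+ 2 = 1 &
              forall j : 'I_3, rho j ^+ 2 + B j ^+ 2 = 1] &
          (* (iv) *)
          forall (T : R) (j : 'I_3) (x : R),
            (0 < x ->
               (fun t => self_similar m T (x, t) 0 j
                  - rho j * cos (c * Phi alpha (x / Num.sqrt (T - t)) - phi j))
               @ T^'- --> (0 : R)) /\
            (x < 0 ->
               (fun t => self_similar m T (x, t) 0 j
                  - rho_minus rho j
                    * cos (c * Phi alpha (- x / Num.sqrt (T - t)) - phi j))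
               @ T^'- --> (0 : R))] &
      (* (v) *)
      forall T : R,
        (forall phi : R -> 'rV[R]_3, W1infty3 phi ->
           exists2 J : R -> R,
             forall t : R, t < T ->
               improper_integral
                 (fun x => dot (self_similar m T (x, t)) (phi x)) (J t) &
             J @ T^'- --> (0 : R)) /\
        tempered_cvg0 (T^'- : set_system R) (fun t x => self_similar m T (x, t))].
Proof.
exists 24 => // alpha c alpha01 c0 beta m n b SF.
have parity j x := @sf_parity R c alpha m n b SF x j _ erefl.
split.
- by move=> T; exact: self_similar_spec SF alpha01 c0.
- move=> x; have [p0 _ _] := parity 0 x; have [p1 _ _] := parity 1 x.
  by have [p2 _ _] := parity 2 x; rewrite p0 p1 p2 /= !mulN1r mul1r.
- have [rho [B [phi [prof sums]]]] := profile_constants SF alpha01 c0.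
  exists rho, B, phi; split=> // T j x; have [_ _ _ profj] := prof j.
  have parj y : m (- y) 0 j = (if j == 0 then 1 else -1) * m y 0 j.
    by have [] := parity j y.
  have [//|pos neg] := self_similar_cvg T x _ alpha01 parj profj.
  split=> // /neg; rewrite /rho_minus.
  by case: ifP => _; rewrite ?mul1r ?mulN1r.
- by move=> T; split=> [phi|]; [exact: (W1infty3_pairing SF alpha01 c0)|
    exact: (tempered_cvg0_self_similar SF alpha01 c0)].
Qed.
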